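(* Let $k\ge 1$, let $H$ be a subgroup of $\mathbb{Z}^k$, and let $\mathbf{q}:\mathbb{Z}^k\to\mathbb{Z}^k/H$ be the quotient map. Suppose that $\Gamma$ is a $\mathbf{q}(\mathbb{N}^k)$-graph. Then there is an injective C*-homomorphism from $C^*(\mathbf{q}^*\Gamma)$ to $C^*(\Gamma)\otimes C^*(H)$.
   Context: All monoids are finitely generated, cancellative and abelian; a monoid $P$ is regarded as a category with one object. A $P$-graph is a countable small category $\Gamma$ (identified with its set of morphisms) with a functor $d:\Gamma\to P$ satisfying the factorization property: whenever $d(\xi)=p+q$ there are unique $\eta,\zeta\in\Gamma$ with $d(\eta)=p$, $d(\zeta)=q$, $\xi=\eta\zeta$. Write $\Gamma^p=d^{-1}(p)$; $\Gamma^0$ is the vertex set; $r,s:\Gamma\to\Gamma^0$ are the range and source maps ($r(\xi)\xi s(\xi)=\xi$); $v\Gamma^p=\{\xi\in\Gamma^p: r(\xi)=v\}$. All $P$-graphs are assumed row-finite and source-free: $0<|v\Gamma^p|<\infty$ for all $v\in\Gamma^0$, $p\in P$. $C^*(\Gamma)$ is the universal C*-algebra generated by a Cuntz-Krieger $\Gamma$-family $\{s_\lambda:\lambda\in\Gamma\}$, i.e. a family such that: (CK1) $\{s_v:v\in\Gamma^0\}$ are mutually orthogonal projections; (CK2) $s_\mu s_\nu=s_{\mu\nu}$ if $s(\mu)=r(\nu)$; (CK3) $s_\lambda^*s_\lambda=s_{s(\lambda)}$; (CK4) $s_v=\sum_{\lambda\in v\Gamma^p}s_\lambda s_\lambda^*$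 for all $v\in\Gamma^0$, $p\in P$. For a monoid homomorphism $f:P\to Q$ and a $Q$-graph $(\Gamma,d_\Gamma)$, the pullback $f^*\Gamma$ is the $P$-graph $\{(\lambda,p)\in\Gamma\times P: d_\Gamma(\lambda)=f(p)\}$ with $d(\lambda,p)=p$, $s(\lambda,p)=s(\lambda)$, $r(\lambda,p)=r(\lambda)$, and $(\mu,p)(\nu,q)=(\mu\nu,p+q)$ if $s(\mu)=r(\nu)$. Here $\mathbf{q}^*\Gamma$ is the pullback via the restriction $\mathbf{q}:\mathbb{N}^k\to\mathbf{q}(\mathbb{N}^k)$, an $\mathbb{N}^k$-graph. $C^*(H)$ is the group C*-algebra of $H$ (abelian, so the choice of C*-tensor product does not matter). *)

(* Defs.v *)
From HB Require Import structures.
From mathcomp Require Import all_boot all_order all_algebra.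
From mathcomp Require Import ring_quotient complex.
From mathcomp Require Import all_classical all_reals all_analysis.

Set Implicit Arguments.
Unset Strict Implicit.
Unset Printing Implicit Defensive.

Import Order.TTheory GRing.Theory Num.Theory.
Import numFieldNormedType.Exports.
Local Open Scope classical_set_scope.
Local Open Scope quotient_scope.
Local Open Scope ring_scope.

(* Complex C*-algebras, with or without unit.  The library's ring structures
   are all unital, hence the separate product. *)
HB.mixin Record isCStarAlgebra (R : realType) A
    of CompleteNormedModule R[i] A := {
  cmul : A -> A -> A;
  star : A -> A;
  cmulA : forall a b c, cmul a (cmul b c) = cmul (cmul a b) c;
  cmulDl : forall a b c, cmul (a + b) c = cmul a c + cmul b c;
  cmulDr : forall a b c, cmul a (b + c) = cmul a b + cmul a c;
  cmulZl : forall (z : R[i]) a b, cmul (z *: a) b = z *: cmul a b;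
  cmulZr : forall (z : R[i]) a b, cmul a (z *: b) = z *: cmul a b;
  starK : forall a, star (star a) = a;
  starD : forall a b, star (a + b) = star a + star b;
  starZ : forall (z : R[i]) a, star (z *: a) = z^* *: star a;
  starM : forall a b, star (cmul a b) = cmul (star b) (star a);
  normM_le : forall a b, `|cmul a b| <= `|a| * `|b|;
  cstar_identity : forall a, `|cmul (star a) a| = `|a| ^+ 2
}.

#[short(type="cstarAlgType")]
HB.structure Definition CStarAlgebra (R : realType) :=
  {A of isCStarAlgebra R A & CompleteNormedModule R[i] A}.

Notation "a ** b" := (cmul a b) (at level 40, left associativity) : ring_scope.

Definition star_hom (R : realType) (A B : cstarAlgType R) (f : A -> B) : Prop :=
  [/\ linear f,
      forall a b, f (a ** b) = f a ** f b
    & forall a, f (star a) = star (f a)].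

(* A small category identified with its set of morphisms: [rng] and [src] send
   a morphism to the identity morphism at its range and source.  [compose] is
   total, but only its values on pairs with [src x = rng y] carry meaning.
   Only row-finite and source-free P-graphs are considered. *)
Record pgraph (P : nmodType) := PGraph {
  mor :> countType;
  deg : mor -> P;
  rng : mor -> mor;
  src : mor -> mor;
  compose : mor -> mor -> mor;
  rng_rng : forall x, rng (rng x) = rng x;
  src_rng : forall x, src (rng x) = rng x;
  rng_src : forall x, rng (src x) = src x;
  src_src : forall x, src (src x) = src x;
  rng_comp : forall x y, src x = rng y -> rng (compose x y) = rng x;
  src_comp : forall x y, src x = rng y -> src (compose x y) = src y;
  comp_rng : forall x, compose (rng x) x = x;
  comp_src : forall x, compose x (src x) = x;
  composeA : forall x y z, src x = rng y -> src y = rng z ->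
    compose x (compose y z) = compose (compose x y) z;
  deg_rng : forall x, deg (rng x) = 0;
  deg_src : forall x, deg (src x) = 0;
  deg_comp : forall x y, src x = rng y -> deg (compose x y) = deg x + deg y;
  factorization : forall x p q, deg x = p + q ->
    exists! yz : mor * mor,
      [/\ src yz.1 = rng yz.2, deg yz.1 = p, deg yz.2 = q
        & x = compose yz.1 yz.2];
  row_finite : forall (v : mor) (p : P), deg v = 0 ->
    finite_set [set x | rng x = v /\ deg x = p];
  source_free : forall (v : mor) (p : P), deg v = 0 ->
    [set x | rng x = v /\ deg x = p] !=set0
}.

Arguments deg {P _}.
Arguments rng {P _}.
Arguments src {P _}.
Arguments compose {P _}.

(* The vertex set is the set of morphisms of degree 0; by the factorization
   property these are exactly the identity morphisms. *)
Definition vertices (P : nmodType) (G : pgraph P) : set G :=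
  [set v | deg v = 0].

Definition paths_from (P : nmodType) (G : pgraph P) (v : G) (p : P) : set G :=
  [set x | rng x = v /\ deg x = p].

Section Pullback.
Variables (P : countNmodType) (Q : nmodType) (f : {additive P -> Q}).
Variable G : pgraph Q.

Definition pullback_mor := {x : G * P | deg x.1 == f x.2}.
Implicit Types x y z : pullback_mor.

Lemma pullback_degP x : deg (val x).1 = f (val x).2.
Proof. exact/eqP/(valP x). Qed.

Definition pullback_deg x : P := (val x).2.

Fact pullback_rng_subproof x : deg (rng (val x).1) == f 0.
Proof. by rewrite deg_rng raddf0. Qed.
Definition pullback_rng x : pullback_mor :=
  exist _ (rng (val x).1, 0) (pullback_rng_subproof x).

Fact pullback_src_subproof x : deg (src (val x).1) == f 0.
Proof. by rewrite deg_src raddf0. Qed.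
Definition pullback_src x : pullback_mor :=
  exist _ (src (val x).1, 0) (pullback_src_subproof x).

(* [insubd x] returns its default [x] only when the pair is not composable,
   see [val_pullback_comp]. *)
Definition pullback_comp x y : pullback_mor :=
  insubd x (compose (val x).1 (val y).1, (val x).2 + (val y).2).

Lemma pullback_composable x y :
  pullback_src x = pullback_rng y <-> src (val x).1 = rng (val y).1.
Proof.
split=> [/(congr1 val) /= [] // | e].
by apply: val_inj; rewrite /= e.
Qed.

Lemma val_pullback_comp x y : src (val x).1 = rng (val y).1 ->
  val (pullback_comp x y) =
    (compose (val x).1 (val y).1, (val x).2 + (val y).2).
Proof.
move=> e; rewrite /pullback_comp val_insubd /=.
by rewrite deg_comp // !pullback_degP raddfD eqxx.
Qed.

Fact pullback_rng_rng x : pullback_rng (pullback_rng x) = pullback_rng x.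
Proof. by apply: val_inj; rewrite /= rng_rng. Qed.
Fact pullback_src_rng x : pullback_src (pullback_rng x) = pullback_rng x.
Proof. by apply: val_inj; rewrite /= src_rng. Qed.
Fact pullback_rng_src x : pullback_rng (pullback_src x) = pullback_src x.
Proof. by apply: val_inj; rewrite /= rng_src. Qed.
Fact pullback_src_src x : pullback_src (pullback_src x) = pullback_src x.
Proof. by apply: val_inj; rewrite /= src_src. Qed.

Fact pullback_rng_comp x y : pullback_src x = pullback_rng y ->
  pullback_rng (pullback_comp x y) = pullback_rng x.
Proof.
move=> /pullback_composable e; apply: val_inj => /=.
by rewrite val_pullback_comp //= rng_comp.
Qed.

Fact pullback_src_comp x y : pullback_src x = pullback_rng y ->
  pullback_src (pullback_comp x y) = pullback_src y.
Proof.
move=> /pullback_composable e; apply: val_inj => /=.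
by rewrite val_pullback_comp //= src_comp.
Qed.

Fact pullback_comp_rng x : pullback_comp (pullback_rng x) x = x.
Proof.
apply: val_inj; rewrite val_pullback_comp /= ?src_rng //.
by rewrite comp_rng add0r -surjective_pairing.
Qed.

Fact pullback_comp_src x : pullback_comp x (pullback_src x) = x.
Proof.
apply: val_inj; rewrite val_pullback_comp /= ?rng_src //.
by rewrite comp_src addr0 -surjective_pairing.
Qed.

Fact pullback_compA x y z :
  pullback_src x = pullback_rng y -> pullback_src y = pullback_rng z ->
  pullback_comp x (pullback_comp y z) = pullback_comp (pullback_comp x y) z.
Proof.
move=> /pullback_composable e1 /pullback_composable e2; apply: val_inj.
rewrite !val_pullback_comp //=; first by rewrite composeA // addrA.
  by rewrite src_comp.
by rewrite rng_comp.
Qed.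

Fact pullback_deg_rng x : pullback_deg (pullback_rng x) = 0.
Proof. by []. Qed.
Fact pullback_deg_src x : pullback_deg (pullback_src x) = 0.
Proof. by []. Qed.
Fact pullback_deg_comp x y : pullback_src x = pullback_rng y ->
  pullback_deg (pullback_comp x y) = pullback_deg x + pullback_deg y.
Proof.
by move=> /pullback_composable e; rewrite /pullback_deg val_pullback_comp.
Qed.

Fact pullback_factorization x p q : pullback_deg x = p + q ->
  exists! yz : pullback_mor * pullback_mor,
    [/\ pullback_src yz.1 = pullback_rng yz.2, pullback_deg yz.1 = p,
        pullback_deg yz.2 = q & x = pullback_comp yz.1 yz.2].
Proof.
move=> dx; have := pullback_degP x; rewrite -/(pullback_deg x) dx raddfD.
move=> /factorization [[y z]] /= [[yz dy dz xyz] uniq_yz].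
have hy : deg (y, p).1 == f (y, p).2 by rewrite dy.
have hz : deg (z, q).1 == f (z, q).2 by rewrite dz.
exists (exist _ (y, p) hy, exist _ (z, q) hz); split.
  split=> //=; first exact/pullback_composable.
  apply: val_inj; rewrite val_pullback_comp //= -xyz -dx.
  exact: surjective_pairing.
move=> [y' z'] /= [/pullback_composable yz' dy' dz' xyz'].
have /(uniq_yz (_, _)) [e1 e2] : [/\ src (val y').1 = rng (val z').1,
    deg (val y').1 = f p, deg (val z').1 = f q
    & (val x).1 = compose (val y').1 (val z').1].
  split=> //=; rewrite ?pullback_degP; [by rewrite -dy'|by rewrite -dz'|].
  by rewrite xyz' val_pullback_comp.
congr pair; apply: val_inj => /=.
  by rewrite e1 -dy' -surjective_pairing.
by rewrite e2 -dz' -surjective_pairing.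
Qed.

Lemma pullback_deg0 x : pullback_deg x = 0 -> deg (val x).1 = 0.
Proof. by rewrite /pullback_deg pullback_degP => ->; rewrite raddf0. Qed.

Fact pullback_row_finite x p : pullback_deg x = 0 ->
  finite_set [set y | pullback_rng y = x /\ pullback_deg y = p].
Proof.
move=> /pullback_deg0 /(row_finite (f p)) fin.
apply: sub_finite_set (finite_image (fun g => insubd x (g, p)) fin) => y.
move=> [<- dy]; exists (val y).1; first by split=> //=; rewrite pullback_degP -dy.
by rewrite -dy -surjective_pairing valKd.
Qed.

Fact pullback_source_free x p : pullback_deg x = 0 ->
  [set y | pullback_rng y = x /\ pullback_deg y = p] !=set0.
Proof.
move=> dx; have [y [ry dy]] := source_free (f p) (pullback_deg0 dx).
have hy : deg (y, p).1 == f (y, p).2 by rewrite dy.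
exists (exist _ (y, p) hy); split=> //; apply: val_inj.
by rewrite /= ry -dx -surjective_pairing.
Qed.

Definition pullback : pgraph P :=
  PGraph pullback_rng_rng pullback_src_rng pullback_rng_src pullback_src_src
    pullback_rng_comp pullback_src_comp pullback_comp_rng pullback_comp_src
    pullback_compA pullback_deg_rng pullback_deg_src pullback_deg_comp
    pullback_factorization pullback_row_finite pullback_source_free.

End Pullback.

HB.instance Definition _ := Countable.on nat.
HB.instance Definition _ (k : nat) := Countable.on 'rV[nat]_k.

Section Image.
Variables (P Q : nmodType) (f : {additive P -> Q}).

Definition image_pred : {pred Q} := fun y => `[< exists x, y = f x >].

Fact image_nmod_closed : Algebra.nmod_closed image_pred.
Proof.
split; first by apply/asboolP; exists 0; rewrite raddf0.
move=> _ _ /asboolP[x ->] /asboolP[y ->].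
by apply/asboolP; exists (x + y); rewrite raddfD.
Qed.
HB.instance Definition _ := GRing.isAddClosed.Build Q image_pred
  image_nmod_closed.

Record image_monoid :=
  ImageMonoid { image_val : Q; _ : image_val \in image_pred }.
HB.instance Definition _ := [isSub of image_monoid for image_val].
HB.instance Definition _ := [Choice of image_monoid by <:].
HB.instance Definition _ := GRing.SubChoice_isSubNmodule.Build Q image_pred
  image_monoid image_nmod_closed.

Fact corestrict_subproof x : f x \in image_pred.
Proof. by apply/asboolP; exists x. Qed.
Definition corestrict (x : P) : image_monoid :=
  ImageMonoid (corestrict_subproof x).

Fact corestrict_is_nmod_morphism : nmod_morphism corestrict.
Proof.
by split=> [|x y]; apply: val_inj; rewrite /= ?raddf0 ?raddfD.
Qed.
HB.instance Definition _ := GRing.isNmodMorphism.Build P image_monoid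
  corestrict corestrict_is_nmod_morphism.
End Image.

Section Quotient.
Variables (k : nat) (H : zmodClosed 'rV[int]_k).

(* The composite N^k -> Z^k -> Z^k / H; [Quotient.quot H] only uses the
   additive structure. *)
Definition quot_Nk : {additive 'rV[nat]_k -> Quotient.quot H} :=
  \pi_(Quotient.quot H) \o map_mx Posz.

Definition qNk : nmodType := image_monoid quot_Nk.
Definition q_Nk : {additive 'rV[nat]_k -> qNk} := corestrict quot_Nk.
End Quotient.

Section Subgroup.
Variables (V : zmodType) (H : zmodClosed V).

Record subgroup := Subgroup { subgroup_val : V; _ : subgroup_val \in H }.
HB.instance Definition _ := [isSub of subgroup for subgroup_val].
HB.instance Definition _ := [Choice of subgroup by <:].
HB.instance Definition _ := [SubChoice_isSubZmodule of subgroup by <:].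
End Subgroup.

Section Universal.
Variable R : realType.
Implicit Types A B C D T : cstarAlgType R.

Definition cuntz_krieger (P : nmodType) (G : pgraph P) A (s : G -> A) : Prop :=
  [/\ (forall v, vertices v -> star (s v) = s v /\ s v ** s v = s v) /\
        (forall v w : G, vertices v -> vertices w -> v <> w ->
          s v ** s w = 0),
      forall x y, src x = rng y -> s x ** s y = s (compose x y),
      forall x, star (s x) ** s x = s (src x)
    & forall v p, vertices v ->
        s v = \sum_(x \in paths_from v p) (s x ** star (s x))].

(* [A] is C*(G) with canonical generators [s].  Uniqueness of [phi] forces [A]
   to be generated by [s]: map [A] into the C*-subalgebra generated by [s] by
   the universal property; followed by the inclusion this is the identity. *)
Definition graph_cstar (P : nmodType) (G : pgraph P) A (s : G -> A) : Prop :=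
  cuntz_krieger s /\
  forall D (t : G -> D), cuntz_krieger t ->
    exists! phi : A -> D, star_hom phi /\ forall x, phi (s x) = t x.

(* [u 0] is required to be a two-sided unit of [D], so that [D] is unital and
   the homomorphisms below preserve units. *)
Definition unitary_rep (K : zmodType) D (u : K -> D) : Prop :=
  [/\ forall a, u 0 ** a = a /\ a ** u 0 = a,
      forall g h, u (g + h) = u g ** u h
    & forall g, star (u g) ** u g = u 0 /\ u g ** star (u g) = u 0].

Definition group_cstar (K : zmodType) C (u : K -> C) : Prop :=
  unitary_rep u /\
  forall D (w : K -> D), unitary_rep w ->
    exists! phi : C -> D, star_hom phi /\ forall g, phi (u g) = w g.

(* These maps are the *-homomorphisms from the algebraic tensor product of [B]
   and [C] to [D]. *)
Definition star_bilinear B C D (beta : B -> C -> D) : Prop :=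
  [/\ forall b, linear (beta b),
      forall c, linear (beta^~ c),
      forall b b' c c', beta (b ** b') (c ** c') = beta b c ** beta b' c'
    & forall b c, beta (star b) (star c) = star (beta b c)].

(* The maximal C*-tensor product.  It is the only C*-tensor product as soon as
   [B] or [C] is nuclear, e.g. when [C] is the C*-algebra of an abelian group. *)
Definition cstar_tensor B C T (tens : B -> C -> T) : Prop :=
  star_bilinear tens /\
  forall D (beta : B -> C -> D), star_bilinear beta ->
    exists! phi : T -> D,
      star_hom phi /\ forall b c, phi (tens b c) = beta b c.

End Universal.

(* Main.v *)
(* Choose a homomorphism x |-> x K from Z^k into H that is multiplication by
   some N > 0 on H (a multiple of a rational projection).  Then
   s_(l, p) |-> t_l (x) u_(p K) is a Cuntz-Krieger family, which gives
   phi : C*(q^* Gamma) -> C*(Gamma) (x) C*(H).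

   For injectivity no gauge-invariant uniqueness theorem is needed: phi has a
   left inverse up to enlarging the codomain.  For x in H the strictly
   convergent sums U_x of the s_(l, p) s_(l, b)^* with p - b = x are commuting
   unitary multipliers of A = C*(q^* Gamma) that commute with A, and
   s_(l, p) = U_(p - b) s_(l, b).  Suppose that A acts, with a given a <> 0 not
   acting as 0, on some D together with a commuting unitary representation v of
   Z^k such that v_(N x) = U_x on H.  Then v_(p K)^* s_(l, p) depends only on l;
   these elements and v restricted to H give a homomorphism Psi from the tensor
   product such that Psi \o phi is the action of A, so phi a <> 0.

   To extend v from N H to Z^k, one needs m-th roots of a central unitary U.
   With X = - U or X = U, the binomial series gives g with g^m = 1 - X =
   - X (g^m)^*, so the phase of g is a root of - X on the ideal where
   X has no fixed vector; for one choice of the sign, a still acts nontrivially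
   on that ideal, because (1 + U) + (1 - U) = 2. *)
Require Import Defs.
From HB Require Import structures.
From mathcomp Require Import all_boot all_order all_algebra.
From mathcomp Require Import ring_quotient complex.
From mathcomp Require Import all_classical all_reals all_analysis.
From mathcomp Require Import zify ring lra.

Set Implicit Arguments.
Unset Strict Implicit.
Unset Printing Implicit Defensive.

Import Order.TTheory GRing.Theory Num.Theory.
Import numFieldNormedType.Exports.
Local Open Scope classical_set_scope.
Local Open Scope ring_scope.

(** * Real-valued norms and sequences *)

(** Why [K] and why roots: C*(Gamma) sees a degree p only modulo H, so the second tensor factor has
    to remember the lost part. A homomorphism from Z^k to H that is the identity on H would do this
    with no further work, but it exists only if Z^k / H is torsion-free. Clearing denominators
    always works; the price is the factor N, which has to be undone in the left inverse.

    A unitary need not have any root among the multipliers of the algebra it lives in (think of the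
    coordinate function on the circle), so the algebra itself must change. The new representation
    may have a kernel: injectivity only asks that one prescribed nonzero element survive, and the
    representation is chosen after that element.

    Multipliers appear because a graph algebra with infinitely many vertices has no unit.
    Positivity, functional calculus and polar decomposition are replaced throughout by the
    C*-identity and norm limits. This matters at once for (CK4), which does not say that the range
    projections in the sum are orthogonal: that is derived from a random-walk estimate. *)

Section RealNorm.
Variable R : realType.

(** Norms have values in [R[i]]; their real parts give access to suprema and to linear
    arithmetic. *)
Definition nm (X : normedModType R[i]) (x : X) : R := complex.Re `|x|.

Section NormedModule.
Variable X : normedModType R[i].
Implicit Types (x y z : X) (u v : nat -> X).

Lemma normE x : `|x| = (nm x)%:C%C.
Proof. by rewrite /nm RRe_real // ger0_real. Qed.

Lemma nm_ge0 x : 0 <= nm x.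
Proof. by have := normr_ge0 x; rewrite normE lecR. Qed.

Lemma nm0 : nm (0 : X) = 0.
Proof. by rewrite /nm normr0. Qed.

Lemma nm_eq0 x : nm x = 0 -> x = 0.
Proof. by move=> e; apply/eqP; rewrite -normr_eq0 normE e. Qed.

Lemma nmN x : nm (- x) = nm x.
Proof. by rewrite /nm normrN. Qed.

Lemma nmC x y : nm (x - y) = nm (y - x).
Proof. by rewrite -nmN opprB. Qed.

Lemma nmD x y : nm (x + y) <= nm x + nm y.
Proof. by have := ler_normD x y; rewrite !normE -rmorphD lecR. Qed.

Lemma nm_tri z x y : nm (x - y) <= nm (x - z) + nm (z - y).
Proof. by rewrite -[x - y](subrKA z) nmD. Qed.

Lemma nmZ (c : R[i]) x : nm (c *: x) = complex.Re `|c| * nm x.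
Proof.
have e : `|c| = (complex.Re `|c|)%:C%C by rewrite RRe_real // ger0_real.
by rewrite {1}/nm normrZ e normE -rmorphM.
Qed.

Lemma nmZ_real (c : R) x : 0 <= c -> nm (c%:C%C *: x) = c * nm x.
Proof. by move=> c0; rewrite nmZ ger0_norm // lecR. Qed.

Lemma nm_le_eps x : (forall e : R, 0 < e -> nm x <= e) -> x = 0.
Proof.
move=> h; apply: nm_eq0; apply/eqP; rewrite eq_le nm_ge0 andbT.
by apply/ler_addgt0Pr => e e0; rewrite add0r h.
Qed.

Lemma nm_sum I (r : seq I) (P : pred I) (F : I -> X) :
  nm (\sum_(i <- r | P i) F i) <= \sum_(i <- r | P i) nm (F i).
Proof.
elim/big_rec2: _ => [|i a b _ h]; first by rewrite nm0.
by apply: le_trans (nmD _ _) _; rewrite lerD2l.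
Qed.

(** Sequences suffice for every limit below; [cvg_cvs], [csq_cvs] and [complete_of_csq] are the
    bridges to filters. *)
Definition cvs u x := forall e : R, 0 < e ->
  exists N, forall n, (N <= n)%N -> nm (u n - x) < e.

Definition csq u := forall e : R, 0 < e ->
  exists N, forall n p, (N <= n)%N -> (N <= p)%N -> nm (u n - u p) < e.

Lemma cvs_cst x : cvs (fun=> x) x.
Proof. by move=> e e0; exists 0%N => n _; rewrite subrr nm0. Qed.

Lemma cvs_ev u v x : (exists N, forall n, (N <= n)%N -> u n = v n) ->
  cvs u x -> cvs v x.
Proof.
move=> [N uv] ux e /ux [M h]; exists (maxn N M) => n.
by rewrite geq_max => /andP[Nn Mn]; rewrite -uv // h.
Qed.

Lemma cvsD u v x y : cvs u x -> cvs v y -> cvs (fun n => u n + v n) (x + y).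
Proof.
move=> ux vy e e0; have e2 : 0 < e / 2 by lra.
have [N hN] := ux _ e2; have [M hM] := vy _ e2.
exists (maxn N M) => n; rewrite geq_max => /andP[/hN h1 /hM h2].
rewrite opprD addrACA; have := nmD (u n - x) (v n - y); lra.
Qed.

Lemma cvs_unique u x y : cvs u x -> cvs u y -> x = y.
Proof.
move=> ux uy; apply/eqP; rewrite -subr_eq0; apply/eqP.
apply: nm_le_eps => e e0; have e2 : 0 < e / 2 by lra.
have [N hN] := ux _ e2; have [M hM] := uy _ e2.
have h1 := hN (maxn N M) (leq_maxl _ _).
have h2 := hM (maxn N M) (leq_maxr _ _).
by have := nm_tri (u (maxn N M)) x y; rewrite (nmC x (u _)); lra.
Qed.

Lemma cvs_csq u x : cvs u x -> csq u.
Proof.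
move=> ux e e0; have e2 : 0 < e / 2 by lra.
have [N hN] := ux _ e2; exists N => n p /hN h1 /hN h2.
by have := nm_tri x (u n) (u p); rewrite (nmC x); lra.
Qed.

Lemma cvs_le_cst u x (M : R) : (forall n, nm (u n) <= M) -> cvs u x -> nm x <= M.
Proof.
move=> uM ux; apply/ler_addgt0Pr => e /ux [N /(_ N (leqnn _)) h].
have := nm_tri (u N) x 0; rewrite !subr0 nmC.
by have := uM N; lra.
Qed.

End NormedModule.

Lemma cvs_lipschitz (X Y : normedModType R[i]) (f : X -> Y) (M : R) :
  (forall x y, nm (f x - f y) <= M * nm (x - y)) ->
  forall u x, cvs u x -> cvs (f \o u) (f x).
Proof.
move=> fM u x ux e e0; have M1 : 0 < 1 + `|M| by rewrite ltr_pwDl.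
have [N hN] := ux (e / (1 + `|M|)) (divr_gt0 e0 M1).
exists N => n /hN; rewrite ltr_pdivlMr // => h.
apply: le_lt_trans (fM _ _) _; apply: le_lt_trans h; rewrite mulrC.
by apply: ler_wpM2l; rewrite ?nm_ge0 //; have := ler_norm M; lra.
Qed.

Lemma cvs0_dominated (Y Z : normedModType R[i]) (u : nat -> Y) (v : nat -> Z) (M : R) :
  (forall n, nm (v n) <= M * nm (u n)) -> cvs u 0 -> cvs v 0.
Proof.
move=> vu uc e e0; have M1 : 0 < 1 + `|M| by rewrite ltr_pwDl.
have [N hN] := uc (e / (1 + `|M|)) (divr_gt0 e0 M1).
exists N => n /hN; rewrite !subr0 ltr_pdivlMr // => h.
apply: le_lt_trans (vu _) _; apply: le_lt_trans h; rewrite mulrC.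
by apply: ler_wpM2l; rewrite ?nm_ge0 //; have := ler_norm M; lra.
Qed.

Lemma csq_dominated (X Y : normedModType R[i]) (u : nat -> X) (v : nat -> Y) (M : R) :
  (forall n p, nm (v n - v p) <= M * nm (u n - u p)) -> csq u -> csq v.
Proof.
move=> vu uc e e0; have M1 : 0 < 1 + `|M| by rewrite ltr_pwDl.
have [N hN] := uc (e / (1 + `|M|)) (divr_gt0 e0 M1).
exists N => n p Nn Np; have := hN n p Nn Np; rewrite ltr_pdivlMr // => h.
apply: le_lt_trans (vu _ _) _; apply: le_lt_trans h; rewrite mulrC.
by apply: ler_wpM2l; rewrite ?nm_ge0 //; have := ler_norm M; lra.
Qed.

Lemma csqD (X : normedModType R[i]) (u v : nat -> X) :
  csq u -> csq v -> csq (fun n => u n + v n).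
Proof.
move=> uc vc e e0; have e2 : 0 < e / 2 by lra.
have [N hN] := uc _ e2; have [M hM] := vc _ e2.
exists (maxn N M) => n p; rewrite !geq_max => /andP[n1 n2] /andP[p1 p2].
have := hN _ _ n1 p1; have := hM _ _ n2 p2.
by rewrite opprD addrACA; have := nmD (u n - u p) (v n - v p); lra.
Qed.

Lemma csq_sum (X : normedModType R[i]) I (r : seq I) (u : I -> nat -> X) :
  (forall i, csq (u i)) -> csq (fun n => \sum_(i <- r) u i n).
Proof.
move=> uc; elim: r => [|i r IH].
  apply: (@cvs_csq _ _ 0); apply: cvs_ev (cvs_cst _).
  by exists 0%N => n _; rewrite big_nil.
by under eq_fun do rewrite big_cons; apply: csqD.
Qed.

Lemma cvg_cvs (X : normedModType R[i]) (u : nat -> X) x :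
  u @ \oo --> x -> cvs u x.
Proof.
move=> ux e e0; move/cvgrPdist_lt : ux => /(_ (e%:C%C)).
rewrite ltcR => /(_ e0)[N _ hN]; exists N => n /hN /=.
by rewrite normE ltcR nmC.
Qed.

Lemma csq_cvs (X : completeNormedModType R[i]) (u : nat -> X) :
  csq u -> exists x, cvs u x.
Proof.
move=> uc; have /cauchy_cvg/cvg_ex[x] : cauchy (u @ \oo).
  apply/cauchy_ballP => e e0.
  have er : e = (complex.Re e)%:C%C by rewrite RRe_real // gtr0_real.
  have : 0 < complex.Re e by rewrite -ltcR -er.
  move=> /uc[N hN].
  exists (u @` [set n | (N <= n)%N], u @` [set n | (N <= n)%N]) => /=.
    by split; exists N => // n /= Nn; exists n.
  move=> [a b] /= [[n Nn <-] [p Np <-]].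
  by rewrite -ball_normE /= normE er ltcR hN.
by move=> /cvg_cvs ux; exists x.
Qed.

(** Pick [u n] such that its ball of radius 1/(n+1) belongs to the filter. Two members of a filter
    meet, so [u] is Cauchy, and its limit is a limit of the filter. *)
Lemma complete_of_csq (X : normedModType R[i]) :
  (forall u : nat -> X, csq u -> exists x, cvs u x) ->
  forall F : set_system X, ProperFilter F -> cauchy F -> cvg F.
Proof.
move=> h F FF /cauchy_ballP Fc.
have ex n : exists y : X, F (ball y ((n.+1%:R^-1 : R)%:C%C)).
  have /Fc[[P Q] /= [FP FQ] PQ] : 0 < ((n.+1%:R^-1 : R)%:C%C).
    by rewrite ltcR invr_gt0 ltr0n.
  have [y Py] := filter_ex FP; exists y.
  by apply: filterS FQ => z Qz; apply: (PQ (y, z)).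
have {ex}[u hu] := choice ex.
have inve (e : R) : 0 < e -> exists N, forall n, (N <= n)%N -> n.+1%:R^-1 < e.
  move=> e0; exists (Num.truncn e^-1) => n Nn.
  rewrite invf_plt ?posrE ?ltr0n //.
  apply: lt_le_trans (truncnS_gt _) _.
  by rewrite ler_nat ltnS.
have ub (e : R) : 0 < e -> exists N, forall n, (N <= n)%N ->
    forall z, ball (u n) ((n.+1%:R^-1 : R)%:C%C) z -> nm (u n - z) < e.
  move=> /inve[N hN]; exists N => n /hN h1 z.
  by rewrite -ball_normE /= normE ltcR => h2; apply: lt_trans h2 h1.
have /h[x ux] : csq u.
  move=> e e0; have e2 : 0 < e / 2 by lra.
  have [N hN] := ub _ e2; exists N => n p Nn Np.
  have [z [z1 z2]] := filter_ex (filterI (hu n) (hu p)).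
  have := hN n Nn z z1; have := hN p Np z z2.
  by have := nm_tri z (u n) (u p); rewrite (nmC z (u p)); lra.
apply/cvg_ex; exists x; apply/cvgrPdist_lt => e e0.
have er : e = (complex.Re e)%:C%C by rewrite RRe_real // gtr0_real.
have e2 : 0 < complex.Re e / 2 by rewrite divr_gt0 // -ltcR -er.
have [N hN] := ub _ e2; have [M hM] := ux _ e2.
apply: filterS (hu (maxn N M)) => z /(hN _ (leq_maxl _ _)).
have := hM _ (leq_maxr N M); rewrite nmC normE er ltcR.
by have := nm_tri (u (maxn N M)) x z; lra.
Qed.

End RealNorm.

(** * Algebra and norm estimates from the C*-identity, without a unit *)

Section CStarBasics.
Variable R : realType.

Section Algebra.
Variable A : cstarAlgType R.
Implicit Types (a b c : A) (u v : nat -> A).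

Lemma cmul0l a : 0 ** a = 0.
Proof. by apply: (addrI (0 ** a)); rewrite -cmulDl !addr0. Qed.

Lemma cmul0r a : a ** 0 = 0.
Proof. by apply: (addrI (a ** 0)); rewrite -cmulDr !addr0. Qed.

Lemma cmulNl a b : (- a) ** b = - (a ** b).
Proof. by apply/eqP; rewrite -addr_eq0 -cmulDl addNr cmul0l. Qed.

Lemma cmulNr a b : a ** (- b) = - (a ** b).
Proof. by apply/eqP; rewrite -addr_eq0 -cmulDr addNr cmul0r. Qed.

Lemma cmulBl a b c : (a - b) ** c = a ** c - b ** c.
Proof. by rewrite cmulDl cmulNl. Qed.

Lemma cmulBr a b c : a ** (b - c) = a ** b - a ** c.
Proof. by rewrite cmulDr cmulNr. Qed.

Lemma cmul_suml I (r : seq I) (P : pred I) (F : I -> A) a :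
  (\sum_(i <- r | P i) F i) ** a = \sum_(i <- r | P i) F i ** a.
Proof.
by elim/big_rec2: _ => [|i x y _ <-]; rewrite ?cmul0l ?cmulDl.
Qed.

Lemma cmul_sumr I (r : seq I) (P : pred I) (F : I -> A) a :
  a ** (\sum_(i <- r | P i) F i) = \sum_(i <- r | P i) a ** F i.
Proof.
by elim/big_rec2: _ => [|i x y _ <-]; rewrite ?cmul0r ?cmulDr.
Qed.

Lemma star0 : star (0 : A) = 0.
Proof. by apply: (addrI (star 0)); rewrite -starD !addr0. Qed.

Lemma starN a : star (- a) = - star a.
Proof. by apply/eqP; rewrite -addr_eq0 -starD addNr star0. Qed.

Lemma starB a b : star (a - b) = star a - star b.
Proof. by rewrite starD starN. Qed.

Lemma star_sum I (r : seq I) (P : pred I) (F : I -> A) :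
  star (\sum_(i <- r | P i) F i) = \sum_(i <- r | P i) star (F i).
Proof.
by elim/big_rec2: _ => [|i x y _ <-]; rewrite ?star0 ?starD.
Qed.

Lemma starI a b : star a = star b -> a = b.
Proof. by move=> /(congr1 star); rewrite !starK. Qed.

Lemma nmM a b : nm (a ** b) <= nm a * nm b.
Proof. by have := normM_le a b; rewrite !normE -rmorphM lecR. Qed.

Lemma nm_starM a : nm (star a ** a) = nm a ^+ 2.
Proof.
by have := cstar_identity a; rewrite !normE -rmorphXn => /complexI.
Qed.

Lemma nm_star a : nm (star a) = nm a.
Proof.
suff h b : nm b <= nm (star b).
  by apply/eqP; rewrite eq_le h -{2}(starK a) h.
have := nmM (star b) b; rewrite nm_starM expr2.
have [-> _|b0] := eqVneq (nm b) 0; first exact: nm_ge0.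
by rewrite ler_pM2r // lt_neqAle eq_sym b0 nm_ge0.
Qed.

Lemma starM_eq0 a : star a ** a = 0 -> a = 0.
Proof.
move=> e; apply: nm_eq0; apply/eqP.
by rewrite -sqrf_eq0 -nm_starM e nm0.
Qed.

Lemma nm_eq_starM a b : star a ** a = star b ** b -> nm a = nm b.
Proof.
move=> /(congr1 (@nm _ _)); rewrite !nm_starM => /eqP.
by rewrite eqrXn2 ?nm_ge0 // => /eqP.
Qed.

(** The C*-identity, used for [a] and for [star a ** a], gives nm a ^ 4 = nm a ^ 2. *)
Lemma nm_proj_le1 a : star a ** a ** (star a ** a) = star a ** a -> nm a <= 1.
Proof.
move=> e; have : nm (star (star a ** a) ** (star a ** a)) = nm (star a ** a).
  by rewrite starM starK e.
rewrite nm_starM nm_starM -exprM; set t := nm a => h.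
have t0 : 0 <= t := nm_ge0 a.
have [->//|tn0] := eqVneq t 0.
have : t ^+ 2 = 1.
  by apply: (mulfI (expf_neq0 2 tn0)); rewrite -exprD h mulr1.
by move=> /eqP; rewrite sqrf_eq1 => /orP[|] /eqP ->; rewrite ?lerN10 ?lexx //; lra.
Qed.

Lemma nm_proj a : star a = a -> a ** a = a -> nm a <= 1.
Proof. by move=> e1 e2; apply: nm_proj_le1; rewrite e1 !e2. Qed.

Lemma cvs_mull a u b : cvs u b -> cvs (fun n => a ** u n) (a ** b).
Proof.
apply: (@cvs_lipschitz _ _ _ (cmul a) (nm a)) => x y.
by rewrite -cmulBr nmM.
Qed.

Lemma cvs_mulr a u b : cvs u b -> cvs (fun n => u n ** a) (b ** a).
Proof.
apply: (@cvs_lipschitz _ _ _ (fun x => x ** a) (nm a)) => x y.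
by rewrite -cmulBl mulrC nmM.
Qed.

Lemma cvs_star u b : cvs u b -> cvs (fun n => star (u n)) (star b).
Proof.
apply: (@cvs_lipschitz _ _ _ star 1) => x y.
by rewrite -starB nm_star mul1r.
Qed.

End Algebra.

Lemma star_hom0 (A B : cstarAlgType R) (f : A -> B) : star_hom f -> f 0 = 0.
Proof.
by case=> l _ _; have := l (-1) 0 0; rewrite scaler0 addr0 scaleN1r addNr.
Qed.

Lemma star_homD (A B : cstarAlgType R) (f : A -> B) : star_hom f ->
  {morph f : x y / x + y}.
Proof. by case=> l _ _ x y; have := l 1 x y; rewrite !scale1r. Qed.

Lemma star_homN (A B : cstarAlgType R) (f : A -> B) : star_hom f ->
  {morph f : x / - x}.
Proof.
move=> h x; apply/eqP; rewrite -addr_eq0 -star_homD // addNr.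
by rewrite star_hom0.
Qed.

Lemma star_homB (A B : cstarAlgType R) (f : A -> B) : star_hom f ->
  {morph f : x y / x - y}.
Proof. by move=> h x y; rewrite star_homD // star_homN. Qed.

Lemma star_hom_sum (A B : cstarAlgType R) (f : A -> B) : star_hom f ->
  forall I (r : seq I) (P : pred I) (F : I -> A),
  f (\sum_(i <- r | P i) F i) = \sum_(i <- r | P i) f (F i).
Proof.
move=> h I r P F.
by elim/big_rec2: _ => [|i x y _ <-]; rewrite ?star_hom0 ?star_homD.
Qed.

Lemma star_hom_comp (A B C : cstarAlgType R) (f : A -> B) (g : B -> C) :
  star_hom f -> star_hom g -> star_hom (g \o f).
Proof.
move=> [f1 f2 f3] [g1 g2 g3]; split=> [c x y|x y|x] /=.
- by rewrite f1 g1.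
- by rewrite f2 g2.
- by rewrite f3 g3.
Qed.

Lemma star_hom_id (A : cstarAlgType R) : star_hom (@id A).
Proof. by []. Qed.

End CStarBasics.

(** * Closed *-subalgebras and universal properties *)

Section SubCStar.
Variable R : realType.

(** Three uses occur: properties that need checking only on generators, commutants, and an ideal
    that becomes a C*-algebra of its own. *)
Record csubalg (A : cstarAlgType R) := CSubalg {
  csub_pred :> A -> Prop;
  csub0 : csub_pred 0;
  csubD : forall x y, csub_pred x -> csub_pred y -> csub_pred (x + y);
  csubZ : forall (c : R[i]) x, csub_pred x -> csub_pred (c *: x);
  csubM : forall x y, csub_pred x -> csub_pred y -> csub_pred (x ** y);
  csubS : forall x, csub_pred x -> csub_pred (star x);
  csub_closed : forall u x, (forall n : nat, csub_pred (u n)) ->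
    cvs u x -> csub_pred x
}.

Section Carrier.
Variables (A : cstarAlgType R) (S : csubalg A).

Record csub := CSub { csval : A; csvalP : S csval }.

HB.instance Definition _ := gen_eqMixin csub.
HB.instance Definition _ := gen_choiceMixin csub.

Lemma csval_inj : injective csval.
Proof.
case=> [x Px] [y Py] /= e; rewrite {}e in Px *.
by congr CSub; exact: Prop_irrelevance.
Qed.

Implicit Types x y z : csub.

Lemma csubN (x : A) : S x -> S (- x).
Proof. by move=> Sx; rewrite -scaleN1r; exact: csubZ. Qed.

Definition cs_add x y := CSub (csubD (csvalP x) (csvalP y)).
Definition cs_opp x := CSub (csubN (csvalP x)).
Definition cs_zero := CSub (csub0 S).
Definition cs_scale c x := CSub (csubZ c (csvalP x)).
Definition cs_mul x y := CSub (csubM (csvalP x) (csvalP y)).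
Definition cs_star x := CSub (csubS (csvalP x)).
Definition cs_norm x : R[i] := `|csval x|.

Fact cs_addA : associative cs_add.
Proof. by move=> x y z; apply: csval_inj; rewrite /= addrA. Qed.
Fact cs_addC : commutative cs_add.
Proof. by move=> x y; apply: csval_inj; rewrite /= addrC. Qed.
Fact cs_add0 : left_id cs_zero cs_add.
Proof. by move=> x; apply: csval_inj; rewrite /= add0r. Qed.
Fact cs_addN : left_inverse cs_zero cs_opp cs_add.
Proof. by move=> x; apply: csval_inj; rewrite /= addNr. Qed.
HB.instance Definition _ :=
  GRing.isZmodule.Build csub cs_addA cs_addC cs_add0 cs_addN.

Fact cs_scaleA a b x : cs_scale a (cs_scale b x) = cs_scale (a * b) x.
Proof. by apply: csval_inj; rewrite /= scalerA. Qed.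
Fact cs_scale1 : left_id 1 cs_scale.
Proof. by move=> x; apply: csval_inj; rewrite /= scale1r. Qed.
Fact cs_scaleDr : right_distributive cs_scale +%R.
Proof. by move=> a x y; apply: csval_inj; rewrite /= scalerDr. Qed.
Fact cs_scaleDl x : {morph cs_scale^~ x : a b / a + b}.
Proof. by move=> a b; apply: csval_inj; rewrite /= scalerDl. Qed.
HB.instance Definition _ := GRing.Zmodule_isLmodule.Build R[i] csub
  cs_scaleA cs_scale1 cs_scaleDr cs_scaleDl.

Fact cs_normD x y : cs_norm (x + y) <= cs_norm x + cs_norm y.
Proof. exact: ler_normD. Qed.
Fact cs_normZ (c : R[i]) x : cs_norm (c *: x) = `|c| * cs_norm x.
Proof. exact: normrZ. Qed.
Fact cs_norm0 x : cs_norm x = 0 -> x = 0.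
Proof. by move=> /normr0_eq0 e; apply: csval_inj. Qed.
HB.instance Definition _ := Lmodule_isNormed.Build R[i] csub
  cs_normD cs_normZ cs_norm0.

Fact cs_complete (u : nat -> csub) : csq u -> exists x, cvs u x.
Proof.
move=> uc; have [a ua] : exists a, cvs (fun n => csval (u n)) a.
  exact: csq_cvs uc.
have Sa : S a by apply: csub_closed ua => n; exact: csvalP.
by exists (CSub Sa).
Qed.
HB.instance Definition _ := Uniform_isComplete.Build csub
  (complete_of_csq cs_complete).

Fact cs_mulA x y z : cs_mul x (cs_mul y z) = cs_mul (cs_mul x y) z.
Proof. by apply: csval_inj; rewrite /= cmulA. Qed.
Fact cs_mulDl x y z : cs_mul (x + y) z = cs_mul x z + cs_mul y z.
Proof. by apply: csval_inj; rewrite /= cmulDl. Qed.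
Fact cs_mulDr x y z : cs_mul x (y + z) = cs_mul x y + cs_mul x z.
Proof. by apply: csval_inj; rewrite /= cmulDr. Qed.
Fact cs_mulZl (c : R[i]) x y : cs_mul (c *: x) y = c *: cs_mul x y.
Proof. by apply: csval_inj; rewrite /= cmulZl. Qed.
Fact cs_mulZr (c : R[i]) x y : cs_mul x (c *: y) = c *: cs_mul x y.
Proof. by apply: csval_inj; rewrite /= cmulZr. Qed.
Fact cs_starK x : cs_star (cs_star x) = x.
Proof. by apply: csval_inj; rewrite /= starK. Qed.
Fact cs_starD x y : cs_star (x + y) = cs_star x + cs_star y.
Proof. by apply: csval_inj; rewrite /= starD. Qed.
Fact cs_starZ (c : R[i]) x : cs_star (c *: x) = c^* *: cs_star x.
Proof. by apply: csval_inj; rewrite /= starZ. Qed.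
Fact cs_starM x y : cs_star (cs_mul x y) = cs_mul (cs_star y) (cs_star x).
Proof. by apply: csval_inj; rewrite /= starM. Qed.
Fact cs_normM x y : `|cs_mul x y| <= `|x| * `|y|.
Proof. exact: normM_le. Qed.
Fact cs_cstar x : `|cs_mul (cs_star x) x| = `|x| ^+ 2.
Proof. exact: cstar_identity. Qed.
HB.instance Definition _ := isCStarAlgebra.Build R csub
  cs_mulA cs_mulDl cs_mulDr cs_mulZl cs_mulZr cs_starK cs_starD cs_starZ
  cs_starM cs_normM cs_cstar.

Lemma csval_hom : star_hom (csval : csub -> A).
Proof. by []. Qed.

End Carrier.

Arguments csval {A S} _.

Lemma ck_corestrict (P : nmodType) (G : pgraph P) (E : cstarAlgType R)
    (t : G -> E) (S : csubalg E) (St : forall x, S (t x)) :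
  cuntz_krieger t -> cuntz_krieger (fun x => CSub (St x)).
Proof.
move=> [[c1 c1'] c2 c3 c4]; split.
- split=> [v hv|v w hv hw vw].
    by have [e1 e2] := c1 v hv; split; apply: csval_inj.
  by apply: csval_inj; exact: c1'.
- by move=> x y e; apply: csval_inj; exact: c2.
- by move=> x; apply: csval_inj; exact: c3.
- move=> v p hv; apply: csval_inj => /=; rewrite (c4 v p hv).
  rewrite !fsbig_finite; last 2 first.
  + exact: row_finite.
  + exact: row_finite.
  by rewrite (star_hom_sum (@csval_hom E S)).
Qed.

(** The family is corestricted to [S], and the induced map is followed by the inclusion. Taking a
    commutant for [S] is how the images of two universal algebras are made to commute. *)
Lemma graph_cstar_lift (P : nmodType) (G : pgraph P) (A E : cstarAlgType R)
    (s : G -> A) (t : G -> E) (S : csubalg E) :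
  graph_cstar s -> cuntz_krieger t -> (forall x, S (t x)) ->
  exists phi : A -> E,
    [/\ star_hom phi, forall x, phi (s x) = t x & forall a, S (phi a)].
Proof.
move=> [_ univ] ckt St.
have [phi [[phih phis] _]] := univ _ _ (ck_corestrict St ckt).
exists (csval \o phi); split=> [|x|a] /=; last exact: csvalP.
  exact: star_hom_comp phih (@csval_hom _ S).
by rewrite phis.
Qed.

Lemma graph_cstar_hom_eq (P : nmodType) (G : pgraph P) (A E : cstarAlgType R)
    (s : G -> A) (phi psi : A -> E) :
  graph_cstar s -> cuntz_krieger (phi \o s) -> star_hom phi -> star_hom psi ->
  (forall x, phi (s x) = psi (s x)) -> phi = psi.
Proof.
move=> [_ univ] ck hphi hpsi e; have [f [_ fu]] := univ _ _ ck.
transitivity f; first exact/esym/fu.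
by apply: fu; split=> // x /=.
Qed.

(* By uniqueness, the identity factors through the subalgebra [S]. *)
Lemma graph_cstar_ind (P : nmodType) (G : pgraph P) (A : cstarAlgType R)
    (s : G -> A) (S : csubalg A) :
  graph_cstar s -> (forall x, S (s x)) -> forall a, S a.
Proof.
move=> hs Ss a; have cks : cuntz_krieger s by case: hs.
have [phi [phih phis phiS]] := graph_cstar_lift hs cks Ss.
suff -> : a = phi a by [].
by rewrite -[LHS]/(id a) (graph_cstar_hom_eq hs _ (@star_hom_id _ A) phih).
Qed.

Lemma group_cstar_lift (K : zmodType) (C E : cstarAlgType R) (u : K -> C)
    (w : K -> E) (S : csubalg E) :
  group_cstar u -> unitary_rep w -> (forall g, S (w g)) ->
  exists rho : C -> E,
    [/\ star_hom rho, forall g, rho (u g) = w g & forall c, S (rho c)].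
Proof.
move=> [_ univ] [c1 c2 c3] Sw.
have rw : unitary_rep (fun g => CSub (Sw g)).
  split.
  - by move=> a; have [e1 e2] := c1 (csval a); split; apply: csval_inj.
  - by move=> g h; apply: csval_inj; exact: c2.
  - by move=> g; have [e1 e2] := c3 g; split; apply: csval_inj.
have [rho [[rhoh rhou] _]] := univ _ _ rw.
exists (csval \o rho); split=> [|x|a] /=; last exact: csvalP.
  exact: star_hom_comp rhoh (@csval_hom _ S).
by rewrite rhou.
Qed.

Section Commutant.
Variables (E : cstarAlgType R) (K : E -> Prop).
Hypothesis K_star : forall y, K y -> K (star y).

Let comm_with x := forall y, K y -> x ** y = y ** x.

Fact commutant0 : comm_with 0.
Proof. by move=> y _; rewrite cmul0l cmul0r. Qed.
Fact commutantD x z : comm_with x -> comm_with z -> comm_with (x + z).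
Proof. by move=> hx hz y Ky; rewrite cmulDl cmulDr hx // hz. Qed.
Fact commutantZ (c : R[i]) x : comm_with x -> comm_with (c *: x).
Proof. by move=> hx y Ky; rewrite cmulZl cmulZr hx. Qed.
Fact commutantM x z : comm_with x -> comm_with z -> comm_with (x ** z).
Proof. by move=> hx hz y Ky; rewrite -cmulA hz // !cmulA hx. Qed.
Fact commutantS x : comm_with x -> comm_with (star x).
Proof.
by move=> hx y Ky; apply: starI; rewrite !starM starK hx //; exact: K_star.
Qed.
Fact commutant_closed (u : nat -> E) x :
  (forall n, comm_with (u n)) -> cvs u x -> comm_with x.
Proof.
move=> hu ux y Ky; apply: (@cvs_unique _ _ (fun n => u n ** y)).
  exact: cvs_mulr.
apply: cvs_ev (cvs_mull y ux).
by exists 0%N => n _; rewrite hu.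
Qed.

Definition commutant := CSubalg commutant0 commutantD commutantZ commutantM
  commutantS commutant_closed.

End Commutant.

End SubCStar.

(** * Multipliers *)

Section Multipliers.
Variables (R : realType) (D : cstarAlgType R).

(** The test element is [star (a - b)]. This replaces evaluation at a unit when multipliers are
    compared. *)
Lemma cmul_left_faithful (a b : D) : (forall x, x ** a = x ** b) -> a = b.
Proof.
move=> h; apply/eqP; rewrite -subr_eq0; apply/eqP/starM_eq0.
by rewrite cmulBr h subrr.
Qed.

(* Adjointable operators on [D], seen as a right Hilbert module over itself. *)
Record mult := Mult {
  mact :> D -> D;
  madj : D -> D;
  madjP : forall x y, star (mact x) ** y = star x ** madj y;
  mbound : exists M : R, forall x, nm (mact x) <= M * nm x
}.

HB.instance Definition _ := gen_eqMixin mult.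
HB.instance Definition _ := gen_choiceMixin mult.

Implicit Types S T : mult.

Lemma mult_ext S T : S =1 T -> S = T.
Proof.
case: S T => [f f' fP fb] [g g' gP gb] /= /funext e.
rewrite {}e in fP fb *.
have e : f' = g'.
  apply/funext => y; apply: cmul_left_faithful => x.
  by rewrite -(starK x) -fP gP.
rewrite {}e in fP *.
by congr Mult; exact: Prop_irrelevance.
Qed.

Lemma madjP' S x y : star x ** S y = star (madj S x) ** y.
Proof. by apply: starI; rewrite !starM !starK madjP. Qed.

(** Linearity is not a field of [mult]: like right [D]-linearity in [mactM], it follows by moving
    the operator to the other side of the pairing, where the argument stands bare. *)
Lemma mact_lin S (c : R[i]) x y : S (c *: x + y) = c *: S x + S y.
Proof.
apply: cmul_left_faithful => z; rewrite -(starK z).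
by rewrite cmulDr cmulZr !madjP' cmulDr cmulZr.
Qed.

Lemma mactD S : {morph S : x y / x + y}.
Proof. by move=> x y; have := mact_lin S 1 x y; rewrite !scale1r. Qed.

Lemma mact0 S : S 0 = 0.
Proof. by apply: (addrI (S 0)); rewrite -mactD !addr0. Qed.

Lemma mactZ S (c : R[i]) x : S (c *: x) = c *: S x.
Proof. by have := mact_lin S c x 0; rewrite mact0 !addr0. Qed.

Lemma mactN S : {morph S : x / - x}.
Proof. by move=> x; rewrite -scaleN1r mactZ scaleN1r. Qed.

Lemma mactB S : {morph S : x y / x - y}.
Proof. by move=> x y; rewrite mactD mactN. Qed.

Lemma mactM S x y : S (x ** y) = S x ** y.
Proof.
apply: cmul_left_faithful => z; rewrite -(starK z).
by rewrite madjP' !cmulA madjP'.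
Qed.

Lemma mact_sum S I (r : seq I) (P : pred I) (F : I -> D) :
  S (\sum_(i <- r | P i) F i) = \sum_(i <- r | P i) S (F i).
Proof.
by elim/big_rec2: _ => [|i x y _ <-]; rewrite ?mact0 ?mactD.
Qed.

(** With z = [madj S y], the adjoint relation gives nm z ^ 2 = nm (star (S z) ** y) <= M * nm z * nm
    y, and a factor nm z cancels. *)
Lemma madj_bound S (M : R) : (forall x, nm (S x) <= M * nm x) ->
  forall x, nm (madj S x) <= M * nm x.
Proof.
move=> SM y; set z := madj S y.
have : nm z ^+ 2 <= (M * nm z) * nm y.
  rewrite -nm_starM -madjP; apply: le_trans (nmM _ _) _.
  by rewrite nm_star ler_wpM2r ?nm_ge0.
have [-> _|z0] := eqVneq (nm z) 0.
  by apply: le_trans (SM _); exact: nm_ge0.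
by rewrite expr2 mulrAC ler_pM2r // lt_neqAle eq_sym z0 nm_ge0.
Qed.

Fact mstar_subproof S x y : star (madj S x) ** y = star x ** S y.
Proof. by rewrite madjP'. Qed.
Fact mstar_bound S : exists M : R, forall x, nm (madj S x) <= M * nm x.
Proof. by have [M SM] := mbound S; exists M; exact: madj_bound. Qed.
Definition mstar S := Mult (mstar_subproof S) (mstar_bound S).

Fact madd_subproof S T x y :
  star (S x + T x) ** y = star x ** (madj S y + madj T y).
Proof. by rewrite starD cmulDl !madjP cmulDr. Qed.
Fact madd_bound S T : exists M : R, forall x, nm (S x + T x) <= M * nm x.
Proof.
have [M SM] := mbound S; have [N TN] := mbound T; exists (M + N) => x.
by rewrite mulrDl; apply: le_trans (nmD _ _) _; apply: lerD.
Qed.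
Definition madd S T := Mult (madd_subproof S T) (madd_bound S T).

Fact mscale_subproof (c : R[i]) S x y :
  star (c *: S x) ** y = star x ** (c^* *: madj S y).
Proof. by rewrite starZ cmulZl cmulZr madjP. Qed.
Fact mscale_bound (c : R[i]) S : exists M : R, forall x, nm (c *: S x) <= M * nm x.
Proof.
have [M SM] := mbound S; exists (complex.Re `|c| * M) => x.
rewrite nmZ -mulrA ler_wpM2l //.
by have : 0 <= `|c| := normr_ge0 c; rewrite lecE => /andP[].
Qed.
Definition mscale c S := Mult (mscale_subproof c S) (mscale_bound c S).

Fact mzero_subproof (x y : D) : star (0 : D) ** y = star x ** 0.
Proof. by rewrite star0 cmul0l cmul0r. Qed.
Fact mzero_bound : exists M : R, forall x : D, nm (0 : D) <= M * nm x.
Proof. by exists 0 => x; rewrite nm0 mul0r. Qed.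
Definition m0 := Mult mzero_subproof mzero_bound.

Fact mone_bound : exists M : R, forall x : D, nm x <= M * nm x.
Proof. by exists 1 => x; rewrite mul1r. Qed.
Definition mone := @Mult id id (fun x y => erefl) mone_bound.

Fact mmul_subproof S T x y :
  star (S (T x)) ** y = star x ** madj T (madj S y).
Proof. by rewrite !madjP. Qed.
Fact mmul_bound S T : exists M : R, forall x, nm (S (T x)) <= M * nm x.
Proof.
have [M SM] := mbound S; have [N TN] := mbound T.
exists (`|M| * N) => x; apply: le_trans (SM _) _.
apply: le_trans (_ : `|M| * nm (T x) <= _); last by rewrite -mulrA ler_wpM2l.
by rewrite ler_wpM2r ?nm_ge0 // ler_norm.
Qed.
Definition mmul S T := Mult (mmul_subproof S T) (mmul_bound S T).

Definition mopp S := mscale (-1) S.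

Fact maddA : associative madd.
Proof. by move=> S T U; apply: mult_ext => x; rewrite /= addrA. Qed.
Fact maddC : commutative madd.
Proof. by move=> S T; apply: mult_ext => x; rewrite /= addrC. Qed.
Fact madd0 : left_id m0 madd.
Proof. by move=> S; apply: mult_ext => x; rewrite /= add0r. Qed.
Fact maddN : left_inverse m0 mopp madd.
Proof. by move=> S; apply: mult_ext => x; rewrite /= scaleN1r addNr. Qed.
HB.instance Definition _ := GRing.isZmodule.Build mult maddA maddC madd0 maddN.

Fact mscaleA a b S : mscale a (mscale b S) = mscale (a * b) S.
Proof. by apply: mult_ext => x; rewrite /= scalerA. Qed.
Fact mscale1 : left_id 1 mscale.
Proof. by move=> S; apply: mult_ext => x; rewrite /= scale1r. Qed.
Fact mscaleDr : right_distributive mscale +%R.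
Proof. by move=> a S T; apply: mult_ext => x; rewrite /= scalerDr. Qed.
Fact mscaleDl S : {morph mscale^~ S : a b / a + b}.
Proof. by move=> a b; apply: mult_ext => x; rewrite /= scalerDl. Qed.
HB.instance Definition _ := GRing.Zmodule_isLmodule.Build R[i] mult
  mscaleA mscale1 mscaleDr mscaleDl.

Fact mmulA : associative mmul.
Proof. by move=> S T U; apply: mult_ext. Qed.
Fact mmul1l : left_id mone mmul.
Proof. by move=> S; apply: mult_ext. Qed.
Fact mmul1r : right_id mone mmul.
Proof. by move=> S; apply: mult_ext. Qed.
Fact mmulDl : left_distributive mmul +%R.
Proof. by move=> S T U; apply: mult_ext. Qed.
Fact mmulDr : right_distributive mmul +%R.
Proof. by move=> S T U; apply: mult_ext => x; rewrite /= mactD. Qed.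
HB.instance Definition _ := GRing.Zmodule_isPzRing.Build mult
  mmulA mmul1l mmul1r mmulDl mmulDr.

Definition mnorm S : R := sup [set nm (S x) | x in [set x | nm x <= 1]].

Lemma mnorm_has_sup S : has_sup [set nm (S x) | x in [set x | nm x <= 1]].
Proof.
have [M SM] := mbound S; split; first by exists (nm (S 0)), 0 => //=; rewrite nm0.
exists `|M| => _ [x /= x1 <-]; apply: le_trans (SM _) _.
apply: le_trans (_ : `|M| * nm x <= _).
  by rewrite ler_wpM2r ?nm_ge0 // ler_norm.
by rewrite ler_piMr.
Qed.

Lemma mnorm_ge0 S : 0 <= mnorm S.
Proof.
apply: (ub_le_sup (mnorm_has_sup S).2).
by exists 0; rewrite /= ?nm0 // mact0 nm0.
Qed.

Lemma le_mnorm S x : nm (S x) <= mnorm S * nm x.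
Proof.
have [x0|x0] := eqVneq (nm x) 0.
  by rewrite (nm_eq0 x0) mact0 nm0 mulr0.
have xp : 0 < nm x by rewrite lt_neqAle eq_sym x0 nm_ge0.
have xi : 0 <= (nm x)^-1 by rewrite invr_ge0 ltW.
rewrite -ler_pdivrMr // mulrC -nmZ_real // -mactZ.
apply: (ub_le_sup (mnorm_has_sup S).2).
by exists ((nm x)^-1%:C%C *: x) => //=; rewrite nmZ_real // mulVf.
Qed.

Lemma mnorm_le S (M : R) : 0 <= M -> (forall x, nm (S x) <= M * nm x) ->
  mnorm S <= M.
Proof.
move=> M0 SM; apply: ge_sup => [|_ [x /= x1 <-]].
  by case: (mnorm_has_sup S).
by apply: le_trans (SM x) _; rewrite ler_piMr.
Qed.

Fact mnormD S T : (mnorm (S + T))%:C%C <= (mnorm S)%:C%C + (mnorm T)%:C%C :> R[i].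
Proof.
rewrite -rmorphD lecR; apply: mnorm_le => [|x].
  by rewrite addr_ge0 ?mnorm_ge0.
by rewrite mulrDl; apply: le_trans (nmD _ _) _; rewrite lerD ?le_mnorm.
Qed.

Fact mnormZ (c : R[i]) S : (mnorm (c *: S))%:C%C = `|c| * (mnorm S)%:C%C :> R[i].
Proof.
have ce : `|c| = (complex.Re `|c|)%:C%C by rewrite RRe_real // ger0_real.
have c0 : 0 <= complex.Re `|c|.
  by have : 0 <= `|c| := normr_ge0 c; rewrite lecE => /andP[].
rewrite ce -rmorphM; congr _%:C%C; apply/eqP; rewrite eq_le; apply/andP; split.
  apply: mnorm_le => [|x]; first by rewrite mulr_ge0 ?mnorm_ge0.
  by rewrite /= nmZ -mulrA ler_wpM2l ?le_mnorm.
have [e|cn0] := eqVneq (complex.Re `|c|) 0; first by rewrite e mul0r mnorm_ge0.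
have cp : 0 < complex.Re `|c| by rewrite lt_neqAle eq_sym cn0 c0.
rewrite mulrC -ler_pdivlMr //; apply: mnorm_le => [|x].
  by rewrite mulr_ge0 ?mnorm_ge0 ?invr_ge0.
by rewrite mulrAC ler_pdivlMr // mulrC -nmZ; exact: le_mnorm (c *: S) x.
Qed.

Fact mnorm0 S : (mnorm S)%:C%C = 0 :> R[i] -> S = 0.
Proof.
move=> /complexI S0; apply: mult_ext => x; apply: nm_eq0; apply/eqP.
by rewrite eq_le nm_ge0 andbT; have := le_mnorm S x; rewrite S0 mul0r.
Qed.
HB.instance Definition _ := Lmodule_isNormed.Build R[i] mult
  mnormD mnormZ mnorm0.

Lemma le_nm_mult S x : nm (S x) <= nm S * nm x.
Proof. exact: le_mnorm. Qed.

Lemma nm_mult_le S (M : R) : 0 <= M -> (forall x, nm (S x) <= M * nm x) ->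
  nm S <= M.
Proof. exact: mnorm_le. Qed.

Lemma multBE S T x : (S - T) x = S x - T x.
Proof. by rewrite /= scaleN1r. Qed.

Lemma madjB S T x : madj (S - T) x = madj S x - madj T x.
Proof. by rewrite /= rmorphN rmorph1 scaleN1r. Qed.

Lemma le_nm_madj S x : nm (madj S x) <= nm S * nm x.
Proof. by apply: madj_bound; exact: le_nm_mult. Qed.

Fact mult_complete (u : nat -> mult) : csq u -> exists S, cvs u S.
Proof.
move=> uc.
have pw (f : mult -> D -> D) :
    (forall S T x, nm (f S x - f T x) <= nm (S - T) * nm x) ->
    forall x, exists y, cvs (fun n => f (u n) x) y.
  move=> fb x; apply: csq_cvs => e e0.
  have x1 : 0 < 1 + nm x by rewrite ltr_pwDl ?nm_ge0.
  have [N hN] := uc (e / (1 + nm x)) (divr_gt0 e0 x1).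
  exists N => n p Nn Np; apply: le_lt_trans (fb _ _ _) _.
  have := hN n p Nn Np; rewrite ltr_pdivlMr //; apply: le_lt_trans.
  by rewrite ler_wpM2l ?nm_ge0 // lerDr.
have /choice[f uf] : forall x, exists y, cvs (fun n => u n x) y.
  move=> x; apply: (pw (fun S => mact S)) => S T {}x.
  by rewrite -multBE le_nm_mult.
have /choice[g ug] : forall x, exists y, cvs (fun n => madj (u n) x) y.
  move=> x; apply: (pw madj) => S T {}x.
  by rewrite -madjB le_nm_madj.
have fP x y : star (f x) ** y = star x ** g y.
  apply: (@cvs_unique _ _ (fun n => star (u n x) ** y)).
    by apply: cvs_mulr; apply: cvs_star.
  apply: cvs_ev (cvs_mull (star x) (ug y)).
  by exists 0%N => n _; rewrite madjP.
(* The Cauchy estimate between [u n] and [u p] is uniform in x relative to [nm x]; letting p tend to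
   infinity pointwise keeps it for [u n] and [f]. *)
have fb (e : R) : 0 < e ->
    exists N, forall n x, (N <= n)%N -> nm (u n x - f x) <= e * nm x.
  move=> /uc[N hN]; exists N => n x Nn.
  apply/ler_addgt0Pr => d d0; have [K hK] := uf x d d0.
  pose p := maxn N K; have h1 := hK p (leq_maxr _ _).
  have h2 := hN n p Nn (leq_maxl _ _).
  have h3 : nm (u n x - u p x) <= e * nm x.
    rewrite -multBE; apply: le_trans (le_nm_mult _ _) _.
    by rewrite ler_wpM2r ?nm_ge0 // ltW.
  by have := nm_tri (u p x) (u n x) (f x); lra.
have fbd : exists M : R, forall x, nm (f x) <= M * nm x.
  have [N /(_ N) hN] := fb 1 ltr01; exists (nm (u N) + 1) => x.
  have := hN x (leqnn _); have := le_nm_mult (u N) x.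
  by have := nm_tri (u N x) (f x) 0; rewrite !subr0 nmC; lra.
exists (Mult fP fbd) => e e0; have e2 : 0 < e / 2 by lra.
have [N hN] := fb _ e2; exists N => n Nn.
suff : nm (u n - Mult fP fbd) <= e / 2 by lra.
by apply: nm_mult_le => [|x]; rewrite ?multBE /= ?hN // ltW.
Qed.
HB.instance Definition _ := Uniform_isComplete.Build mult
  (complete_of_csq mult_complete).

Fact mmulZl (c : R[i]) S T : mmul (c *: S) T = c *: mmul S T.
Proof. by apply: mult_ext. Qed.
Fact mmulZr (c : R[i]) S T : mmul S (c *: T) = c *: mmul S T.
Proof. by apply: mult_ext => x; rewrite /= mactZ. Qed.
Fact mstarK S : mstar (mstar S) = S.
Proof. by apply: mult_ext. Qed.
Fact mstarD S T : mstar (S + T) = mstar S + mstar T.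
Proof. by apply: mult_ext. Qed.
Fact mstarZ (c : R[i]) S : mstar (c *: S) = c^* *: mstar S.
Proof. by apply: mult_ext. Qed.
Fact mstarM S T : mstar (mmul S T) = mmul (mstar T) (mstar S).
Proof. by apply: mult_ext. Qed.
Lemma nm_mmul_le S T : nm (S * T) <= nm S * nm T.
Proof.
apply: nm_mult_le => [|x]; first by rewrite mulr_ge0 ?nm_ge0.
apply: le_trans (le_nm_mult S (T x)) _.
by rewrite -mulrA ler_wpM2l ?nm_ge0 ?le_nm_mult.
Qed.
Fact mmul_norm S T : `|mmul S T| <= `|S| * `|T|.
Proof. by rewrite !normE -rmorphM lecR; exact: nm_mmul_le. Qed.
Fact mmul_cstar S : `|mmul (mstar S) S| = `|S| ^+ 2.
Proof.
rewrite !normE -rmorphXn; congr _%:C%C.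
have sle T : nm (mstar T) <= nm T.
  by apply: nm_mult_le => [|x]; rewrite ?nm_ge0 //=; exact: le_nm_madj.
apply/eqP; rewrite eq_le; apply/andP; split.
  apply: le_trans (nm_mmul_le _ _) _; rewrite expr2 ler_wpM2r ?nm_ge0 //.
set b := nm (mmul _ _); have b0 : 0 <= b := nm_ge0 _.
rewrite -[leRHS]sqr_sqrtr // ler_pXn2r ?nnegrE ?nm_ge0 ?sqrtr_ge0 //.
apply: nm_mult_le => [|x]; first exact: sqrtr_ge0.
have this : nm (S x) ^+ 2 <= (Num.sqrt b * nm x) ^+ 2.
  rewrite -nm_starM madjP exprMn sqr_sqrtr // expr2.
  apply: le_trans (nmM _ _) _; rewrite nm_star mulrCA ler_wpM2l ?nm_ge0 //.
  exact: (le_nm_mult (mmul (mstar S) S)).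
by move: this; rewrite ler_pXn2r ?nnegrE ?mulr_ge0 ?nm_ge0 ?sqrtr_ge0.
Qed.
HB.instance Definition _ := isCStarAlgebra.Build R mult
  mmulA mmulDl mmulDr mmulZl mmulZr mstarK mstarD mstarZ mstarM mmul_norm
  mmul_cstar.

Lemma cmulE S T : S ** T = S * T. Proof. by []. Qed.

Lemma mmulE S T x : (S * T) x = S (T x). Proof. by []. Qed.

Lemma mstarP S x y : star (S x) ** y = star x ** star S y.
Proof. exact: madjP. Qed.

Lemma mult_star1 : star (1 : mult) = 1. Proof. exact: mult_ext. Qed.

Lemma mult_starX S n : star (S ^+ n) = star S ^+ n.
Proof.
elim: n => [|n IH]; first by rewrite !expr0 mult_star1.
by rewrite exprS exprSr -cmulE starM IH.
Qed.

Definition lmult (a : D) : mult.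
Proof.
apply: (@Mult (cmul a) (cmul (star a))) => [x y|].
  by rewrite starM cmulA.
by exists (nm a) => x; exact: nmM.
Defined.

Lemma lmultE a x : lmult a x = a ** x. Proof. by []. Qed.

Lemma lmult_hom : star_hom lmult.
Proof.
split=> [c a b|a b|a]; apply: mult_ext => x /=.
- by rewrite cmulDl cmulZl.
- by rewrite cmulA.
- by [].
Qed.

Lemma lmult_inj : injective lmult.
Proof.
move=> a b e; apply: starI; apply: cmul_left_faithful => x.
by apply: starI; rewrite !starM !starK -!lmultE e.
Qed.

End Multipliers.

(** * Orthogonality of range projections *)

Section ExtremePoint.
Variables (R : realType) (D : cstarAlgType R) (e d : D).
Hypotheses (ee : e ** e = e) (ed : e ** d = d) (de : d ** e = d).
Hypotheses (xle : nm (e + d) <= 1) (yle : nm (e - d) <= 1).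

(* [walk n f] is the average, over the random signs [w], of
   [f (w_1 + ... + w_n) (e + w_1 d) ... (e + w_n d)]. *)
Fixpoint walk (n : nat) (f : R -> R) : D :=
  if n is n'.+1 then (2^-1%:C)%C *:
    (walk n' (fun t => f (t + 1)) ** (e + d) +
     walk n' (fun t => f (t - 1)) ** (e - d))
  else ((f 0)%:C)%C *: e.

Lemma eq_walk n f g : f =1 g -> walk n f = walk n g.
Proof. by move=> /funext ->. Qed.

(** For a sign w, the average of w (e + w d) is d and that of e + w d is e, so every new factor adds
    one d; the terms in [d ** d] cancel between the two signs. *)
Lemma walk_id n (c : R) :
  walk n (fun t => t + c) = (n%:R%:C)%C *: d + (c%:C)%C *: e.
Proof.
elim: n c => [|n IH] c /=; first by rewrite scale0r !add0r.
rewrite (@eq_walk _ _ (fun t => t + (1 + c))) => [|t]; last by rewrite addrA.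
rewrite (@eq_walk n (fun t => t - 1 + c) (fun t => t + (c - 1))) => [|t]; last first.
  by rewrite -addrA (addrC _ c).
rewrite !IH !(cmulDl, cmulBr, cmulDr, cmulZl) ee ed de.
set dd := d ** d.
rewrite opprD (AC ((2*2)*(2*2)) ((1*5*4*8)*(3*6)*(2*7))).
rewrite /= subrr addr0.
rewrite -!scalerDl -scalerBl scalerDr !scalerA -!rmorphD -rmorphB.
rewrite -!rmorphM /=; congr (_%:C%C *: _ + _%:C%C *: _).
  by rewrite -natr1 natrD; field.
by field.
Qed.

Lemma nm_e : nm e <= 1.
Proof.
have := nmD (e + d) (e - d); rewrite addrACA subrr addr0 -mulr2n -scaler_nat.
rewrite -(rmorph_nat (real_complex R)) nmZ_real ?ler0n //.
by move: xle yle; lra.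
Qed.

(** All factors have norm at most 1, so only the scalar average remains, and the mean of (w_1 + ...
    + w_n + c)^2 is n + c^2. *)
Lemma walk_bound n (f : R -> R) (a b c : R) :
  (forall t, `|f t| <= a * (t + c) ^+ 2 + b) ->
  nm (walk n f) <= a * (n%:R + c ^+ 2) + b.
Proof.
elim: n f c => [|n IH] f c fb /=.
  have := fb 0; rewrite !add0r => h; apply: le_trans h.
  rewrite nmZ normc_def /= expr0n /= addr0 sqrtr_sqr ler_piMr // nm_e //.
rewrite nmZ_real ?invr_ge0 ?ler0n //.
have h1 : nm (walk n (fun t => f (t + 1))) <= a * (n%:R + (1 + c) ^+ 2) + b.
  by apply: IH => t; rewrite addrA.
have h2 : nm (walk n (fun t => f (t - 1))) <= a * (n%:R + (-1 + c) ^+ 2) + b.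
  by apply: IH => t; rewrite addrA.
have h3 u z : nm z <= 1 -> nm (u ** z : D) <= nm u.
  by move=> z1; apply: le_trans (nmM _ _) _; rewrite ler_piMr // nm_ge0.
have := nmD (walk n (fun t => f (t + 1)) ** (e + d))
  (walk n (fun t => f (t - 1)) ** (e - d)).
have := h3 (walk n (fun t => f (t + 1))) _ xle.
have := h3 (walk n (fun t => f (t - 1))) _ yle.
rewrite -(natr1 n); move: h1 h2.
set u1 := nm (walk n _); set u2 := nm (walk n _).
set v1 := nm (walk n _ ** _); set v2 := nm (walk n _ ** _); set w := nm (_ + _).
by move=> *; lra.
Qed.

(* A unit is an extreme point of the unit ball: the mean of
   [|w_1 + ... + w_n|] is only of order [sqrt n]. *)
Lemma extreme_point : d = 0.
Proof.
apply: nm_le_eps => r r0.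
pose s : R := (Num.truncn r^-1).+1%:R.
have s0 : 0 < s by rewrite ltr0n.
have rs : s^-1 < r.
  by rewrite invf_plt ?posrE // truncnS_gt.
(* With s^2 signs the average of the identity function is s^2 d. Since |t| <= t^2 / (2 s) + s / 2,
   its norm is at most s, whence nm d <= 1 / s < r. *)
have := @walk_bound ((Num.truncn r^-1).+1 ^ 2) id ((2 * s)^-1) (s / 2) 0.
rewrite (@eq_walk _ _ (fun t => t + 0)) => [|t]; last by rewrite addr0.
rewrite walk_id scale0r addr0 nmZ_real ?ler0n // natrX -/s expr0n addr0.
move=> h; have : s ^+ 2 * nm d <= s.
  have -> : s = (2 * s)^-1 * s ^+ 2 + s / 2.
    by field; rewrite gt_eqF.
  rewrite -[X in X ^+ 2 * _](_ : s = _); last by field; rewrite gt_eqF.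
  apply: h => t; rewrite addr0 ler_norml.
  have : 0 <= (t - s) ^+ 2 by exact: sqr_ge0.
  have : 0 <= (t + s) ^+ 2 by exact: sqr_ge0.
  have -> : (2 * s)^-1 * t ^+ 2 + s / 2 = (t ^+ 2 + s ^+ 2) / (2 * s).
    by field; rewrite gt_eqF.
  by rewrite lerNl !ler_pdivlMr ?mulr_gt0 //; nra.
rewrite expr2 -mulrA ger_pMr // mulrC -ler_pdivlMr // mul1r => dle.
exact: le_trans dle (ltW rs).
Qed.

End ExtremePoint.

Section ProjectionSums.
Variables (R : realType) (D : cstarAlgType R) (I : eqType) (r : seq I).
Variables (p : I -> D) (e : D).
Hypotheses (ps : forall i, i \in r -> star (p i) = p i).
Hypotheses (pp : forall i, i \in r -> p i ** p i = p i).
Hypotheses (es : star e = e) (ee : e ** e = e).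
Hypotheses (ep : forall i, i \in r -> e ** p i = p i).
Hypotheses (sum_p : e = \sum_(i <- r) p i) (r_uniq : uniq r).

(* The compressions [p_a p_i p_a] with [i <> a] sum to zero while
   [|p_a - p_a p_i p_a| <= 1], so [p_a] would be a proper midpoint in the unit
   ball unless they all vanish. *)
Lemma proj_sum_orth a b : a \in r -> b \in r -> a != b -> p a ** p b = 0.
Proof.
move=> ar br ab; pose c i := p a ** p i ** p a.
have pe i : i \in r -> p i ** e = p i.
  by move=> ir; apply: starI; rewrite starM ps // es ep.
have pa1 : nm (p a) <= 1 by apply: nm_proj; [exact: ps | exact: pp].
have pc i : i \in r -> nm (p a - c i) <= 1.
  move=> ir.
  have -> : p a - c i = p a ** (e - p i) ** p a.
    by rewrite cmulBr cmulBl pe // pp.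
  have h : nm (e - p i) <= 1.
    apply: nm_proj; first by rewrite starB es ps.
    by rewrite cmulBl !cmulBr ee pe // ep // pp // subrr subr0.
  apply: le_trans (nmM _ _) _; rewrite mulr_ile1 ?nm_ge0 //.
  by apply: le_trans (nmM _ _) _; rewrite mulr_ile1 ?nm_ge0.
have ca : c a = p a by rewrite /c !pp.
have csum : \sum_(i <- r) c i = p a.
  by rewrite -cmul_suml -cmul_sumr -sum_p pe // pp.
pose g i := if i != a then c i else 0.
have gsum : \sum_(i <- r) g i = 0.
  rewrite -big_mkcond /=; move: csum; rewrite (bigD1_seq a) //= ca.
  by rewrite -[RHS]addr0 => /addrI.
pose g' i := if i != b then g i else 0.
have gb : c b = - \sum_(i <- r) g' i.
  move: gsum; rewrite (bigD1_seq b) //= big_mkcond /= => /eqP.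
  have -> : g b = c b by rewrite /g eq_sym ab.
  by rewrite addr_eq0 => /eqP.
pose N : R := (size r)%:R.
have N1 : 1 <= N by rewrite ler1n; case: (r) ar.
have N0 : 0 < N by apply: lt_le_trans N1.
(* By [gb], [c b] is minus the sum of the other compressions, so N p_a + c_b splits into N terms p_a
   - g'_i of norm at most 1. *)
have Nb : nm ((N%:C)%C *: p a + c b) <= N.
  have -> : (N%:C)%C *: p a + c b = \sum_(i <- r) (p a - g' i).
    rewrite gb big_split /= sumrN big_const_seq count_predT iter_addr_0.
    by rewrite rmorph_nat scaler_nat.
  apply: le_trans (nm_sum _ _ _) _.
  apply: le_trans (_ : \sum_(i <- r) 1 <= _); last first.
    by rewrite big_const_seq count_predT iter_addr_0.
  rewrite big_seq [leRHS]big_seq; apply: ler_sum => i ir.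
  rewrite /g' /g; case: (i != b); last by rewrite subr0.
  by case: (i != a); rewrite ?subr0 // pc.
have d0 : ((N^-1)%:C)%C *: c b = 0.
  have cNN : ((N^-1)%:C)%C * (N%:C)%C = 1 :> R[i].
    by rewrite -rmorphM mulVf ?gt_eqF.
  apply: (@extreme_point _ _ (p a)).
  - exact: pp.
  - by rewrite cmulZr /c !cmulA pp.
  - by rewrite cmulZl /c -!cmulA pp.
  - have -> : p a + ((N^-1)%:C)%C *: c b =
        ((N^-1)%:C)%C *: ((N%:C)%C *: p a + c b).
      by rewrite scalerDr scalerA cNN scale1r.
    rewrite nmZ_real ?invr_ge0 ?(ltW N0) //.
    by rewrite mulrC ler_pdivrMr // mul1r.
  (* A convex combination of [p a] and [p a - c b], both of norm at most 1. *)
  - have -> : p a - ((N^-1)%:C)%C *: c b =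
        ((1 - N^-1)%:C)%C *: p a + ((N^-1)%:C)%C *: (p a - c b).
      by rewrite rmorphB rmorph1 scalerBl scale1r scalerBr addrA subrK.
    have Ni : 0 <= N^-1 by rewrite invr_ge0 ltW.
    have Ni1 : N^-1 <= 1 by rewrite invf_le1.
    apply: le_trans (nmD _ _) _; rewrite !nmZ_real ?subr_ge0 //.
    have h1 : (1 - N^-1) * nm (p a) <= 1 - N^-1.
      by rewrite ler_piMr ?subr_ge0.
    have h2 : N^-1 * nm (p a - c b) <= N^-1 by rewrite ler_piMr ?pc.
    by apply: le_trans (lerD h1 h2) _; rewrite subrK.
have cb0 : c b = 0.
  move: d0 => /eqP; rewrite scaler_eq0 => /orP[|/eqP //].
  by move=> /eqP/complexI /eqP; rewrite invr_eq0 gt_eqF.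
(* [c b] is the product of [star (p b ** p a)] and [p b ** p a]. *)
have : p b ** p a = 0.
  by apply: starM_eq0; rewrite starM !ps // !cmulA -(cmulA (p a)) pp.
by move=> h; apply: starI; rewrite starM !ps // h star0.
Qed.

End ProjectionSums.

Section PathSeq.
Variables (P : nmodType) (G : pgraph P).
Implicit Types (v x : G) (p : P).

Definition path_seq v p : seq G := finmap.enum_fset (fset_set (paths_from v p)).

Lemma path_seq_uniq v p : uniq (path_seq v p).
Proof. exact: finmap.fset_uniq. Qed.

Lemma mem_path_seq v p x : vertices v ->
  reflect (rng x = v /\ deg x = p) (x \in path_seq v p).
Proof.
move=> hv; rewrite in_fset_set; last exact: row_finite.
by apply: (iffP idP); rewrite inE.
Qed.

Lemma path_sumE (A : zmodType) (F : G -> A) v p : vertices v ->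
  \sum_(x \in paths_from v p) F x = \sum_(x <- path_seq v p) F x.
Proof. by move=> hv; rewrite fsbig_finite //; exact: row_finite. Qed.

End PathSeq.

(** * Consequences of the Cuntz-Krieger relations *)

Section CuntzKrieger.
Variables (R : realType) (P : nmodType) (G : pgraph P) (A : cstarAlgType R).
Variable s : G -> A.
Hypothesis ck : cuntz_krieger s.

Lemma vertices_rng x : vertices (rng x : G).
Proof. exact: deg_rng. Qed.

Lemma vertices_src x : vertices (src x : G).
Proof. exact: deg_src. Qed.

Lemma ck_rng x : s (rng x) ** s x = s x.
Proof. by case: ck => _ c2 _ _; rewrite c2 ?src_rng // comp_rng. Qed.

Lemma ck_src x : s x ** s (src x) = s x.
Proof. by case: ck => _ c2 _ _; rewrite c2 ?rng_src // comp_src. Qed.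

Lemma ck_star_vertex v : vertices v -> star (s v) = s v.
Proof. by case: ck => [[c1 _] _ _ _] /c1 []. Qed.

Lemma ck_vertexM v : vertices v -> s v ** s v = s v.
Proof. by case: ck => [[c1 _] _ _ _] /c1 []. Qed.

Lemma ck_starM x : star (s x) ** s x = s (src x).
Proof. by case: ck. Qed.

Lemma ck_orth_src_rng x y : src x <> rng y -> s x ** s y = 0.
Proof.
move=> e; rewrite -(ck_src x) -(ck_rng y) cmulA -(cmulA (s x)).
case: ck => [[_ c1] _ _ _].
by rewrite c1 ?cmul0r ?cmul0l //; [exact: vertices_src|exact: vertices_rng].
Qed.

Lemma ck_sum v p : vertices v ->
  s v = \sum_(x <- path_seq v p) (s x ** star (s x)).
Proof.
by case: ck => _ _ _ c4 hv; rewrite (c4 v p hv) path_sumE.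
Qed.

(** Paths with different ranges are separated by (CK1). With a common range, both range projections
    occur in (CK4), whose sum is a projection, and [proj_sum_orth] applies. *)
Lemma ck_orth x y : deg x = deg y -> x <> y -> star (s x) ** s y = 0.
Proof.
move=> dxy xy.
have [e|e] := pselect (rng x = rng y); last first.
  rewrite -(ck_rng x) -(ck_rng y) starM (ck_star_vertex (vertices_rng x)).
  case: ck => [[_ c1] _ _ _].
  rewrite cmulA -(cmulA (star (s x))) c1 ?cmul0r ?cmul0l //.
    exact: vertices_rng.
  exact: vertices_rng.
pose v := rng x; have hv : vertices v := vertices_rng x.
pose q z := s z ** star (s z).
have qq z : s z ** star (s z) ** s z = s z by rewrite -cmulA ck_starM ck_src.
have : q x ** q y = 0.
  apply: (@proj_sum_orth _ _ _ (path_seq v (deg x)) q (s v)).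
  - by move=> i _; rewrite /q starM starK.
  - by move=> i _; rewrite /q cmulA qq.
  - exact: ck_star_vertex.
  - exact: ck_vertexM.
  - move=> i /(mem_path_seq _ _ hv) => -[<- _].
    by rewrite /q cmulA ck_rng.
  - exact: ck_sum.
  - exact: finmap.fset_uniq.
  - exact/mem_path_seq.
  - by apply/mem_path_seq; rewrite // /v e.
  - exact/eqP.
move=> /(congr1 (fun z => star (s x) ** z ** s y)).
rewrite cmul0r cmul0l /q => h; rewrite -{}h -!cmulA ck_starM ck_src.
rewrite !cmulA ck_starM -{1}(ck_star_vertex (vertices_src x)) -starM ck_src.
by [].
Qed.

End CuntzKrieger.

(** * The unitaries induced by the periodicity group *)

Section CountEnum.
Variable T : countType.

Definition enum_upto n : seq T := pmap (@pickle_inv T) (iota 0 n).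

Lemma enum_upto_uniq n : uniq (enum_upto n).
Proof. by rewrite (pmap_uniq (@pickle_invK T)) ?iota_uniq. Qed.

Lemma mem_enum_upto n x : (pickle x < n)%N -> x \in enum_upto n.
Proof.
move=> xn; rewrite mem_pmap; apply/mapP; exists (pickle x).
  by rewrite mem_iota.
by rewrite pickleK_inv.
Qed.

End CountEnum.

Section MultAgree.
Variables (R : realType) (D : cstarAlgType R).
Implicit Types S T : mult D.

Lemma cvs_mult S (u : nat -> D) x : cvs u x -> cvs (fun n => S (u n)) (S x).
Proof.
by apply: (@cvs_lipschitz _ _ _ S (nm S)) => y z; rewrite -mactB le_nm_mult.
Qed.

End MultAgree.

Section Pullback.
Variables (R : realType) (P : countNmodType) (Q : nmodType).
Variables (f : {additive P -> Q}) (G : pgraph Q).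
Implicit Types (l m : G) (p b : P).

Lemma pullback_sum (A : cstarAlgType R) (w : pullback f G) p (F : G * P -> A) :
  vertices w ->
  \sum_(x <- path_seq w p) F (val x) =
  \sum_(l <- path_seq (val w).1 (f p)) F (l, p).
Proof.
move=> hw; have hv : vertices (val w).1 by exact: (@pullback_deg0 _ _ _ _ w).
have w2 : (val w).2 = 0 by [].
transitivity (\sum_(x <- [seq insubd w (l, p) | l <- path_seq (val w).1 (f p)])
    F (val x)).
  apply: perm_big; apply: uniq_perm.
  - exact: path_seq_uniq.
  - rewrite map_inj_in_uniq ?path_seq_uniq // => l m.
    move=> /(mem_path_seq _ _ hv)[_ dl] /(mem_path_seq _ _ hv)[_ dm].
    by move=> /(congr1 val); rewrite !val_insubd /= dl dm eqxx => -[].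
  move=> x; apply/(mem_path_seq _ _ hw)/mapP => [[rx dx]|[l]].
    have dx' : (val x).2 = p := dx.
    exists (val x).1.
      apply/(mem_path_seq _ _ hv); split; first by rewrite -rx.
      by rewrite pullback_degP dx'.
    apply: val_inj; rewrite val_insubd /= pullback_degP dx' eqxx.
    by rewrite [LHS]surjective_pairing dx'.
  move=> /(mem_path_seq _ _ hv)[rl dl] ->.
  have vE : val (insubd w (l, p)) = (l, p) by rewrite val_insubd /= dl eqxx.
  split.
    by apply: val_inj; rewrite /= vE /= rl -w2 -surjective_pairing.
  by rewrite /deg /= /pullback_deg vE.
rewrite big_map big_seq [RHS]big_seq; apply: eq_bigr => l.
by move=> /(mem_path_seq _ _ hv)[_ dl]; rewrite val_insubd /= dl eqxx.
Qed.

End Pullback.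

Section Shift.
Variables (R : realType) (P : countNmodType) (Q : nmodType).
Variables (f : {additive P -> Q}) (G : pgraph Q).
Variables (A : cstarAlgType R) (s : pullback f G -> A).
Hypothesis s_univ : graph_cstar s.
Implicit Types (l m : G) (p b : P).

Let ck : cuntz_krieger s. Proof. by case: s_univ. Qed.

(* [s (l, p)], or 0 when [(l, p)] is not in the pullback. *)
Definition spath l p : A := if insub (l, p) is Some x then s x else 0.

Lemma spath_val (x : pullback f G) : spath (val x).1 (val x).2 = s x.
Proof. by rewrite /spath -surjective_pairing valK. Qed.

Lemma spathE (x : pullback f G) l p : val x = (l, p) -> spath l p = s x.
Proof. by move=> e; rewrite -spath_val e. Qed.

Lemma spathP l p : deg l = f p -> exists2 x : pullback f G, val x = (l, p) & spath l p = s x.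
Proof.
move=> e; have h : deg (l, p).1 == f (l, p).2 by rewrite e.
by exists (exist _ (l, p) h) => //; apply: spathE.
Qed.

Lemma spath0 l p : deg l <> f p -> spath l p = 0.
Proof. by move=> /eqP e; rewrite /spath insubN. Qed.

Lemma spathM l m p b : deg l = f p -> deg m = f b -> src l = rng m ->
  spath l p ** spath m b = spath (compose l m) (p + b).
Proof.
move=> /spathP[x xE ->] /spathP[y yE ->] lm.
have e : src (val x).1 = rng (val y).1 by rewrite xE yE.
case: ck => _ c2 _ _; rewrite c2; last exact/pullback_composable.
by apply/esym/spathE; rewrite val_pullback_comp // xE yE.
Qed.

Lemma spathM0 l m p b : src l <> rng m -> spath l p ** spath m b = 0.
Proof.
move=> lm.
have [/spathP[x xE ->]|/spath0 ->] := pselect (deg l = f p); last by rewrite cmul0l.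
have [/spathP[y yE ->]|/spath0 ->] := pselect (deg m = f b); last by rewrite cmul0r.
apply: (ck_orth_src_rng ck) => /pullback_composable; by rewrite xE yE.
Qed.

Lemma spath_starM l p : deg l = f p ->
  star (spath l p) ** spath l p = spath (src l) 0.
Proof.
move=> /spathP[x xE ->]; rewrite (ck_starM ck); apply/esym/spathE.
by rewrite /= xE.
Qed.

Lemma spath_src l p : spath l p ** spath (src l) 0 = spath l p.
Proof.
have [e|/spath0 ->] := pselect (deg l = f p); last by rewrite cmul0l.
by rewrite spathM ?comp_src ?addr0 ?rng_src // deg_src raddf0.
Qed.

Lemma spath_rng l p : spath (rng l) 0 ** spath l p = spath l p.
Proof.
have [e|/spath0 ->] := pselect (deg l = f p); last by rewrite cmul0r.
by rewrite spathM ?comp_rng ?add0r ?src_rng // deg_rng raddf0.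
Qed.

Lemma spath_orth l m p : l <> m -> star (spath l p) ** spath m p = 0.
Proof.
move=> lm.
have [/spathP[x xE ->]|/spath0 ->] := pselect (deg l = f p); last by rewrite star0 cmul0l.
have [/spathP[y yE ->]|/spath0 ->] := pselect (deg m = f p); last by rewrite cmul0r.
apply: (ck_orth ck).
  by rewrite -[deg x]/(val x).2 -[deg y]/(val y).2 xE yE.
by move=> xy; apply: lm; move: yE; rewrite -xy xE => -[].
Qed.

(** (CK4) of the pullback at degree p runs over paths of [G] of degree [f p]; this index set is the
    same for all p in one fibre of [f]. *)
Lemma spath_sum v p : vertices v ->
  spath v 0 = \sum_(l <- path_seq v (f p)) spath l p ** star (spath l p).
Proof.
move=> hv; have : deg v = f 0 by rewrite raddf0.
move=> /spathP[w wE ->]; have hw : vertices w := congr1 snd wE.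
rewrite (ck_sum ck p hw) -[v](congr1 fst wE).
rewrite -(pullback_sum p (fun x => spath x.1 x.2 ** star (spath x.1 x.2)) hw).
by apply: eq_bigr => x _; rewrite spath_val.
Qed.

Lemma spath_star_vertex v : vertices v -> star (spath v 0) = spath v 0.
Proof.
move=> hv; rewrite (spath_sum 0 hv) star_sum; apply: eq_bigr => l _.
by rewrite starM starK.
Qed.

Lemma spath_vertexM v : vertices v -> spath v 0 ** spath v 0 = spath v 0.
Proof.
move=> hv; have : deg v = f 0 by rewrite raddf0.
by move=> /spathP[w wE ->]; exact: (ck_vertexM ck (congr1 snd wE)).
Qed.

Lemma spath_star_src l p : spath (src l) 0 ** star (spath l p) = star (spath l p).
Proof.
by rewrite -{2}(spath_src l p) starM spath_star_vertex //; exact: vertices_src.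
Qed.

Lemma csub_spath (S : csubalg A) : (forall l p, S (spath l p)) -> forall a, S a.
Proof.
by move=> h; apply: (graph_cstar_ind s_univ) => x; rewrite -spath_val.
Qed.

(** Truncates the strictly convergent sum attached to p - b. Paths of the wrong degree need no
    filtering, as [spath] is 0 on them. *)
Definition msum n p b : A :=
  \sum_(l <- enum_upto G n) spath l p ** star (spath l b).

Lemma star_msum n p b : star (msum n p b) = msum n b p.
Proof.
by rewrite star_sum; apply: eq_bigr => l _; rewrite starM starK.
Qed.

Lemma msum_spath n p b l : f p = f b -> l \in enum_upto G n ->
  msum n p b ** spath l b = spath l p.
Proof.
move=> pb ln; rewrite cmul_suml (bigD1_seq l) ?enum_upto_uniq //=.
rewrite big1 => [|m /eqP ml]; last by rewrite -cmulA spath_orth ?cmul0r.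
have [e|e] := pselect (deg l = f b).
  by rewrite addr0 -cmulA spath_starM // spath_src.
by rewrite !(@spath0 l) // ?pb // cmul0r addr0.
Qed.

Lemma msumM n p b c : f p = f b -> msum n p b ** msum n b c = msum n p c.
Proof.
move=> pb; rewrite cmul_sumr big_seq [RHS]big_seq; apply: eq_bigr => l ln.
by rewrite cmulA msum_spath.
Qed.

Lemma nm_msum n p b : f p = f b -> nm (msum n p b) <= 1.
Proof.
by move=> pb; apply: nm_proj_le1; rewrite star_msum !msumM.
Qed.

Lemma msum_ev p b l : f p = f b ->
  exists N, forall n, (N <= n)%N -> msum n p b ** spath l b = spath l p.
Proof.
move=> pb; exists (pickle l).+1 => n ln.
by rewrite msum_spath // mem_enum_upto.
Qed.

Lemma cvs_msum_spath p b l a : f p = f b ->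
  cvs (fun n => msum n p b ** (spath l b ** a)) (spath l p ** a).
Proof.
move=> pb; apply: cvs_ev (cvs_cst _); have [N hN] := msum_ev l pb.
by exists N => n /hN h; rewrite cmulA h.
Qed.

(** [msum n p b] is eventually constant on s_(l, b) a. By (CK4) at degree b, a vertex projection
    times anything is a finite sum of such products. The uniform bound 1 extends convergence to the
    closed subalgebra generated, which is [A]. *)
Lemma csq_msum p b a : f p = f b -> csq (fun n => msum n p b ** a).
Proof.
(* Convergence at a passes to a y by right multiplication but not visibly to the adjoint; carrying
   [star a] along makes the set self-adjoint. *)
pose pr a := forall p b, f p = f b -> csq (fun n => msum n p b ** a) /\
  csq (fun n => msum n p b ** star a).
move=> pb; suff /(_ a _ _ pb) [] : forall a, pr a by [].
have lip1 x p' b' n : f p' = f b' -> nm (msum n p' b' ** x) <= nm x.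
  move=> e; apply: le_trans (nmM _ _) _.
  by rewrite ler_piMl ?nm_ge0 // nm_msum.
have closed u x p' b' : f p' = f b' ->
    (forall k : nat, csq (fun n => msum n p' b' ** u k)) -> cvs u x ->
    csq (fun n => msum n p' b' ** x).
  move=> e uc ux r r0; have r3 : 0 < r / 3 by lra.
  have [K /(_ K (leqnn _)) hK] := ux _ r3; have [N hN] := uc K _ r3.
  exists N => n j Nn Nj; have := hN n j Nn Nj.
  have := nm_tri (msum n p' b' ** u K) (msum n p' b' ** x) (msum j p' b' ** x).
  have := nm_tri (msum j p' b' ** u K) (msum n p' b' ** u K) (msum j p' b' ** x).
  rewrite -!cmulBr.
  have := lip1 (u K - x) _ _ j e; have := lip1 (x - u K) _ _ n e.
  by rewrite (nmC x); move: hK; set d := nm (u K - x); lra.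
have vert v x p' b' : f p' = f b' -> vertices v ->
    csq (fun n => msum n p' b' ** (spath v 0 ** x)).
  move=> e hv; rewrite (spath_sum b' hv).
  under eq_fun do rewrite cmul_suml cmul_sumr.
  apply: csq_sum => l; under eq_fun do rewrite -cmulA.
  exact: cvs_csq (cvs_msum_spath _ _ e).
suff [S SE] : exists S : csubalg A, pr = S.
  rewrite SE; apply: csub_spath => l d; rewrite -SE => p' b' e.
  split.
    by rewrite -spath_rng; apply: vert => //; exact: vertices_rng.
  by rewrite -spath_star_src; apply: vert => //; exact: vertices_src.
unshelve eexists (@CSubalg _ _ pr _ _ _ _ _ _) => //.
- move=> p' b' _; rewrite star0; split; apply: (@cvs_csq _ _ _ 0);
  apply: cvs_ev (cvs_cst _); by exists 0%N => n _; rewrite cmul0r.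
- move=> x y hx hy p' b' e; have [x1 x2] := hx _ _ e; have [y1 y2] := hy _ _ e.
  by split; [|rewrite starD]; under eq_fun do rewrite cmulDr; exact: csqD.
- move=> c x hx p' b' e; have [x1 x2] := hx _ _ e.
  have h y z : csq (fun n => msum n p' b' ** y) ->
      csq (fun n => msum n p' b' ** (z *: y)).
    apply: (@csq_dominated _ _ _ _ _ (complex.Re `|z|)) => n j.
    by rewrite !cmulZr -scalerBr nmZ.
  by split; [|rewrite starZ]; exact: h.
- move=> x y hx hy p' b' e; have [x1 x2] := hx _ _ e; have [y1 y2] := hy _ _ e.
  have h z t : csq (fun n => msum n p' b' ** z) ->
      csq (fun n => msum n p' b' ** (z ** t)).
    apply: (@csq_dominated _ _ _ _ _ (nm t)) => n j.
    by rewrite !cmulA -cmulBl mulrC nmM.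
  by split; [|rewrite starM]; exact: h.
- by move=> x hx p' b' e; have [x1 x2] := hx _ _ e; rewrite starK.
- move=> u x hu ux p' b' e; split.
    by apply: (closed _ _ _ _ e _ ux) => k; have [] := hu k _ _ e.
  by apply: (closed _ _ _ _ e _ (cvs_star ux)) => k; have [] := hu k _ _ e.
Qed.

(** The adjoint of [msum n p b] is [msum n b p], so the limit for the swapped pair is the adjoint of
    the limit. *)
Lemma shift_ex p b : f p = f b ->
  exists S : mult A, forall a, cvs (fun n => msum n p b ** a) (S a).
Proof.
move=> pb.
have lim p' b' : f p' = f b' ->
    exists g : A -> A, forall a, cvs (fun n => msum n p' b' ** a) (g a).
  move=> e; have /choice[g hg] : forall a, exists y, cvs (fun n => msum n p' b' ** a) y.
    by move=> a; apply: csq_cvs; exact: csq_msum.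
  by exists g.
have [g hg] := lim p b pb; have [h hh] := lim b p (esym pb).
have adj x y : star (g x) ** y = star x ** h y.
  apply: (@cvs_unique _ _ (fun n => star (msum n p b ** x) ** y)).
    by apply: cvs_mulr; exact: cvs_star.
  apply: cvs_ev (cvs_mull (star x) (hh y)).
  by exists 0%N => n _; rewrite starM star_msum cmulA.
have bd : exists M : R, forall x, nm (g x) <= M * nm x.
  exists 1 => x; apply: cvs_le_cst (hg x) => n.
  by apply: le_trans (nmM _ _) _; rewrite ler_wpM2r ?nm_ge0 ?nm_msum.
by exists (Mult adj bd).
Qed.

(* The strict limit of the partial isometries [msum n p b]. *)
Definition pshift p b : mult A :=
  get [set S : mult A | forall a, cvs (fun n => msum n p b ** a) (S a)].

Lemma shift_cvs p b a : f p = f b -> cvs (fun n => msum n p b ** a) (pshift p b a).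
Proof. by move=> pb; have /xgetPex := shift_ex pb; apply. Qed.

Lemma shift_star p b : f p = f b -> star (pshift p b) = pshift b p.
Proof.
move=> pb; apply: mult_ext => y; apply: cmul_left_faithful => x.
rewrite -(starK x) -mstarP.
apply: (@cvs_unique _ _ (fun n => star (msum n p b ** star x) ** y)).
  by apply: cvs_mulr; apply: cvs_star; exact: shift_cvs.
apply: cvs_ev (cvs_mull (star (star x)) (shift_cvs y (esym pb))).
by exists 0%N => n _; rewrite starM star_msum cmulA.
Qed.

Lemma shift_spath0 p b l : f p = f b -> pshift p b (spath l b) = spath l p.
Proof.
move=> pb; apply: (@cvs_unique _ _ (fun n => msum n p b ** spath l b)).
  exact: shift_cvs.
apply: cvs_ev (cvs_cst _); have [N hN] := msum_ev l pb.
by exists N => n /hN h; rewrite h.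
Qed.

Lemma shift_spath p b m d c : f p = f b -> f d = f c -> d + b = c + p ->
  pshift p b (spath m c) = spath m d.
Proof.
move=> pb dc dbcp.
have [dm|dm] := pselect (deg m = f c); last first.
  by rewrite !(@spath0 m) ?dc // mact0.
rewrite -spath_src -[RHS]spath_src (spath_sum b (vertices_src m)).
rewrite !cmul_sumr mact_sum big_seq [RHS]big_seq; apply: eq_bigr => n.
move=> /(mem_path_seq _ _ (vertices_src m))[rn dn].
rewrite !cmulA mactM; congr (_ ** _).
rewrite !spathM ?dc //.
have : deg (compose m n) = f b + f c by rewrite deg_comp // dm dn addrC.
move=> /factorization[[y z] [/= [yz dy dz ->] _]].
rewrite (addrC c).
rewrite -(spathM dy dz yz) mactM shift_spath0 // spathM ?dy //.
by rewrite (addrC p) -dbcp.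
Qed.

(** One fixed b suffices: every generator and its adjoint starts with a vertex projection, which by
    (CK4) lies in the right ideal generated by the [spath l b]. *)
Lemma mult_spath_ext (S T : mult A) b :
  (forall l, S (spath l b) = T (spath l b)) -> S = T.
Proof.
move=> e.
have v v : vertices v -> S (spath v 0) = T (spath v 0).
  move=> hv; rewrite (spath_sum b hv) !mact_sum; apply: eq_bigr => l _.
  by rewrite !mactM e.
pose pr a := S a = T a /\ S (star a) = T (star a).
suff h : forall a, pr a by apply: mult_ext => a; case: (h a).
suff [S' SE] : exists S' : csubalg A, pr = S'.
  rewrite SE; apply: csub_spath => l d; rewrite -SE; split.
    by rewrite -spath_rng !mactM v //; exact: vertices_rng.
  by rewrite -spath_star_src !mactM v //; exact: vertices_src.
unshelve eexists (@CSubalg _ _ pr _ _ _ _ _ _) => //.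
- by rewrite /pr star0 !mact0.
- by move=> x y [x1 x2] [y1 y2]; rewrite /pr starD !mactD x1 x2 y1 y2.
- by move=> c x [x1 x2]; rewrite /pr starZ !mactZ x1 x2.
- by move=> x y [x1 x2] [y1 y2]; rewrite /pr starM !mactM x1 y2.
- by move=> x [x1 x2]; rewrite /pr starK.
- move=> u x hu ux; split.
    apply: (@cvs_unique _ _ (fun n => S (u n))); first exact: cvs_mult.
    by under eq_fun do rewrite (proj1 (hu _)); exact: cvs_mult.
  apply: (@cvs_unique _ _ (fun n => S (star (u n)))).
    by apply: cvs_mult; exact: cvs_star.
  under eq_fun do rewrite (proj2 (hu _)).
  by apply: cvs_mult; exact: cvs_star.
Qed.

Lemma shift_id p : pshift p p = 1.
Proof. by apply: (@mult_spath_ext _ _ p) => l; rewrite shift_spath0. Qed.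

(** Both sides are computed on s_(l, b + b'), a degree that [shift_spath] can handle for either
    pair. *)
Lemma shift_eq p b p' b' : f p = f b -> f p' = f b' -> p + b' = p' + b ->
  pshift p b = pshift p' b'.
Proof.
move=> e e' h; apply: (@mult_spath_ext _ _ (b + b')) => l.
rewrite (@shift_spath p b l (p + b') (b + b')) //.
- rewrite (@shift_spath p' b' l (p' + b) (b + b')) ?h //.
    by rewrite !raddfD e' addrC.
  by rewrite -addrA addrC.
- by rewrite !raddfD e.
- by rewrite -addrA addrC (addrC b').
Qed.

Lemma shiftM p b p' b' : f p = f b -> f p' = f b' ->
  pshift p b * pshift p' b' = pshift (p + p') (b + b').
Proof.
move=> e e'; apply: (@mult_spath_ext _ _ (b + b')) => l.
rewrite mmulE shift_spath0 ?raddfD ?e ?e' //.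
rewrite (@shift_spath p' b' l (b + p') (b + b')) ?raddfD ?e' //; last first.
  by rewrite addrAC.
rewrite (@shift_spath p b l (p + p') (b + p')) ?raddfD ?e //.
by rewrite addrAC [in RHS]addrAC (addrC p).
Qed.

Lemma shiftM_eq p b p' b' c d : f p = f b -> f p' = f b' -> f c = f d ->
  p + p' + d = c + (b + b') -> pshift p b * pshift p' b' = pshift c d.
Proof.
move=> e e' e2 h; rewrite shiftM //; apply: shift_eq => //.
by rewrite !raddfD e e'.
Qed.

(** On products s_(m, d) s_(l, b) both orders give the path m l in a degree shifted by p - b:
    degrees add up, so it does not matter which factor is shifted. *)
Lemma shift_lmult p b a : f p = f b ->
  pshift p b * lmult a = lmult a * pshift p b.
Proof.
move=> pb.
have gen m d p' b' : f p' = f b' ->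
    pshift p' b' * lmult (spath m d) = lmult (spath m d) * pshift p' b'.
  move=> e; apply: (@mult_spath_ext _ _ b') => l.
  rewrite !mmulE !lmultE shift_spath0 //.
  have [dm|/spath0 ->] := pselect (deg m = f d); last first.
    by rewrite !cmul0l mact0.
  have [dl|dl] := pselect (deg l = f b'); last first.
    by rewrite !(@spath0 l) ?e // !cmul0r mact0.
  have [ml|ml] := pselect (src m = rng l); last first.
    by rewrite !spathM0 // mact0.
  rewrite !spathM ?e //; apply: shift_spath => //.
    by rewrite !raddfD e.
  by rewrite addrAC.
pose pr a := pshift p b * lmult a = lmult a * pshift p b /\
  pshift p b * lmult (star a) = lmult (star a) * pshift p b.
suff h : forall a, pr a by case: (h a).
have [lZD lM lS] := lmult_hom A; have lD := star_homD (lmult_hom A).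
suff [S' SE] : exists S' : csubalg A, pr = S'.
  rewrite SE; apply: csub_spath => l d; rewrite -SE; split; first exact: gen.
  apply: (@starI _ (mult A)).
  by rewrite -!cmulE !starM lS !starK shift_star // !cmulE gen.
unshelve eexists (@CSubalg _ _ pr _ _ _ _ _ _) => //.
- by rewrite /pr star0 (star_hom0 (lmult_hom A)) !mulr0 !mul0r.
- move=> x y [x1 x2] [y1 y2]; rewrite /pr starD !lD !mulrDr !mulrDl.
  by rewrite x1 x2 y1 y2.
- move=> c x [x1 x2]; rewrite /pr starZ.
  have lZ z y : lmult (z *: y) = z *: lmult y :> mult A.
    by apply: mult_ext => t; rewrite /= cmulZl.
  by rewrite !lZ -!cmulE !cmulZr !cmulZl !cmulE x1 x2.
- move=> x y [x1 x2] [y1 y2]; rewrite /pr starM !lM !cmulE.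
  by split; rewrite mulrA ?x1 ?y2 -mulrA ?y1 ?x2 mulrA.
- by move=> x [x1 x2]; rewrite /pr starK.
- have c u x : (forall n : nat, pshift p b * lmult (u n) = lmult (u n) * pshift p b) ->
      cvs u x -> pshift p b * lmult x = lmult x * pshift p b.
    move=> uc ux; apply: mult_ext => y.
    apply: (@cvs_unique _ _ (fun n => pshift p b (u n ** y))).
      by apply: cvs_mult; exact: cvs_mulr.
    apply: cvs_ev (cvs_mulr (pshift p b y) ux); exists 0%N => n _.
    by have := congr1 (fun S : mult A => S y) (uc n) => /= ->.
  move=> u x hu ux; split.
    by apply: c ux => n; case: (hu n).
  by apply: c (cvs_star ux) => n; case: (hu n).
Qed.

End Shift.

Global Opaque spath pshift.

(** * Roots of unitaries *)

Section BinomialCoefficients.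
Variable R : realType.
Implicit Types (a b : R) (n N : nat).

(* Coefficients of the power series of [(1 - x) `^ a]. *)
Fixpoint bcoef a n : R :=
  if n is n'.+1 then bcoef a n' * (n'%:R - a) / n'.+1%:R else 1.

Lemma bcoefS a n : n.+1%:R * bcoef a n.+1 = (n%:R - a) * bcoef a n.
Proof. by rewrite /=; field. Qed.

(** Coefficientwise Leibniz rule: multiply by n+1 = i + (n+1-i), apply [bcoefS] to each factor, and
    the weights add up to n - (a + b). *)
Lemma bcoef_vandermonde a b n :
  \sum_(i < n.+1) bcoef a i * bcoef b (n - i)%N = bcoef (a + b) n.
Proof.
elim: n => [|n IH]; first by rewrite big_ord1 /= mulr1.
apply: (@mulfI _ n.+1%:R); first by rewrite pnatr_eq0.
rewrite bcoefS -IH !mulr_sumr.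
transitivity (\sum_(i < n.+2) (i%:R * bcoef a i * bcoef b (n.+1 - i)%N +
    bcoef a i * ((n.+1 - i)%:R * bcoef b (n.+1 - i)%N))).
  apply: eq_bigr => i _; have il : (i <= n.+1)%N by rewrite -ltnS.
  by rewrite natrB //; ring.
rewrite big_split /= big_ord_recl mul0r mul0r add0r.
rewrite [X in _ + X]big_ord_recr /= subnn mul0r mulr0 addr0 -big_split /=.
apply: eq_bigr => i _; have il : (i <= n)%N by rewrite -ltnS.
rewrite /bump /= add1n bcoefS subSS subSn // bcoefS natrB //; ring.
Qed.

Lemma bcoef_le0 a n : 0 <= a <= 1 -> bcoef a n.+1 <= 0.
Proof.
move=> /andP[a0 a1]; elim: n => [|n IH].
  by rewrite /= mul1r add0r divr1 oppr_le0.
rewrite [bcoef _ _]/= -/(bcoef a n.+1) -mulrA mulr_le0_ge0 // divr_ge0 ?ler0n //.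
by rewrite subr_ge0; apply: le_trans a1 _; rewrite ler1n.
Qed.

Lemma bcoef_sum a N : a * \sum_(i < N.+1) bcoef a i = - (N.+1%:R * bcoef a N.+1).
Proof.
elim: N => [|N IH]; first by rewrite big_ord1 /= mulr1; field.
by rewrite big_ord_recr mulrDr IH (bcoefS a N.+1) -[nat_of_ord ord_max]/N.+1; ring.
Qed.

(** All coefficients after the constant 1 are nonpositive, while by [bcoef_sum] the partial sums
    stay nonnegative; so the rest has absolute sum at most 1. *)
Lemma bcoef_abs_sum a N : 0 < a <= 1 -> \sum_(i < N) `|bcoef a i| <= 2.
Proof.
move=> /andP[a0 a1]; case: N => [|N]; first by rewrite big_ord0.
have h : 0 <= \sum_(i < N.+1) bcoef a i.
  rewrite -(pmulr_rge0 _ a0) bcoef_sum oppr_ge0 mulr_ge0_le0 ?ler0n //.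
  by rewrite bcoef_le0 // ltW.
have e : \sum_(i < N) `|bcoef a (lift ord0 i)| =
    - \sum_(i < N) bcoef a (lift ord0 i).
  rewrite -sumrN; apply: eq_bigr => i _.
  by rewrite ler0_norm // lift0 bcoef_le0 // ltW.
move: h; rewrite !big_ord_recl e -[bcoef a ord0]/1 normr1; lra.
Qed.

Lemma bcoef1_0 n : bcoef 1 n.+2 = 0.
Proof.
elim: n => [|n IH]; first by rewrite /= subrr mulr0 mul0r.
by rewrite -[LHS]/(bcoef 1 n.+2 * _ / _) IH !mul0r.
Qed.

Lemma bcoef1_1 : bcoef 1 1 = -1.
Proof. by rewrite /= mul1r add0r divr1. Qed.

Lemma abs_sum_tail (c : nat -> R) (K : R) :
  (forall N, \sum_(i < N) `|c i| <= K) -> forall e, 0 < e ->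
  exists N, forall n p, (N <= n)%N -> (n <= p)%N ->
    \sum_(n <= i < p) `|c i| < e.
Proof.
move=> cK e e0; pose E := [set \sum_(i < N) `|c i| | N in setT].
have supE : has_sup E.
  by split; [exists (\sum_(i < 0) `|c i|), 0%N | exists K => _ [N _ <-]].
have [_ [N _ <-] hN] := sup_adherent e0 supE.
exists N => n p Nn np.
have h1 : \sum_(0 <= i < p) `|c i| <= sup E.
  by rewrite big_mkord; apply: (ub_le_sup supE.2); exists p.
have h2 : \sum_(i < N) `|c i| <= \sum_(0 <= i < n) `|c i|.
  rewrite -(big_mkord xpredT (fun i => `|c i|)) [leRHS](@big_cat_nat _ _ _ N) //=.
  by rewrite lerDl sumr_ge0.
by move: h1; rewrite (@big_cat_nat _ _ _ n) //=; lra.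
Qed.

End BinomialCoefficients.

Section PowerSeries.
Variables (R : realType) (D : cstarAlgType R) (X : mult D).
Hypothesis X1 : nm X <= 1.

Lemma nm_mult1 : nm (1 : mult D) <= 1.
Proof. by apply: nm_mult_le => // x; rewrite mul1r. Qed.

Lemma nm_exp_le1 (Y : mult D) n : nm Y <= 1 -> nm (Y ^+ n) <= 1.
Proof.
move=> Y1; elim: n => [|n IH]; first by rewrite expr0 nm_mult1.
rewrite exprS; apply: le_trans (nm_mmul_le _ _) _.
by rewrite mulr_ile1 ?nm_ge0.
Qed.

Definition psum (c : nat -> R) N : mult D := \sum_(i < N) (c i)%:C%C *: X ^+ i.

Lemma nm_term (c : R) n : nm (c%:C%C *: X ^+ n) <= `|c|.
Proof.
rewrite nmZ normc_def /= expr0n /= addr0 sqrtr_sqr.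
by rewrite ler_piMr // nm_exp_le1.
Qed.

Definition abs_summable (c : nat -> R) :=
  exists K : R, forall N, \sum_(i < N) `|c i| <= K.

Lemma csq_psum c : abs_summable c -> csq (psum c).
Proof.
move=> [K cK] e e0; have [N hN] := abs_sum_tail cK e0; exists N.
have h n p : (N <= n)%N -> (n <= p)%N -> nm (psum c n - psum c p) < e.
  move=> Nn np; rewrite nmC /psum.
  rewrite -!(big_mkord xpredT (fun i => (c i)%:C%C *: X ^+ i)).
  rewrite (@big_cat_nat _ _ _ n 0 p) //= [X in nm X]addrC addKr.
  apply: le_lt_trans (hN n p Nn np); apply: le_trans (nm_sum _ _ _) _.
  by apply: ler_sum => i _; exact: nm_term.
move=> n p Nn Np; case: (leqP n p) => np; first exact: h.
by rewrite nmC h // ltnW.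
Qed.

Definition conv (c d : nat -> R) n := \sum_(i < n.+1) c i * d (n - i)%N.

Lemma psumM c d N : psum c N * psum d N - psum (conv c d) N =
  \sum_(i < N) \sum_(j < N | (N <= i + j)%N)
    (c i * d j)%:C%C *: X ^+ (i + j).
Proof.
have -> : psum c N * psum d N = \sum_(i < N) \sum_(j < N)
    (c i * d j)%:C%C *: X ^+ (i + j).
  rewrite mulr_suml; apply: eq_bigr => i _.
  rewrite mulr_sumr; apply: eq_bigr => j _.
  by rewrite -!cmulE cmulZl cmulZr scalerA -rmorphM cmulE exprD.
have -> : psum (conv c d) N = \sum_(i < N) \sum_(j < N | (i + j < N)%N)
    (c i * d j)%:C%C *: X ^+ (i + j).
  transitivity (\sum_(n < N) \sum_(i < N | (i <= n)%N)
      (c i * d (n - i)%N)%:C%C *: X ^+ n).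
    apply: eq_bigr => n _; rewrite /conv rmorph_sum scaler_suml /=.
    pose F i := (c i * d (n - i)%N)%:C%C *: X ^+ n : mult D.
    rewrite -[LHS](big_mkord xpredT F) (big_nat_widen _ _ N) //.
    by rewrite big_mkord; apply: eq_bigl => i; rewrite ltnS.
  rewrite (exchange_big_dep xpredT) //=; apply: eq_bigr => i _.
  pose F n := (c i * d (n - i)%N)%:C%C *: X ^+ n : mult D.
  have iN : (i <= N)%N by apply: ltnW.
  transitivity (\sum_(i <= n < N) F n).
    by rewrite (big_nat_widenl i 0) // big_mkord.
  rewrite -{1}(add0n i) big_addn big_mkord.
  pose H j := (c i * d j)%:C%C *: X ^+ (i + j) : mult D.
  rewrite -(big_mkord (fun j => (i + j < N)%N) H).
  transitivity (\sum_(0 <= j < N - i) H j).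
    by rewrite big_mkord; apply: eq_bigr => j _; rewrite /F /H addnK addnC.
  rewrite (big_nat_widen _ (N - i) N) ?leq_subr //=; apply: eq_bigl => j.
  by rewrite ltn_subRL.
rewrite -sumrB; apply: eq_bigr => i _.
apply/eqP; rewrite subr_eq (bigID (fun j : 'I_N => (N <= i + j)%N)) /=.
apply/eqP; congr (_ + _); apply: eq_bigl => j; exact/esym/ltnNge.
Qed.

(** The difference consists of the terms with i + j >= N. For N >= 2 m one of i, j is at least m, so
    it is bounded by tails of one series times the total of the other. *)
Lemma cvs_psumM c d : abs_summable c -> abs_summable d ->
  cvs (fun N => psum c N * psum d N - psum (conv c d) N) 0.
Proof.
move=> [K cK] [L dL] e e0; pose M := 1 + `|K| + `|L|.
have M0 : 0 < M by rewrite /M -addrA ltr_pwDl // addr_ge0.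
have eM : 0 < e / (2 * M) by rewrite divr_gt0 ?mulr_gt0.
have [N1 h1] := abs_sum_tail cK eM; have [N2 h2] := abs_sum_tail dL eM.
exists (2 * maxn N1 N2)%N => N NN; rewrite subr0 psumM.
set m := maxn N1 N2 in NN.
have mN : (m <= N)%N by lia.
apply: le_lt_trans (_ : \sum_(i < N) \sum_(j < N)
    ((m <= i)%:R * `|c i| * `|d j| + (m <= j)%:R * `|c i| * `|d j|) < e).
  apply: le_trans (nm_sum _ _ _) _; apply: ler_sum => i _.
  apply: le_trans (nm_sum _ _ _) _; rewrite big_mkcond /=; apply: ler_sum => j _.
  have pos : 0 <= (m <= i)%:R * `|c i| * `|d j| + (m <= j)%:R * `|c i| * `|d j|.
    by rewrite addr_ge0 // !mulr_ge0.
  case: ifPn => // ij; apply: le_trans (nm_term _ _) _; rewrite normrM.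
  have [mi|im] := leqP m i; first by rewrite mul1r lerDl !mulr_ge0.
  have -> : (m <= j)%N by lia.
  by rewrite mul1r lerDr !mulr_ge0.
have tail (u : nat -> R) n : (n <= N)%N ->
    \sum_(i < N) (n <= i)%:R * `|u i| = \sum_(n <= i < N) `|u i|.
  move=> nN; pose F i := `|u i|.
  rewrite -[RHS]/(\sum_(n <= i < N) F i) (big_nat_widenl _ 0) // big_mkord.
  rewrite [RHS]big_mkcond /=; apply: eq_bigr => i _.
  by case: leqP; rewrite ?mul1r ?mul0r.
under eq_bigr do rewrite big_split /= -mulr_sumr.
rewrite big_split /= -mulr_suml tail // exchange_big /=.
under [X in _ + X]eq_bigr => j _.
  under eq_bigr => i _ do rewrite mulrAC.
  rewrite -mulr_sumr; over.
rewrite -mulr_suml tail //.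
have c1 : \sum_(m <= i < N) `|c i| < e / (2 * M) by apply: h1; rewrite ?leq_maxl.
have d1 : \sum_(m <= i < N) `|d i| < e / (2 * M) by apply: h2; rewrite ?leq_maxr.
have c2 : \sum_(i < N) `|c i| <= M.
  by apply: le_trans (cK N) _; rewrite /M; have := ler_norm K; have := normr_ge0 L; lra.
have d2 : \sum_(i < N) `|d i| <= M.
  by apply: le_trans (dL N) _; rewrite /M; have := ler_norm L; have := normr_ge0 K; lra.
have c0 : 0 <= \sum_(m <= i < N) `|c i| by rewrite sumr_ge0.
have d0 : 0 <= \sum_(m <= i < N) `|d i| by rewrite sumr_ge0.
apply: le_lt_trans (_ : (\sum_(m <= i < N) `|c i| + \sum_(m <= i < N) `|d i|) * M < e).
  by rewrite mulrDl; apply: lerD; rewrite ler_wpM2l.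
rewrite -ltr_pdivlMr //; have -> : e / M = e / (2 * M) + e / (2 * M).
  by field; rewrite gt_eqF.
exact: ltrD.
Qed.

End PowerSeries.

Section RootElement.
Variables (R : realType) (D : cstarAlgType R).
Implicit Types X Y f g : mult D.

Lemma cvsM (A : cstarAlgType R) (u v : nat -> A) x y :
  cvs u x -> cvs v y -> cvs (fun n => u n ** v n) (x ** y).
Proof.
move=> ux vy e e0; pose M := 1 + nm x + nm y.
have M0 : 0 < M by rewrite /M -addrA ltr_pwDl // addr_ge0 ?nm_ge0.
have eM : 0 < e / (2 * M) by rewrite divr_gt0 ?mulr_gt0.
have [N1 h1] := ux _ eM; have [N2 h2] := vy _ eM; have [N3 h3] := ux 1 ltr01.
exists (maxn N1 (maxn N2 N3)) => n; rewrite !geq_max => /andP[/h1 {}h1].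
move=> /andP[/h2 {}h2 /h3 {}h3].
have -> : u n ** v n - x ** y = u n ** (v n - y) + (u n - x) ** y.
  by rewrite cmulBr cmulBl addrA subrK.
apply: le_lt_trans (nmD _ _) _.
have u1 : nm (u n) <= M.
  have := nm_tri x (u n) 0; rewrite !subr0 /M => h; have := nm_ge0 y; lra.
have y1 : nm y <= M by rewrite /M; have := nm_ge0 x; lra.
apply: le_lt_trans (_ : M * nm (v n - y) + nm (u n - x) * M < e).
  apply: lerD; apply: le_trans (nmM _ _) _.
    by rewrite ler_wpM2r ?nm_ge0.
  by rewrite ler_wpM2l ?nm_ge0.
rewrite mulrC -mulrDl -ltr_pdivlMr //.
have -> : e / M = e / (2 * M) + e / (2 * M) by field; rewrite gt_eqF.
exact: ltrD.
Qed.

(** [S a] is the series for (1 - X)^a, and g = S (1/m). The law S a * S b = S (a + b) is needed only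
    for exponents in (0, 1], where the coefficients are absolutely summable, since k/m <= 1 for all
    powers involved. *)
Lemma unit_sub_root X m : nm X <= 1 -> (0 < m)%N ->
  exists g, g ^+ m = 1 - X /\
    forall f, GRing.comm f X -> GRing.comm f g.
Proof.
move=> X1 m0.
have summ (a : R) : 0 < a <= 1 -> abs_summable (bcoef a).
  by move=> a01; exists 2 => N; exact: bcoef_abs_sum.
have /choice[S hS] (a : R) : exists g, 0 < a <= 1 -> cvs (psum X (bcoef a)) g.
  have [a01|a01] := pselect (0 < a <= 1); last by exists 0.
  by have [g hg] := csq_cvs (csq_psum X1 (summ a a01)); exists g.
have SM (a b : R) : 0 < a <= 1 -> 0 < b <= 1 -> a + b <= 1 ->
    S a * S b = S (a + b).
  move=> a01 b01 ab1; have ab01 : 0 < a + b <= 1 by lra.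
  have h1 := cvsM (hS a a01) (hS b b01).
  apply: cvs_unique h1 _.
  have := cvsD (cvs_psumM X1 (summ a a01) (summ b b01)) (hS (a + b) ab01).
  rewrite add0r; apply: cvs_ev; exists 0%N => n _.
  rewrite (_ : conv (bcoef a) (bcoef b) = bcoef (a + b)) ?subrK //.
  by apply/funext => j; exact: bcoef_vandermonde.
have S1 : S 1 = 1 - X.
  have h1 : 0 < (1 : R) <= 1 by rewrite ltr01 lexx.
  apply: cvs_unique (hS 1 h1) _.
  apply: cvs_ev (cvs_cst _); exists 2 => -[|[|n]] // _.
  rewrite /psum !big_ord_recl big1 => [|i _].
    rewrite addr0 expr0 lift0 bcoef1_1 expr1 scale1r.
    by rewrite rmorphN rmorph1 scaleN1r.
  by rewrite !lift0 bcoef1_0 scale0r.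
pose a : R := m%:R^-1.
have a0 : 0 < a by rewrite invr_gt0 ltr0n.
have pw k : (k < m)%N -> S a ^+ k.+1 = S (k.+1%:R * a).
  elim: k => [_|k IH km]; first by rewrite expr1 mul1r.
  have le1 j : (j <= m)%N -> j%:R * a <= 1.
    by move=> jm; rewrite ler_pdivrMr ?ltr0n // mul1r ler_nat.
  rewrite exprS IH ?(ltnW km) // SM.
  - by rewrite -[in RHS]natr1 mulrDl mul1r addrC.
  - by rewrite a0; have := le1 1%N m0; rewrite mul1r.
  - by rewrite mulr_gt0 ?ltr0n //= le1 // ltnW.
  - by rewrite addrC -{2}[a]mul1r -mulrDl natr1 le1.
exists (S a); split.
  rewrite -(prednK m0) pw ?prednK // mulfV ?S1 // pnatr_eq0.
  by rewrite -lt0n.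
have a1 : 0 < a <= 1.
  by rewrite a0 invf_le1 ?ltr0n // ler1n.
move=> f fX; apply: (@cvs_unique _ _ (fun n => f ** psum X (bcoef a) n)).
  exact: cvs_mull (hS a a1).
apply: cvs_ev (cvs_mulr f (hS a a1)); exists 0%N => n _.
rewrite cmul_suml cmul_sumr; apply: eq_bigr => i _.
by rewrite cmulZl cmulZr; congr (_ *: _); exact/esym/commrX.
Qed.

End RootElement.

(** * A root on the ideal where a unitary has no fixed vector *)

Section UnitaryRoot.
Variables (R : realType) (D : cstarAlgType R) (X : mult D).
Hypotheses (XsX : star X * X = 1) (XXs : X * star X = 1).
Implicit Types f x y : mult D.

Let com f := GRing.comm f X.

Lemma nm_unitary : nm X <= 1.
Proof. by apply: nm_proj_le1; rewrite !cmulE XsX mulr1. Qed.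

Lemma com_star f : com f -> com (star f).
Proof.
move=> fX; rewrite /com /GRing.comm.
have : X * (star X * star f) * X = X * (star f * star X) * X.
  by rewrite -!cmulE -!starM !cmulE fX.
by rewrite !mulrA XXs mul1r -mulrA XsX mulr1.
Qed.

Lemma com_X : com X. Proof. exact: commr_refl. Qed.

Definition avg n : mult D := (n.+1%:R^-1)%:C%C *: \sum_(i < n.+1) X ^+ i.

(** The quotient of [1 - avg n] by [1 - X], from 1 - X^i = (1 - X)(1 + X + ... + X^(i-1)). *)
Definition avg_quo n : mult D :=
  (n.+1%:R^-1)%:C%C *: \sum_(i < n.+1) \sum_(j < i) X ^+ j.

Lemma comm_scale f x (c : R[i]) : GRing.comm f x -> GRing.comm f (c *: x).
Proof.
by rewrite /GRing.comm => h; rewrite -!cmulE cmulZl cmulZr !cmulE h.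
Qed.

Lemma com_avg f n : com f -> GRing.comm f (avg n).
Proof.
by move=> h; apply/comm_scale/commr_sum => i _; exact: commrX.
Qed.

Lemma com_avg_quo f n : com f -> GRing.comm f (avg_quo n).
Proof.
move=> h; apply/comm_scale/commr_sum => i _; apply/commr_sum => j _.
exact: commrX.
Qed.

Lemma nm_avg n : nm (avg n) <= 1.
Proof.
rewrite nmZ_real ?invr_ge0 ?ler0n // mulrC ler_pdivrMr ?ltr0n // mul1r.
apply: le_trans (nm_sum _ _ _) _.
apply: le_trans (_ : \sum_(i < n.+1) 1 <= _); last by rewrite sumr_const card_ord.
by apply: ler_sum => i _; rewrite nm_exp_le1 // nm_unitary.
Qed.

Lemma scale_natVK n y : (n.+1%:R^-1)%:C%C *: (y *+ n.+1) = y.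
Proof.
rewrite -(@scaler_nat R[i]) scalerA -(rmorph_nat (real_complex R)) -rmorphM.
by rewrite mulVf ?pnatr_eq0 // rmorph1 scale1r.
Qed.

Lemma one_sub_avg n : 1 - avg n = (1 - X) * avg_quo n.
Proof.
rewrite -cmulE cmulZr cmulE mulr_sumr.
under eq_bigr do rewrite -opprB mulNr -subrX1 opprB.
by rewrite sumrB sumr_const card_ord scalerBr scale_natVK.
Qed.

Lemma avg_mul n : (1 - X) * avg n = (n.+1%:R^-1)%:C%C *: (1 - X ^+ n.+1).
Proof.
by rewrite -cmulE cmulZr cmulE -opprB mulNr -subrX1 opprB.
Qed.

(* [X] has no fixed vector on this ideal, by the mean ergodic theorem. *)
Definition fix_free x := com x /\ cvs (fun n => avg n * x) 0.

Lemma avg_fixed y n : X * y = y -> avg n * y = y.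
Proof.
move=> h; have hk k : X ^+ k * y = y.
  by elim: k => [|k IH]; rewrite ?mul1r // exprS -mulrA IH.
rewrite -cmulE cmulZl cmulE mulr_suml.
under eq_bigr do rewrite hk.
by rewrite sumr_const card_ord scale_natVK.
Qed.

Lemma nm_normal (a y : mult D) : GRing.comm a (star a) -> nm (star a * y) = nm (a * y).
Proof.
move=> h; apply: nm_eq_starM; rewrite !starM starK !cmulE -!mulrA.
by rewrite (mulrA a) (mulrA (star a)) h.
Qed.

Lemma avg_normal n : GRing.comm (avg n) (star (avg n)).
Proof.
apply/commr_sym/com_avg/com_star/commr_sym/com_avg; exact: com_X.
Qed.

Lemma cvs0_star_avg x : cvs (fun n => avg n * x) 0 ->
  cvs (fun n => star (avg n) * x) 0.
Proof.
by apply: (@cvs0_dominated _ _ _ _ _ 1) => n; rewrite mul1r nm_normal //; exact: avg_normal.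
Qed.

Fact fix_free0 : fix_free 0.
Proof.
split; first exact: commr_sym (commr0 _).
by apply: cvs_ev (cvs_cst _); exists 0%N => n _; rewrite mulr0.
Qed.
Fact fix_freeD x y : fix_free x -> fix_free y -> fix_free (x + y).
Proof.
move=> [x1 x2] [y1 y2]; split.
  by apply/commr_sym/commrD; exact/commr_sym.
have := cvsD x2 y2; rewrite addr0; apply: cvs_ev.
by exists 0%N => n _; rewrite mulrDr.
Qed.
Fact fix_freeZ (c : R[i]) x : fix_free x -> fix_free (c *: x).
Proof.
move=> [x1 x2]; split; first by apply/commr_sym/comm_scale/commr_sym.
apply: (cvs0_dominated _ x2) => n; rewrite -cmulE cmulZr nmZ; exact: lexx.
Qed.
Fact fix_freeM x y : fix_free x -> fix_free y -> fix_free (x ** y).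
Proof.
move=> [x1 x2] [y1 y2]; split.
  by apply/commr_sym/commrM; exact/commr_sym.
apply: (@cvs0_dominated _ _ _ _ _ (nm y) _ x2) => n.
by rewrite cmulE mulrA mulrC nm_mmul_le.
Qed.
Fact fix_freeS x : fix_free x -> fix_free (star x).
Proof.
move=> [x1 x2]; split; first exact: com_star.
apply: (@cvs0_dominated _ _ _ _ _ 1 _ x2) => n; rewrite mul1r.
rewrite -nm_star -cmulE starM starK cmulE.
have -> : x * star (avg n) = star (avg n) * x.
  apply: starI; rewrite -!cmulE !starM !starK !cmulE.
  exact/esym/com_avg/com_star.
by rewrite nm_normal //; exact: avg_normal.
Qed.
Fact fix_free_closed (u : nat -> mult D) x :
  (forall n, fix_free (u n)) -> cvs u x -> fix_free x.
Proof.
move=> hu ux; split.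
  apply: (@cvs_unique _ _ (fun n => u n ** X)); first exact: cvs_mulr.
  apply: cvs_ev (cvs_mull X ux); exists 0%N => n _.
  by have [h _] := hu n; rewrite !cmulE h.
move=> e e0; have e2 : 0 < e / 2 by lra.
have [K /(_ K (leqnn _)) hK] := ux _ e2; have [_ /(_ _ e2)[N hN]] := hu K.
exists N => n /hN; rewrite !subr0 => h.
have := nmD (avg n * (x - u K)) (avg n * u K).
have := nm_mmul_le (avg n) (x - u K); have := nm_avg n.
rewrite mulrBr subrK (nmC x) => h1 h2 h3.
have h4 : nm (avg n) * nm (u K - x) <= nm (u K - x).
  by rewrite ler_piMl ?nm_ge0.
lra.
Qed.

(** An ideal in the commutant of [X], not in all of [mult D]: its elements are required to commute
    with [X]. *)
Definition fix_free_ideal := CSubalg fix_free0 fix_freeD fix_freeZ fix_freeM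
  fix_freeS fix_free_closed.

Let J := csub fix_free_ideal.

Lemma fix_freeMl f x : com f -> fix_free x -> fix_free (f * x).
Proof.
move=> hf [x1 x2]; split; first by apply/commr_sym/commrM; exact/commr_sym.
apply: (@cvs0_dominated _ _ _ _ _ (nm f) _ x2) => n.
by rewrite mulrA -(com_avg n hf) -mulrA nm_mmul_le.
Qed.

(** (1 - X) avg n telescopes to (1 - X^(n+1)) / (n+1), of norm at most 2 / (n+1). Hence any [f]
    acting as zero on the ideal kills [1 - X]. *)
Lemma fix_free_1X : fix_free (1 - X).
Proof.
split; first exact/commr_sym/commrB/commr_refl/commr1.
move=> e e0; exists (Num.truncn (2 / e)) => n Nn; rewrite subr0.
have cA : com (1 - X) by exact/commr_sym/commrB/commr_refl/commr1.
rewrite -(com_avg n cA) avg_mul nmZ_real ?invr_ge0 ?ler0n //.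
apply: le_lt_trans (_ : n.+1%:R^-1 * 2 < e).
  rewrite ler_wpM2l ?invr_ge0 ?ler0n //; apply: le_trans (nmD _ _) _.
  by rewrite nmN; have := nm_mult1 D; have := nm_exp_le1 n.+1 nm_unitary; lra.
rewrite mulrC ltr_pdivrMr ?ltr0n // mulrC -ltr_pdivrMr //.
by apply: lt_le_trans (truncnS_gt _) _; rewrite ler_nat.
Qed.

Lemma multJ_ex (F F' : mult D -> mult D) (M : R) :
  (forall x, fix_free x -> fix_free (F x)) ->
  (forall x, fix_free x -> fix_free (F' x)) ->
  (forall x y, fix_free x -> fix_free y -> star (F x) * y = star x * F' y) ->
  (forall x, fix_free x -> nm (F x) <= M * nm x) ->
  exists S : mult J, (forall a : J, csval (S a) = F (csval a)) /\
    (forall a : J, csval (star S a) = F' (csval a)).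
Proof.
move=> FJ F'J adj bd.
pose S (x : J) : J := @CSub _ _ fix_free_ideal _ (FJ _ (csvalP x)).
pose S' (x : J) : J := @CSub _ _ fix_free_ideal _ (F'J _ (csvalP x)).
have SP a b : star (S a) ** b = star a ** S' b.
  by apply: csval_inj; exact: (adj _ _ (csvalP a) (csvalP b)).
have Sb : exists M : R, forall a, nm (S a) <= M * nm a.
  by exists M => a; exact: (bd _ (csvalP a)).
by exists (Mult SP Sb).
Qed.

(** Chosen rather than constructed, to be total: multiplication by [f] is known to preserve the
    ideal only if [f] commutes with [X]. *)
Definition act_ideal f : mult J :=
  get [set S : mult J | forall a : J, csval (S a) = f * csval a].

Lemma act_idealE f (a : J) : com f -> csval (act_ideal f a) = f * csval a.
Proof.
move=> hf; have : exists S : mult J, forall a : J, csval (S a) = f * csval a.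
  have [||||S [SE _]] := @multJ_ex (fun x => f * x) (fun x => star f * x) (nm f).
  - by move=> y; exact: fix_freeMl.
  - by move=> y; apply: fix_freeMl; exact: com_star.
  - by move=> y z _ _; rewrite -!cmulE starM cmulA.
  - by move=> y _; exact: nm_mmul_le.
  by exists S.
by move=> /xgetPex; apply.
Qed.

Lemma act_ideal_ext f (S : mult J) : com f -> (forall a : J, csval (S a) = f * csval a) ->
  S = act_ideal f.
Proof.
by move=> hf h; apply: mult_ext => x; apply: csval_inj; rewrite h act_idealE.
Qed.

Lemma act_ideal_lin (c : R[i]) f f' : com f -> com f' ->
  act_ideal (c *: f + f') = c *: act_ideal f + act_ideal f'.
Proof.
move=> h h'; apply/esym/act_ideal_ext => [|x].
  by apply/commr_sym/commrD; [apply: comm_scale|]; exact/commr_sym.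
rewrite -[LHS]/(c *: csval (act_ideal f x) + csval (act_ideal f' x)).
by rewrite !act_idealE // mulrDl -!cmulE cmulZl.
Qed.

Lemma act_idealM f f' : com f -> com f' ->
  act_ideal (f * f') = act_ideal f * act_ideal f'.
Proof.
move=> h h'; apply/esym/act_ideal_ext => [|x].
  by apply/commr_sym/commrM; exact/commr_sym.
by rewrite mmulE !act_idealE // mulrA.
Qed.

Lemma act_ideal1 : act_ideal 1 = 1.
Proof.
by apply/esym/act_ideal_ext => [|x]; [exact/commr_sym/commr1 | rewrite mul1r].
Qed.

Lemma act_ideal_star f : com f -> act_ideal (star f) = star (act_ideal f).
Proof.
move=> hf; apply: mult_ext => y; apply: cmul_left_faithful => x.
rewrite -(starK x) -mstarP; apply: csval_inj.
rewrite -[LHS]/(star (csval (star x)) * csval (act_ideal (star f) y)).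
rewrite -[RHS]/(star (csval (act_ideal f (star x))) * csval y).
rewrite act_idealE; last exact: com_star.
by rewrite act_idealE // -!cmulE starM cmulA.
Qed.

Lemma act_ideal_eq0 f : com f -> act_ideal f = 0 -> f * (1 - X) = 0.
Proof.
move=> hf h; have := act_idealE (@CSub _ _ fix_free_ideal _ fix_free_1X) hf.
by rewrite h => /= <-.
Qed.

Section Root.
Variables (m : nat) (g : mult D).
Hypotheses (m0 : (0 < m)%N) (gm : g ^+ m = 1 - X).
Hypothesis gcom : forall f, com f -> GRing.comm f g.

Let com_g : com g. Proof. exact/commr_sym/gcom/com_X. Qed.
Let com_gs : com (star g). Proof. exact: com_star. Qed.
Let g_gs : GRing.comm g (star g). Proof. exact/commr_sym/gcom. Qed.

Let com_g_star f : com f -> GRing.comm f (star g).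
Proof.
move=> /com_star/gcom h; rewrite /GRing.comm -(starK f) -!cmulE -!starM.
by rewrite !cmulE h.
Qed.

(** An approximate right inverse of [star g] on the ideal, so that [G n] below approximates g
    divided by [star g]. The m-th power of this quotient is [- X]. *)
Let h n := - (X * star g ^+ m.-1 * avg_quo n).

Let com_h f n : com f -> GRing.comm f (h n).
Proof.
move=> hf; apply/commrN/commrM; last exact: com_avg_quo.
by apply: commrM => //; apply: commrX; exact: com_g_star.
Qed.

Let com_hX n : com (h n). Proof. exact/commr_sym/com_h/com_X. Qed.

(* [1 - X = - X * star (1 - X)], that is, [g ^+ m = - X * star g ^+ m]. *)
Lemma gs_h n : star g * h n = 1 - avg n.
Proof.
rewrite one_sub_avg /h mulrN !mulrA.
have -> : star g * X = X * star g by exact: com_gs.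
rewrite -(mulrA X) -exprS prednK // -mult_starX gm.
have -> : star (1 - X) = 1 - star X by rewrite starB mult_star1.
by rewrite mulrBr mulr1 XXs -mulNr opprB.
Qed.

Let G n := g * h n.

Let com_G f n : com f -> GRing.comm f (G n).
Proof. by move=> hf; apply: commrM; [exact: gcom | exact: com_h]. Qed.

Let com_GX n : com (G n). Proof. exact/commr_sym/com_G/com_X. Qed.

Let nm_g y : nm (g * y) = nm (star g * y).
Proof. by rewrite nm_normal. Qed.

Let starG n : star (G n) = star g * star (h n).
Proof.
rewrite /G -cmulE starM cmulE; apply/esym.
by have := com_h n com_g => /(congr1 star); rewrite -!cmulE !starM !cmulE.
Qed.

Let starGG j n : star (G j) * G n = star (1 - avg j) * (1 - avg n).
Proof.
rewrite -!gs_h -[star g * h j]/(star g ** h j) starM starK cmulE.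
rewrite /G -[g * h j]/(g ** h j) starM cmulE -!mulrA; congr (_ * _).
by rewrite !mulrA g_gs.
Qed.

Let GstarG j n : G j * star (G n) = (1 - avg j) * star (1 - avg n).
Proof.
rewrite starG /G -!gs_h -[star g * h n]/(star g ** h n) starM starK cmulE.
have e : star (h n) * g = g * star (h n) by apply: gcom; exact: com_star.
rewrite e !mulrA; congr (_ * _).
rewrite (com_h j com_g) (com_h j com_gs) -!mulrA.
by rewrite g_gs.
Qed.

Let sub_1B (a b : mult D) : (1 - a) - (1 - b) = b - a.
Proof. by rewrite opprB addrC addrA subrK. Qed.

(** Normality of g allows replacing g by [star g] inside the norm, and [star g * h n] is
    [1 - avg n]; so the differences are those of [avg n * x]. *)
Let csqG x : fix_free x -> csq (fun n => G n * x).
Proof.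
move=> [x1 x2]; apply: (@csq_dominated _ _ _ (fun n => avg n * x) _ 1) => [n j|].
  rewrite mul1r -mulrBl /G -mulrBr -mulrA nm_g mulrA mulrBr !gs_h.
  by rewrite sub_1B mulrBl nmC.
exact: cvs_csq x2.
Qed.

Let csqGs x : fix_free x -> csq (fun n => star (G n) * x).
Proof.
move=> [x1 x2].
apply: (@csq_dominated _ _ _ (fun n => star (avg n) * x) _ 1) => [n j|].
  rewrite mul1r !starG -mulrBl -mulrBr -mulrA -nm_g mulrA.
  have e : g * (star (h n) - star (h j)) = star (star g ** (h n - h j)).
    rewrite starM starK -starB; apply/esym/gcom; apply: com_star.
    exact/commr_sym/commrB/commr_sym/com_hX/commr_sym/com_hX.
  rewrite e cmulE mulrBr !gs_h sub_1B starB mulrBl nmC; exact: lexx.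
exact: cvs_csq (cvs0_star_avg x2).
Qed.

Let lim_ex (u : nat -> mult D -> mult D) :
  (forall x, fix_free x -> csq (fun n => u n x)) ->
  exists F, forall x, fix_free x -> cvs (fun n => u n x) (F x).
Proof.
move=> uc; have /choice[F hF] : forall x, exists y, fix_free x -> cvs (fun n => u n x) y.
  move=> x; have [hx|hx] := pselect (fix_free x); last by exists 0.
  by have [y hy] := csq_cvs (uc x hx); exists y.
by exists F.
Qed.

Let nm_G n y : nm (G n * y) <= 2 * nm y.
Proof.
rewrite /G -mulrA nm_g mulrA gs_h; apply: le_trans (nm_mmul_le _ _) _.
rewrite ler_wpM2r ?nm_ge0 //; apply: le_trans (nmD _ _) _.
by rewrite nmN; have := nm_mult1 D; have := nm_avg n; lra.
Qed.

Let nm_Gs n y : nm (star (G n) * y) <= 2 * nm y.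
Proof.
by rewrite nm_normal; [exact: nm_G | apply/commr_sym/com_G/com_star/com_GX].
Qed.

Let lim_fix_free (u : nat -> mult D) (F : mult D -> mult D) :
  (forall n, com (u n)) -> (forall n y, nm (u n * y) <= 2 * nm y) ->
  (forall x, fix_free x -> cvs (fun n => u n * x) (F x)) ->
  forall x, fix_free x -> fix_free (F x).
Proof.
move=> cu ub uF x hx; have [x1 x2] := hx; split.
  apply: (@cvs_unique _ _ (fun n => (u n * x) ** X)).
    exact: cvs_mulr (uF x hx).
  apply: cvs_ev (cvs_mull X (uF x hx)); exists 0%N => n _.
  by rewrite !cmulE -mulrA x1 !mulrA (cu n).
apply: (@cvs0_dominated _ _ _ _ _ 2 _ x2) => k.
apply: (@cvs_le_cst _ _ (fun n => avg k ** (u n * x))) => [n|].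
  by rewrite cmulE mulrA -(com_avg k (cu n)) -mulrA; exact: ub.
exact: cvs_mull (uF x hx).
Qed.

Lemma ideal_root : exists V : mult J,
  [/\ star V * V = 1, V * star V = 1, V ^+ m = act_ideal (- X) &
    forall f, com f -> GRing.comm V (act_ideal f)].
Proof.
have [F hF] := lim_ex csqG; have [F' hF'] := lim_ex csqGs.
have FJ := lim_fix_free com_GX nm_G hF.
have F'J : forall x, fix_free x -> fix_free (F' x).
  apply: (lim_fix_free _ nm_Gs hF') => n; exact/com_star/com_GX.
have adj x y : fix_free x -> fix_free y -> star (F x) * y = star x * F' y.
  move=> hx hy; apply: (@cvs_unique _ _ (fun n => star (G n * x) ** y)).
    by apply: cvs_mulr; apply: cvs_star; exact: hF.
  apply: cvs_ev (cvs_mull (star x) (hF' y hy)).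
  by exists 0%N => n _; rewrite -!cmulE starM cmulA.
have bd x : fix_free x -> nm (F x) <= 2 * nm x.
  by move=> hx; apply: cvs_le_cst (hF x hx) => n; exact: nm_G.
have [V [VE VsE]] := multJ_ex FJ F'J adj bd.
have avg0 x : fix_free x -> cvs (fun n => (1 - avg n) * x) x.
  move=> [x1 x2]; have x3 : cvs (fun n => - (avg n * x)) 0.
    by apply: (@cvs0_dominated _ _ _ _ _ 1 _ x2) => n; rewrite nmN mul1r.
  have := cvsD (cvs_cst x) x3; rewrite addr0; apply: cvs_ev.
  by exists 0%N => n _; rewrite mulrBl mul1r.
have avg0s x : fix_free x -> cvs (fun n => star (1 - avg n) * x) x.
  move=> [x1 x2]; have x3 : cvs (fun n => - (star (avg n) * x)) 0.
    apply: (@cvs0_dominated _ _ _ _ _ 1 _ (cvs0_star_avg x2)) => n.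
    by rewrite nmN mul1r.
  have := cvsD (cvs_cst x) x3; rewrite addr0; apply: cvs_ev.
  by exists 0%N => n _; rewrite starB mult_star1 mulrBl mul1r.
have gF x : fix_free x -> star g * F x = g * x.
  move=> hx; apply: (@cvs_unique _ _ (fun n => star g ** (G n * x))).
    exact: cvs_mull (hF x hx).
  apply: cvs_ev (cvs_mull g (avg0 x hx)); exists 0%N => n _.
  by rewrite !cmulE !mulrA -gs_h !mulrA g_gs.
have FmJ k x : fix_free x -> fix_free (iter k F x).
  by move=> hx; elim: k => //= k IH; exact: FJ.
have gFm k x : fix_free x -> star g ^+ k * iter k F x = g ^+ k * x.
  move=> hx; elim: k => [|k IH]; first by rewrite !expr0.
  rewrite exprSr -mulrA gF; last exact: FmJ.
  by rewrite mulrA -(commrX k g_gs) -mulrA IH mulrA -exprS.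
(* y = F^m x + X x is killed by star g ^ m = 1 - star X, hence fixed by X; but y lies in the ideal,
   which has no nonzero fixed vector. *)
have Fm x : fix_free x -> iter m F x = - X * x.
  move=> hx; apply/eqP; rewrite mulNr -addr_eq0; apply/eqP.
  set y := _ + _; have yJ : fix_free y.
    by apply: fix_freeD; [exact: FmJ | apply: fix_freeMl => //; exact: com_X].
  have : (1 - star X) * y = 0.
    have e : star (g ^+ m) = 1 - star X by rewrite gm starB mult_star1.
    rewrite -e mult_starX /y mulrDr gFm // gm -mult_starX e mulrA.
    by rewrite (mulrBl X) mul1r XsX -mulrDl addrA subrK subrr mul0r.
  rewrite mulrBl mul1r => /eqP; rewrite subr_eq0 => /eqP e.
  have Xy : X * y = y by rewrite {1}e mulrA XXs mul1r.
  have [_ y2] := yJ; apply: (@cvs_unique _ _ (fun n => avg n * y)) => //.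
  by apply: cvs_ev (cvs_cst _); exists 0%N => n _; rewrite avg_fixed.
(* Iterated limit: for fixed j let n grow in [starGG] to replace [1 - avg n] by the identity, then
   let j grow. *)
have F'F x : fix_free x -> F' (F x) = x.
  move=> hx; apply: (@cvs_unique _ _ (fun n => star (G n) * F x)).
    by apply: hF'; exact: FJ.
  apply: cvs_ev (avg0s x hx); exists 0%N => j _.
  apply: (@cvs_unique _ _ (fun n => star (1 - avg j) ** ((1 - avg n) * x))).
    exact: cvs_mull (avg0 x hx).
  apply: cvs_ev (cvs_mull (star (G j)) (hF x hx)); exists 0%N => n _.
  by rewrite cmulA [_ ** G n]starGG -!cmulE -cmulA.
have FF' x : fix_free x -> F (F' x) = x.
  move=> hx; apply: (@cvs_unique _ _ (fun n => G n * F' x)).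
    by apply: hF; exact: F'J.
  apply: cvs_ev (avg0 x hx); exists 0%N => j _.
  apply: (@cvs_unique _ _ (fun n => (1 - avg j) ** (star (1 - avg n) * x))).
    exact: cvs_mull (avg0s x hx).
  apply: cvs_ev (cvs_mull (G j) (hF' x hx)); exists 0%N => n _.
  by rewrite cmulA [_ ** star (G n)]GstarG -!cmulE -cmulA.
have Fcom f x : com f -> fix_free x -> F (f * x) = f * F x.
  move=> hf hx; apply: (@cvs_unique _ _ (fun n => G n * (f * x))).
    by apply: hF; exact: fix_freeMl.
  apply: cvs_ev (cvs_mull f (hF x hx)); exists 0%N => n _.
  by rewrite cmulE (mulrA f) (com_G n hf) -mulrA.
exists V; split.
- apply: mult_ext => a; apply: csval_inj; rewrite mmulE VsE VE.
  exact: F'F (csvalP a).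
- apply: mult_ext => a; apply: csval_inj; rewrite mmulE VE VsE.
  exact: FF' (csvalP a).
- apply: act_ideal_ext => [|a].
    by apply/commr_sym/commrN; exact: commr_refl.
  have VX k : csval ((V ^+ k) a) = iter k F (csval a).
    by elim: k => //= k IH; rewrite exprS mmulE VE IH.
  by rewrite VX; exact: Fm (csvalP a).
- move=> f hf; apply: mult_ext => a; apply: csval_inj.
  rewrite !mmulE VE !act_idealE // VE.
  exact: Fcom hf (csvalP a).
Qed.

End Root.
End UnitaryRoot.

(** * Extension of unitary representations *)

Section IntegerPowers.
Variables (R : realType) (D : cstarAlgType R) (w : mult D).
Hypotheses (wsw : star w * w = 1) (wws : w * star w = 1).

Definition upow (n : int) : mult D :=
  match n with Posz n => w ^+ n | Negz n => star w ^+ n.+1 end.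

Lemma upow_sub (a b : nat) : upow (a%:Z - b%:Z) = w ^+ a * star w ^+ b.
Proof.
have wK n : w ^+ n * star w ^+ n = 1.
  by elim: n => [|n IH]; rewrite ?mulr1 // exprSr exprS mulrA -(mulrA _ w) wws mulr1.
case: (leqP b a) => ab.
  rewrite subzn // -{2}(subnK ab) exprD -mulrA wK mulr1 //.
have [c ->] : exists c, b = (a + c.+1)%N by exists (b - a).-1; lia.
have -> : a%:Z - (a + c.+1)%:Z = Negz c by lia.
by rewrite exprD mulrA wK mul1r.
Qed.

Lemma comm_w_star : GRing.comm w (star w).
Proof. by rewrite /GRing.comm wsw wws. Qed.

Lemma int_sub_nat (n : int) : exists a b : nat, n = a%:Z - b%:Z.
Proof.
by case: n => n; [exists n, 0%N | exists 0%N, n.+1]; rewrite ?subr0 // NegzE sub0r.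
Qed.

Lemma upowD n p : upow (n + p) = upow n * upow p.
Proof.
have [a [b ->]] := int_sub_nat n; have [c [d ->]] := int_sub_nat p.
have -> : a%:Z - b%:Z + (c%:Z - d%:Z) = (a + c)%:Z - (b + d)%:Z by lia.
rewrite !upow_sub !exprD -!mulrA; congr (_ * _); rewrite !mulrA; congr (_ * _).
exact: commrX (commr_sym (commrX _ (commr_sym comm_w_star))).
Qed.

Lemma upow_star n : star (upow n) = upow (- n).
Proof.
have [a [b ->]] := int_sub_nat n; rewrite opprB !upow_sub -cmulE starM.
by rewrite !mult_starX starK.
Qed.

Lemma comm_upow f n : GRing.comm f w -> GRing.comm f (star w) ->
  GRing.comm f (upow n).
Proof. by move=> h1 h2; case: n => n; exact: commrX. Qed.

End IntegerPowers.

Section Extension.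
Variable R : realType.

(** Relative to [K] because [act_ideal] is a homomorphism only on elements commuting with the given
    unitary. *)
Definition hom_on (D E : cstarAlgType R) (K : mult D -> Prop)
    (th : mult D -> mult E) :=
  [/\ forall (c : R[i]) f g, K f -> K g -> th (c *: f + g) = c *: th f + th g,
      forall f g, K f -> K g -> th (f * g) = th f * th g,
      forall f, K f -> th (star f) = star (th f)
    & th 1 = 1].

(* A unitary [U] acquires an [m]-th root after restriction to the ideal where
   [1 + U], or [1 - U], is injective.  As [2 = (1 + U) + (1 - U)], a given
   nonzero [f0] survives on one of the two. *)
Lemma mult_root (D : cstarAlgType R) (U f0 : mult D) m :
  star U * U = 1 -> U * star U = 1 -> (0 < m)%N ->
  GRing.comm f0 U -> f0 <> 0 ->
  exists (E : cstarAlgType R) (th : mult D -> mult E) (V : mult E),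
    [/\ hom_on (fun f => GRing.comm f U) th, star V * V = 1 /\ V * star V = 1,
      V ^+ m = th U, forall f, GRing.comm f U -> GRing.comm V (th f)
      & th f0 <> 0].
Proof.
move=> UsU UUs m0 f0U f0n.
have main (X : mult D) (XsX : star X * X = 1) (XXs : X * star X = 1) :
    GRing.comm f0 X -> f0 * (1 - X) <> 0 ->
    exists (E : cstarAlgType R) (th : mult D -> mult E) (V : mult E),
    [/\ hom_on (fun f => GRing.comm f X) th, star V * V = 1 /\ V * star V = 1,
      V ^+ m = th (- X), forall f, GRing.comm f X -> GRing.comm V (th f)
      & th f0 <> 0].
  move=> f0X f0n'; have [g [gm gcom]] := unit_sub_root (nm_unitary XsX) m0.
  have [V [V1 V2 V3 V4]] := ideal_root XsX XXs m0 gm gcom.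
  exists (csub (fix_free_ideal XsX XXs)), (@act_ideal _ _ _ XsX XXs), V.
  split=> // [|/act_ideal_eq0]; last by auto.
  split; [exact: act_ideal_lin|exact: act_idealM|exact: act_ideal_star|].
  exact: act_ideal1.
have [e|e] := pselect (f0 * (1 + U) = 0); last first.
  have comN f : GRing.comm f U <-> GRing.comm f (- U).
    by split=> h; [exact: commrN | rewrite -[U]opprK; exact: commrN].
  have N1 : star (- U) * (- U) = 1 by rewrite starN mulrNN.
  have N2 : - U * star (- U) = 1 by rewrite starN mulrNN.
  have c1 : GRing.comm f0 (- U) by apply/comN.
  have n1 : f0 * (1 - - U) <> 0 by rewrite opprK.
  have [E [th [V [[h1 h2 h3 h4] h5 h6 h7 h8]]]] := main _ N1 N2 c1 n1.
  exists E, th, V; split=> //; last 2 first.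
  - by rewrite h6 opprK.
  - by move=> f /comN; exact: h7.
  split=> //.
  - by move=> c f g /comN ? /comN ?; exact: h1.
  - by move=> f g /comN ? /comN ?; exact: h2.
  - by move=> f /comN ?; exact: h3.
have e' : f0 * (1 - U) <> 0.
  move=> h; apply: f0n; have : f0 * (1 + U) + f0 * (1 - U) = 0.
    by rewrite e h addr0.
  rewrite -mulrDr addrACA subrr addr0 mulrDr mulr1 -mulr2n.
  rewrite -(@scaler_nat R[i]) => /eqP; rewrite scaler_eq0 pnatr_eq0 /=.
  by move=> /eqP.
have [E [th [V [[h1 h2 h3 h4] [h5 h5'] h6 h7 h8]]]] := main U UsU UUs f0U e'.
(* [main] for X = U yields a root of - U; the scalar z, of modulus 1, corrects the sign. *)
pose z : R[i] := m.-root (-1).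
have zm : z ^+ m = -1 by exact: rootCK.
have z1 : z^* * z = 1.
  rewrite mulrC -normCK; have : `|z| ^+ m = 1 by rewrite -normrX zm normrN1.
  by move=> /eqP; rewrite pexpr_eq1 // => /eqP ->; rewrite expr1n.
have th0 : th 0 = 0.
  have c1 : GRing.comm 0 U by exact/commr_sym/commr0.
  by have := h1 (-1) 0 0 c1 c1; rewrite scaler0 addr0 scaleN1r addNr.
have thN : th (- U) = - th U.
  have c1 : GRing.comm 0 U by exact/commr_sym/commr0.
  have := h1 (-1) U 0 (commr_refl _) c1.
  by rewrite !addr0 th0 addr0 !scaleN1r.
have zVX n : (z *: V) ^+ n = z ^+ n *: V ^+ n.
  elim: n => [|n IH]; first by rewrite !expr0 scale1r.
  by rewrite !exprS IH -!cmulE cmulZl cmulZr scalerA.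
exists E, th, (z *: V); split=> //.
- by rewrite starZ -!cmulE !cmulZl !cmulZr !scalerA !cmulE h5 h5' z1 mulrC z1 scale1r.
- by rewrite zVX zm h6 thN scaleN1r opprK.
- by move=> f /h7 h; exact/commr_sym/comm_scale/commr_sym.
Qed.

Section Steps.
Variables (V : zmodType) (A : cstarAlgType R) (a0 : A).
Variable Rel : V -> A -> A -> Prop.

(** The invariant of the extension process. [D] and [pi] may change at each step, [a0] must stay
    visible, [Rel] lists relations that [v] has to keep, and [v] is a unitary representation only on
    [L]. *)
Definition has_rep (L : V -> Prop) :=
  exists (D : cstarAlgType R) (pi : A -> mult D) (v : V -> mult D),
  [/\ star_hom pi /\ pi a0 <> 0,
      v 0 = 1 /\ (forall x, L x -> star (v x) = v (- x)),
      forall x y, L x -> L y -> v (x + y) = v x * v y,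
      forall x a, L x -> GRing.comm (v x) (pi a)
    & forall x a b, Rel x a b -> v x * pi a = pi b].

Definition subgroup_pred (L : V -> Prop) :=
  L 0 /\ forall x y, L x -> L y -> L (x - y).

Definition adjoin (L : V -> Prop) (e x : V) :=
  exists y (n : int), L y /\ x = y + e *~ n.

Lemma subgroup_predN L x : subgroup_pred L -> L x -> L (- x).
Proof. by move=> [h0 hB] Lx; rewrite -sub0r; apply: hB. Qed.

Lemma subgroup_predD L x y : subgroup_pred L -> L x -> L y -> L (x + y).
Proof.
by move=> hL Lx Ly; rewrite -[y]opprK; apply: hL.2 => //; exact: subgroup_predN.
Qed.

Lemma subgroup_predZ L x n : subgroup_pred L -> L x -> L (x *~ n).
Proof.
move=> hL Lx; have hn (j : nat) : L (x *+ j).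
  elim: j => [|j IH]; first by rewrite mulr0n; exact: hL.1.
  by rewrite mulrS; exact: subgroup_predD.
by case: n => n; rewrite ?NegzE ?mulrNz -pmulrn //; exact: subgroup_predN.
Qed.

Lemma adjoin_subgroup L e : subgroup_pred L -> subgroup_pred (adjoin L e).
Proof.
move=> hL; split; first by exists 0, 0; rewrite mulr0z addr0; split=> //; case: hL.
move=> _ _ [x [n [Lx ->]]] [y [p [Ly ->]]]; exists (x - y), (n - p).
by split; [exact: hL.2 | rewrite mulrzBr opprD addrACA].
Qed.

Lemma adjoin_sub L e x : L x -> adjoin L e x.
Proof. by move=> Lx; exists x, 0; rewrite mulr0z addr0. Qed.

(** The extension sends y + n e to v_y w^n. Two such decompositions differ by a multiple of e in
    [L], where v and the powers of w agree by hypothesis. *)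
Lemma has_rep_adjoin_of L e : subgroup_pred L ->
  (forall x a b, Rel x a b -> L x) ->
  (exists (D : cstarAlgType R) (pi : A -> mult D) (v : V -> mult D) (w : mult D),
  [/\ star_hom pi /\ pi a0 <> 0,
      v 0 = 1 /\ (forall x, L x -> star (v x) = v (- x)),
      forall x y, L x -> L y -> v (x + y) = v x * v y,
      forall x a, L x -> GRing.comm (v x) (pi a)
    & forall x a b, Rel x a b -> v x * pi a = pi b] /\
  [/\ star w * w = 1, w * star w = 1, forall a, GRing.comm w (pi a),
      forall x, L x -> GRing.comm w (v x)
    & forall n : int, L (e *~ n) -> v (e *~ n) = upow w n]) ->
  has_rep (adjoin L e).
Proof.
move=> hL RL [D [pi [v [w [[[pih pia] [v0 vs] vD vpi vR] [w1 w2 wpi wv we]]]]]].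
have wsc f : GRing.comm w f -> GRing.comm f (star w).
  move=> h; rewrite /GRing.comm -[f * _]mul1r -w1 -!mulrA (mulrA w) h.
  by rewrite -!mulrA w2 mulr1.
have wf y n y' n' : L y -> L y' -> y + e *~ n = y' + e *~ n' ->
    v y * upow w n = v y' * upow w n'.
  move=> Ly Ly' h.
  have yE : y = y' + e *~ (n' - n).
    by rewrite mulrzBr addrA -h addrK.
  have Le : L (e *~ (n' - n)).
    have -> : e *~ (n' - n) = y - y' by rewrite yE [y' + _]addrC addrK.
    exact: hL.2.
  by rewrite yE vD // we // -mulrA -upowD // subrK.
have /choice[v' hv'] x : exists T, forall y n, L y -> x = y + e *~ n ->
    T = v y * upow w n.
  have [[y [n [Ly xE]]]|h] := pselect (adjoin L e x).
    exists (v y * upow w n) => y' n' Ly' xE'.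
    by apply: wf => //; rewrite -xE.
  by exists 0 => y n Ly xE; case: h; exists y, n.
have v'E y n : L y -> v' (y + e *~ n) = v y * upow w n by move=> Ly; exact: hv'.
have v'L y : L y -> v' y = v y.
  by move=> Ly; rewrite -[y]addr0 -(mulr0z e) v'E // mulr1 addr0.
exists D, pi, v'; split=> //.
- split; first by rewrite v'L //; case: hL.
  move=> _ [y [n [Ly ->]]]; rewrite opprD -mulrNz !v'E //; last exact: subgroup_predN.
  rewrite -cmulE starM vs // upow_star // cmulE.
  apply/esym/comm_upow; last by apply: wsc; apply: wv; exact: subgroup_predN.
  by apply/commr_sym/wv; exact: subgroup_predN.
- move=> _ _ [y [n [Ly ->]]] [y' [n' [Ly' ->]]].
  rewrite addrACA -mulrzDr !v'E //; last exact: subgroup_predD.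
  rewrite vD // upowD // -!mulrA; congr (_ * _); rewrite !mulrA; congr (_ * _).
  by apply: comm_upow; [exact/commr_sym/wv | exact/wsc/wv].
- move=> _ a [y [n [Ly ->]]]; rewrite v'E //.
  apply/commr_sym/commrM; first exact/commr_sym/vpi.
  by apply: comm_upow; [exact/commr_sym/wpi | exact/wsc/wpi].
- by move=> x a b h; rewrite v'L ?(vR _ _ _ h) //; exact: RL h.
Qed.

(** If a positive multiple of e lies in [L], take the least one, m e, and let w be an m-th root of
    its unitary. This unitary commutes with [pi] and with v on [L], so passing to the new algebra
    preserves all relations. *)
Lemma has_rep_adjoin L e : subgroup_pred L ->
  (forall x a b, Rel x a b -> L x) ->
  has_rep L -> has_rep (adjoin L e).
Proof.
move=> hL RL [D [pi [v [[pih pia] [v0 vs] vD vpi vR]]]].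
apply: has_rep_adjoin_of => //.
have [hm|hm] := pselect (exists m, (0 < m)%N && `[< L (e *+ m) >]); last first.
  (* No positive multiple of e lies in [L], so the compatibility condition concerns n = 0 only and w
     = 1 will do. *)
  exists D, pi, v, 1; split=> //; rewrite mult_star1.
  split=> [|||x Lx|n Ln]; rewrite ?mulr1 //.
  - by move=> a; exact/commr_sym/commr1.
  - exact/commr_sym/commr1.
  have -> : n = 0.
    case: n Ln => [[//|n]|n] Ln; case: hm; exists n.+1; apply/andP; split=> //.
      exact/asboolP.
    apply/asboolP; rewrite -[_ *+ _]opprK; exact: subgroup_predN hL Ln.
  by rewrite mulr0z v0; exact/esym/expr0.
case: (ex_minnP hm) => m /andP[m0 /asboolP Lm] mmin.
pose U := v (e *+ m).
have vV x : L x -> v x * v (- x) = 1 /\ v (- x) * v x = 1.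
  move=> Lx; have LNx := subgroup_predN hL Lx.
  by rewrite -!vD // subrr addNr.
have U1 : star U * U = 1 by rewrite vs //; case: (vV _ Lm).
have U2 : U * star U = 1 by rewrite vs //; case: (vV _ Lm).
have piU a : GRing.comm (pi a) U by exact/commr_sym/vpi.
have vU x : L x -> GRing.comm (v x) U.
  by move=> Lx; rewrite /GRing.comm -!vD // addrC.
have [E [th [w [[h1 h2 h3 h4] [w1 w2] wm wth th0]]]] :=
  mult_root U1 U2 m0 (piU a0) pia.
exists E, (th \o pi), (th \o v), w; split.
- split.
  + split=> //; case: pih => l1 l2 l3; split=> [c a b|a b|a] /=.
    * by rewrite l1 h1.
    * by rewrite l2 h2.
    * by rewrite l3 h3.
  + split=> [|x Lx] /=; first by rewrite v0 h4.
    by rewrite -vs // h3 //; exact: vU.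
  + by move=> x y Lx Ly /=; rewrite vD // h2 //; exact: vU.
  + move=> x a Lx /=; have vx := vU x Lx.
    by rewrite /GRing.comm -!h2 // vpi.
  + by move=> x a b h /=; rewrite -h2 ?(vR _ _ _ h) //; apply: vU; exact: RL h.
- split=> //.
  + by move=> a; exact: wth.
  + by move=> x Lx; apply: wth; exact: vU.
  move=> n Ln.
  (* The remainder of n modulo m also gives a multiple of e in [L], so it is 0 by minimality of
     m. *)
  have [q nE] : exists q : int, n = m%:Z * q.
    exists (n %/ m%:Z)%Z; rewrite {1}(divz_eq n m%:Z).
    suff -> : (n %% m%:Z)%Z = 0 by rewrite addr0 mulrC.
    have mp : 0 < m%:Z by rewrite ltz_nat.
    have r0 := modz_ge0 n (lt0r_neq0 mp); have rm := ltz_pmod n mp.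
    have Lr : L (e *~ (n %% m%:Z)%Z).
      rewrite (_ : (n %% m%:Z)%Z = n - m%:Z * (n %/ m%:Z)%Z); last first.
        by rewrite {2}(divz_eq n m%:Z) mulrC addrAC subrr add0r.
      rewrite mulrzBr; apply: hL.2 => //; rewrite mulrzA.
      by apply: subgroup_predZ => //; rewrite -pmulrn.
    case: (n %% m%:Z)%Z r0 rm Lr => [[//|j]|//] _ jm Lj.
    have := mmin j.+1; rewrite /= (asboolT Lj) => /(_ isT) mj.
    by move: jm mj; rewrite ltz_nat ltnNge => /negbTE ->.
  have vq (j : nat) : th (v (e *+ m *+ j)) = w ^+ (m * j).
    elim: j => [|j IH]; first by rewrite mulr0n v0 h4 muln0.
    have Lj : L (e *+ m *+ j) by exact: (@subgroup_predZ L (e *+ m) j).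
    rewrite mulrS vD // h2 //; last exact: vU.
    by rewrite IH -wm mulnS exprD.
  rewrite nE mulrzA -pmulrn /=.
  case: q {nE} => q.
    by rewrite -pmulrn vq.
  have Lq : L (e *+ m *+ q.+1) by exact: (@subgroup_predZ L (e *+ m) q.+1).
  rewrite NegzE mulrNz -pmulrn -vs // h3 ?vq; last exact: vU.
  by rewrite mulrN -[(m%:Z * _)%R]/((m * q.+1)%N%:Z) -upow_star.
Qed.

Lemma has_rep_adjoin_seq L (es : seq V) : subgroup_pred L ->
  (forall x a b, Rel x a b -> L x) -> has_rep L ->
  (forall x, exists y (n : V -> int), L y /\ x = y + \sum_(e <- es) e *~ n e) ->
  has_rep (fun=> True).
Proof.
elim: es L => [|e es IH] L hL RL hr full.
  suff -> : (fun=> True) = L by [].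
  apply/funext => x; apply/propext; split=> // _.
  by have [y [n [Ly ->]]] := full x; rewrite big_nil addr0.
apply: (IH (adjoin L e)).
- exact: adjoin_subgroup.
- by move=> x a b /RL; exact: adjoin_sub.
- exact: has_rep_adjoin.
move=> x; have [y [n [Ly ->]]] := full x.
exists (y + e *~ n e), n; split; first by exists y, (n e).
by rewrite big_cons addrA.
Qed.

End Steps.
End Extension.

(** * The homomorphism into H and the embedding *)

Section LatticeRetract.

Lemma rat_mx_denominator m n (A : 'M[rat]_(m, n)) :
  exists (N : nat) (B : 'M[int]_(m, n)), (0 < N)%N /\
    map_mx intr B = N%:R *: A.
Proof.
pose d (ij : 'I_m * 'I_n) := `|denq (A ij.1 ij.2)|%N.
pose rest i j := (\prod_(ij | ij != (i, j)) d ij)%N.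
exists (\prod_ij d ij)%N, (\matrix_(i, j) (numq (A i j) * (rest i j)%:Z)).
split; first by apply: prodn_gt0 => ij; rewrite absz_gt0 denq_neq0.
apply/matrixP => i j; rewrite !mxE (bigD1 (i, j)) //= -/(rest i j).
rewrite rmorphM /= numqE natrM mulrAC -mulrA mulrC.
have -> : (denq (A i j))%:~R = (d (i, j))%:R :> rat.
  by rewrite [RHS]pmulrn absz_denq.
by rewrite -pmulrn (mulrC (rest i j)%:R).
Qed.

Variables (k : nat) (H : zmodClosed 'rV[int]_k).

Let toQ n (M : 'M[int]_(n, k)) : 'M[rat]_(n, k) := map_mx intr M.

(** No finite generation of H is presupposed. Among finite families in H, one of maximal rational
    rank spans H over the rationals, since adjoining a further element cannot raise the rank. *)
Lemma subgroup_maximal_rank : exists n (M : 'M[int]_(n, k)),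
  (forall i, row i M \in H) /\ forall x, x \in H -> (toQ x <= toQ M)%MS.
Proof.
pose P r := `[< exists n (M : 'M[int]_(n, k)),
  (forall i, row i M \in H) /\ \rank (toQ M) = r >].
have exP : exists r, P r.
  exists (\rank (toQ (0 : 'M[int]_(0, k)))); apply/asboolP.
  by exists 0%N, 0; split=> // -[].
have bP r : P r -> (r <= k)%N.
  by move=> /asboolP[n [M [_ <-]]]; exact: rank_leq_col.
case: (ex_maxnP exP bP) => r /asboolP[n [M [MH Mr]]] rmax.
exists n, M; split=> // x xH.
have rle : (\rank (toQ (col_mx M x)) <= r)%N.
  apply: rmax; apply/asboolP; exists (n + 1)%N, (col_mx M x); split=> // i.
  case: (split_ordP i) => j ->.
    by rewrite rowKu.
  by rewrite rowKd (_ : row j x = x) //; apply/rowP => l; rewrite !mxE ord1.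
have e : toQ (col_mx M x) = col_mx (toQ M) (toQ x) by exact: map_col_mx.
have sub : (toQ M <= toQ M + toQ x)%MS by exact: addsmxSl.
have := mxrank_leqif_sup sub; rewrite addsmxE -e => -[].
rewrite Mr => h1 h2; have : (r == \rank (toQ (col_mx M x)))%N by rewrite eqn_leq h1.
rewrite h2 addsmxE -e => h.
by apply: submx_trans h; rewrite e -addsmxE addsmxSr.
Qed.

(* [K] is a rational projection onto the span of [H], with its denominators
   cleared. *)
Lemma subgroup_retract : exists (N : nat) (K : 'M[int]_k),
  [/\ (0 < N)%N, forall p : 'rV_k, p *m K \in H
    & forall x, x \in H -> x *m K = x *+ N].
Proof.
have [n [M [MH Msup]]] := subgroup_maximal_rank.
have [N [B [N0 BE]]] := rat_mx_denominator (pinvmx (toQ M)).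
(* [pinvmx (toQ M) *m toQ M] fixes the row space of [toQ M], and [B] is N times the pseudo-inverse.
   Every p B M is an integer combination of rows of M, hence lies in H. *)
exists N, (B *m M); split=> // [p|x xH].
  rewrite mulmxA mulmx_sum_row; apply: rpred_sum => i _.
  rewrite -[_ 0 i]intz scaler_int; exact: rpredMz.
have inj : injective (@toQ 1).
  move=> y z e; apply/matrixP => i j; move/matrixP: e => /(_ i j).
  by rewrite !mxE => /intr_inj.
apply: inj; rewrite /toQ !map_mxM BE -scalemxAl -scalemxAr.
rewrite mulmxA mulmxKpV; last exact: Msup.
rewrite scaler_nat; apply/matrixP => i j.
by rewrite mulmxnE !mxE mulmxnE rmorphMn.
Qed.

End LatticeRetract.

Section StarHomImage.
Variables (R : realType) (P : nmodType) (G : pgraph P).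
Variables (A E : cstarAlgType R) (s : G -> A) (f : A -> E).

Lemma ck_star_hom : star_hom f -> cuntz_krieger s -> cuntz_krieger (f \o s).
Proof.
move=> hf ck; have [fl fM fS] := hf; case: (ck) => [[c1 c1'] c2 c3 c4]; split.
- split=> [v hv|v w hv hw vw] /=.
    by have [e1 e2] := c1 v hv; rewrite -fS -fM e1 e2.
  by rewrite -fM c1' // star_hom0.
- by move=> x y e /=; rewrite -fM c2.
- by move=> x /=; rewrite -fS -fM c3.
- move=> v p hv; rewrite path_sumE //= (ck_sum ck p hv) star_hom_sum //.
  by apply: eq_bigr => x _; rewrite fM fS.
Qed.

End StarHomImage.

Section Lattice.
Variables (k : nat) (H : zmodClosed 'rV[int]_k).

Definition toZ (p : 'rV[nat]_k) : 'rV[int]_k := map_mx Posz p.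

Definition pos_part (x : 'rV[int]_k) : 'rV[nat]_k :=
  map_mx (fun z : int => if 0 <= z then `|z|%N else 0%N) x.

Lemma toZD p b : toZ (p + b) = toZ p + toZ b.
Proof. by apply/matrixP => i j; rewrite !mxE. Qed.

Lemma toZ0 : toZ 0 = 0.
Proof. by apply/matrixP => i j; rewrite !mxE. Qed.

Lemma toZ_inj : injective toZ.
Proof.
by move=> p b e; apply/matrixP => i j; move/matrixP: e => /(_ i j); rewrite !mxE => -[].
Qed.

Lemma pos_partB x : toZ (pos_part x) - toZ (pos_part (- x)) = x.
Proof.
apply/matrixP => i j; rewrite !mxE; case: (x i j) => [[|n]|n] //=.
  by rewrite subr0.
by rewrite NegzE -[LHS]/(0 - n.+1%:Z) sub0r.
Qed.

Lemma pos_partE x : toZ (pos_part x) = x + toZ (pos_part (- x)).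
Proof. by rewrite -{2}(pos_partB x) subrK. Qed.

Lemma q_Nk_eq (p b : 'rV[nat]_k) :
  q_Nk H p = q_Nk H b <-> toZ p - toZ b \in H.
Proof.
rewrite (Quotient.idealrBE H); split=> [/(congr1 val) /= e|/eqP e].
  exact/eqP.
exact: val_inj.
Qed.

Lemma q_Nk_surj (c : qNk H) : exists p, c = q_Nk H p.
Proof.
case: c => c hc; have /asboolP[p cE] := hc; exists p; exact: val_inj.
Qed.

Lemma q_Nk_pos_part x : x \in H -> q_Nk H (pos_part x) = q_Nk H (pos_part (- x)).
Proof. by move=> xH; apply/q_Nk_eq; rewrite pos_partB. Qed.

End Lattice.

(** * Representations of Z^k that extend the shifts *)

Section InitialRep.
Variables (R : realType) (k : nat) (H : zmodClosed 'rV[int]_k).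
Variables (G : pgraph (qNk H)) (A : cstarAlgType R).
Variable s : pullback (q_Nk H) G -> A.
Hypothesis s_univ : graph_cstar s.
Variables (N : nat) (N0 : (0 < N)%N).

Local Notation sp := (spath s).

Definition scaled_subgroup (x : 'rV[int]_k) := exists2 y, y \in H & x = y *+ N.

(** The relation v_(N x) = U_x, read on generators: for x = p - c in H, v_(N x) carries s_(l, c) to
    s_(l, p). *)
Definition shift_rel (x : 'rV[int]_k) (a b : A) := exists l p c,
  [/\ toZ p - toZ c \in H, x = (toZ p - toZ c) *+ N, a = sp l c & b = sp l p].

Lemma scaled_subgroup_pred : subgroup_pred scaled_subgroup.
Proof.
split; first by exists 0; rewrite ?rpred0 ?mul0rn.
move=> _ _ [x xH ->] [y yH ->]; exists (x - y); first by rewrite rpredB.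
by rewrite mulrnBl.
Qed.

Lemma row_mulrn_inj (x y : 'rV[int]_k) : x *+ N = y *+ N -> x = y.
Proof.
move=> e; apply/matrixP => i j; move/matrixP: e => /(_ i j).
have Nn : N%:R != 0 :> int by rewrite pnatr_eq0 -lt0n.
by rewrite !mulmxnE -(mulr_natr (x i j)) -(mulr_natr (y i j)) => /(mulIf Nn).
Qed.

(** [A] acts on itself, which is faithful, and v_(N y) is the shift by y. It is well defined because
    Z^k has no torsion; [pos_part] writes y as a difference of elements of N^k. *)
Lemma initial_rep (a0 : A) : a0 <> 0 -> has_rep a0 shift_rel scaled_subgroup.
Proof.
move=> a0n; pose sh x := pshift s (pos_part x) (pos_part (- x)).
have /choice[v hv] x : exists T : mult A,
    forall y, y \in H -> x = y *+ N -> T = sh y.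
  have [[y yH ->]|h] := pselect (scaled_subgroup x).
    by exists (sh y) => z zH /row_mulrn_inj ->.
  by exists 0 => y yH xE; case: h; exists y.
have vE y : y \in H -> v (y *+ N) = sh y by move=> yH; exact: hv.
exists A, (@lmult R A), v; split.
- split; first exact: lmult_hom.
  move=> h; apply: a0n; apply: (@lmult_inj R A).
  by rewrite h (star_hom0 (lmult_hom A)).
- split.
    by rewrite -(mul0rn _ N) vE ?rpred0 // /sh oppr0 shift_id.
  move=> _ [y yH ->]; rewrite -mulNrn !vE ?rpredN // /sh opprK.
  by rewrite shift_star //; exact: q_Nk_pos_part.
- move=> _ _ [x xH ->] [y yH ->]; rewrite -mulrnDl !vE ?rpredD // /sh.
  have qx := q_Nk_pos_part xH; have qy := q_Nk_pos_part yH.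
  have qxy := q_Nk_pos_part (rpredD xH yH).
  apply/esym/(shiftM_eq s_univ qx qy qxy).
  apply: toZ_inj; rewrite !toZD (pos_partE x) (pos_partE y) (pos_partE (x + y)).
  by rewrite (AC (2*2*1) ((1*3*5)*(2*4))).
- move=> _ a [x xH ->]; rewrite vE // /GRing.comm /sh shift_lmult //.
  exact: q_Nk_pos_part.
- move=> _ _ _ [l [p [c [pcH -> -> ->]]]]; rewrite vE //.
  set x := toZ p - toZ c in pcH *.
  have e : sh x (sp l c) = sp l p.
    rewrite /sh; apply: (shift_spath s_univ l (q_Nk_pos_part pcH)).
      exact/q_Nk_eq.
    apply: toZ_inj; rewrite !toZD (pos_partE x) addrA [toZ c + x]addrC.
    by rewrite subrK.
  apply: mult_ext => y.
  exact: (etrans (mactM (sh x) (sp l c) y) (congr1 (fun z => z ** y) e)).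
Qed.

Lemma row_delta_sum (x : 'rV[int]_k) :
  x = \sum_(e <- [seq delta_mx 0 i | i <- index_enum 'I_k]) e *~ (x *m e^T) 0 0.
Proof.
rewrite big_map {1}(row_sum_delta x); apply: eq_bigr => i _.
rewrite -scaler_int intz; congr (_ *: _).
rewrite mxE (bigD1 i) //= big1 => [|j ji]; rewrite !mxE ?eqxx ?mulr1 ?addr0 //.
by rewrite (negbTE ji) mulr0.
Qed.

Lemma full_rep (a0 : A) : a0 <> 0 -> has_rep a0 shift_rel (fun=> True).
Proof.
move=> a0n; apply: (@has_rep_adjoin_seq _ _ _ _ _ _
  [seq delta_mx 0 i | i <- index_enum 'I_k] _ _ (initial_rep a0n)).
- exact: scaled_subgroup_pred.
- by move=> x a b [l [p [c [pcH -> _ _]]]]; exists (toZ p - toZ c).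
- move=> x; exists 0, (fun e => (x *m e^T) 0 0); split.
    by case: scaled_subgroup_pred.
  by rewrite add0r; exact: row_delta_sum.
Qed.

End InitialRep.

(** * Twisting by [K] and untwisting *)

Section Embedding.
Variables (R : realType) (k : nat) (H : zmodClosed 'rV[int]_k).
Variables (G : pgraph (qNk H)) (A B C T : cstarAlgType R).
Variables (s : pullback (q_Nk H) G -> A) (t : G -> B) (u : subgroup H -> C).
Variable tens : B -> C -> T.
Hypotheses (s_univ : graph_cstar s) (t_univ : graph_cstar t).
Hypotheses (u_univ : group_cstar u) (tens_univ : cstar_tensor tens).
Variables (N : nat) (K : 'M[int]_k).
Hypotheses (N0 : (0 < N)%N) (KH : forall p : 'rV_k, p *m K \in H).
Hypothesis KN : forall x, x \in H -> x *m K = x *+ N.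

Let ck : cuntz_krieger s. Proof. by case: s_univ. Qed.
Let ckt : cuntz_krieger t. Proof. by case: t_univ. Qed.

Definition retract (p : 'rV[nat]_k) : subgroup H := Subgroup (KH (toZ p)).

Lemma retract0 : retract 0 = 0.
Proof. by apply: val_inj; rewrite /= toZ0 mul0mx. Qed.

Lemma retractD p b : retract (p + b) = retract p + retract b.
Proof. by apply: val_inj; rewrite /= toZD mulmxDl. Qed.

Definition twisted (x : pullback (q_Nk H) G) : T :=
  tens (t (val x).1) (u (retract (val x).2)).

Lemma twisted_ck : cuntz_krieger twisted.
Proof.
have [[tl tr tM tS] _] := tens_univ; have [[u1 u2 u3] _] := u_univ.
have u0s : star (u 0) = u 0.
  by have [e _] := u3 0; have [_ e2] := u1 (star (u 0)); rewrite -{2}e e2.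
have u00 : u 0 ** u 0 = u 0 by have [e _] := u1 (u 0).
have tens0 c : tens 0 c = 0.
  by have := tr c (-1) 0 0; rewrite scaler0 addr0 scaleN1r addNr.
have tensD c : {morph tens^~ c : a b / a + b}.
  by move=> a b; have := tr c 1 a b; rewrite !scale1r.
have vtx (x : pullback (q_Nk H) G) : vertices x -> vertices (val x).1 /\ (val x).2 = 0.
  by move=> hx; split=> //; exact: (@pullback_deg0 _ _ _ _ x).
split.
- split=> [x /vtx[hx x2]|x y /vtx[hx x2] /vtx[hy y2] xy]; rewrite /twisted.
    rewrite -tS -tM x2 retract0 u0s u00.
    by rewrite (ck_star_vertex ckt hx) (ck_vertexM ckt hx).
  rewrite -tM; case: ckt => [[_ c1] _ _ _]; rewrite c1 ?tens0 // => e.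
  apply: xy; apply: val_inj.
  by rewrite [LHS]surjective_pairing [RHS]surjective_pairing e x2 y2.
- move=> x y /pullback_composable e; rewrite /twisted -tM -u2 -retractD.
  case: ckt => _ c2 _ _; rewrite c2 //.
  by rewrite -[compose x y]/(pullback_comp x y) val_pullback_comp.
- move=> x; rewrite /twisted -tS -tM (ck_starM ckt).
  by have [-> _] := u3 (retract (val x).2); rewrite /= retract0.
- move=> x p hx; have [hv x2] := vtx x hx.
  pose F (y : G * 'rV[nat]_k) := tens (t y.1) (u (retract y.2)).
  rewrite path_sumE // (pullback_sum p (fun y => F y ** star (F y)) hx).
  rewrite /twisted x2 retract0 (ck_sum ckt (q_Nk H p) hv).
  rewrite (big_morph _ (tensD (u 0)) (tens0 (u 0))).
  apply: eq_bigr => l _; rewrite /F /= -tS -tM.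
  by have [_ ->] := u3 (retract p).
Qed.

Section LeftInverse.
Variables (D : cstarAlgType R) (pi : A -> mult D) (v : 'rV[int]_k -> mult D).
Hypotheses (pi_hom : star_hom pi) (v0 : v 0 = 1).
Hypotheses (v_star : forall x, star (v x) = v (- x)).
Hypotheses (vD : forall x y, v (x + y) = v x * v y).
Hypothesis v_pi : forall x a, GRing.comm (v x) (pi a).
Hypothesis v_rel : forall x a b, shift_rel s N x a b -> v x * pi a = pi b.

Local Notation sp := (spath s).

Let vV x : v x * v (- x) = 1.
Proof. by rewrite -vD subrr v0. Qed.

Let vVl x : v (- x) * v x = 1.
Proof. by rewrite -vD addNr v0. Qed.

(** Two lifts p, c of the degree of l differ by an element of H, on which [K] is multiplication by
    N; so v_(N (p - c)) accounts both for the change of v_(- p K) and for that of s_(l, p). *)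
Lemma untwisted_ex : exists g : G -> mult D, forall l p, deg l = q_Nk H p ->
  g l = v (- (toZ p *m K)) * pi (sp l p).
Proof.
suff /choice[g hg] : forall l : G, exists y : mult D, forall p,
    deg l = q_Nk H p -> y = v (- (toZ p *m K)) * pi (sp l p) by exists g.
move=> l; have [c lc] := q_Nk_surj (deg l).
exists (v (- (toZ c *m K)) * pi (sp l c)) => p lp.
have pcH : toZ p - toZ c \in H by apply/q_Nk_eq; rewrite -lp.
have e : v ((toZ p - toZ c) *+ N) * pi (sp l c) = pi (sp l p).
  by apply: v_rel; exists l, p, c.
have e' : v (- (toZ c *m K)) = v (- (toZ p *m K)) * v ((toZ p - toZ c) *+ N).
  by rewrite -vD -(KN pcH) mulmxBl addrA addNr add0r.
apply: etrans (congr1 (GRing.mul (v (- (toZ p *m K)))) e).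
by rewrite mulrA -e'.
Qed.

(** [Psi] sends the image of (l, p) to g_l v_(p K), where the factor v_(- p K) built into g_l
    cancels. *)
Lemma untwist : exists Psi : T -> mult D,
  star_hom Psi /\ forall x, Psi (twisted x) = pi (s x).
Proof.
have [g gE] := untwisted_ex; have [_ piM piS] := pi_hom.
have v_pi' x a : pi a * v x = v x * pi a by exact/esym/v_pi.
have q0 : q_Nk H 0 = 0 by exact: raddf0.
have g0 l : vertices l -> g l = pi (sp l 0).
  move=> hl; rewrite (gE l 0) ?toZ0 ?mul0mx ?oppr0 ?v0 ?mul1r //.
  by rewrite q0.
have ckg : cuntz_krieger g.
  split.
  - split=> [l hl|l m hl hm lm].
      rewrite g0 // -piS -piM (spath_star_vertex s_univ hl).
      by rewrite (spath_vertexM s_univ hl).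
    rewrite !g0 // -piM -(spath_star_vertex s_univ hl).
    by rewrite (spath_orth s_univ) // (star_hom0 pi_hom).
  - move=> l m lm; have [p lp] := q_Nk_surj (deg l).
    have [b mb] := q_Nk_surj (deg m).
    rewrite (gE l p lp) (gE m b mb) (gE _ (p + b)); last first.
      by rewrite deg_comp // lp mb raddfD.
    rewrite -(spathM s_univ lp mb lm) piM !cmulE toZD mulmxDl opprD vD.
    by rewrite -!mulrA; congr (_ * _); rewrite !mulrA v_pi'.
  - move=> l; have [p lp] := q_Nk_surj (deg l).
    rewrite (gE l p lp) g0; last exact: vertices_src.
    rewrite -(spath_starM s_univ lp) piM piS -cmulE starM v_star opprK.
    by rewrite !cmulE mulrA -(mulrA (star (pi _))) vV mulr1.
  - move=> l c hl; have [p cE] := q_Nk_surj c.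
    rewrite path_sumE // g0 // cE (spath_sum s_univ p hl) star_hom_sum //.
    rewrite big_seq [RHS]big_seq; apply: eq_bigr => m.
    move=> /(mem_path_seq _ _ hl)[_ dm].
    rewrite (gE m p dm) piM piS -cmulE starM v_star opprK !cmulE.
    by rewrite -!mulrA -piS v_pi' (mulrA (pi _) (v _)) v_pi' -!mulrA mulrA vVl mul1r.
(* Each g_l commutes with v, so [phiB] lands in the commutant of v. Hence v on H commutes with the
   image of [phiB], and [rho] lands in the commutant of that image; this makes [beta]
   multiplicative. *)
pose Kv y := exists x, y = v x.
have Kv_star y : Kv y -> Kv (star y) by move=> [x ->]; exists (- x).
have [phiB [phiBh phiBt phiBv]] : exists phi : B -> mult D,
    [/\ star_hom phi, forall l, phi (t l) = g l
      & forall b, commutant Kv_star (phi b)].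
  apply: (graph_cstar_lift t_univ ckg) => l.
  change (forall y, Kv y -> g l ** y = y ** g l) => _ [x ->].
  have [p lp] := q_Nk_surj (deg l); rewrite (gE l p lp) !cmulE.
  by rewrite -mulrA v_pi' !mulrA -!vD addrC.
pose Kb y := exists b, y = phiB b.
have [_ phiBM phiBS] := phiBh.
have Kb_star y : Kb y -> Kb (star y).
  by move=> [b ->]; exists (star b); rewrite phiBS.
pose w (h : subgroup H) := v (val h).
have rw : unitary_rep w.
  split.
  - by move=> a; rewrite /w /= v0 !cmulE mul1r mulr1.
  - by move=> h h'; rewrite /w /= vD.
  - by move=> h; rewrite /w v_star !cmulE vVl vV v0.
have [rho [rhoh rhou rhob]] : exists rho : C -> mult D,
    [/\ star_hom rho, forall h, rho (u h) = w h
      & forall c, commutant Kb_star (rho c)].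
  apply: (group_cstar_lift u_univ rw) => h.
  change (forall y, Kb y -> w h ** y = y ** w h) => _ [b ->].
  by apply/esym/phiBv; exists (val h).
have [_ rhoM rhoS] := rhoh; have [rhoL _ _] := rhoh; have [phiBL _ _] := phiBh.
pose beta b c := phiB b ** rho c.
have rp b c : rho c ** phiB b = phiB b ** rho c by apply: rhob; exists b.
have [_ tens_lift] := tens_univ.
have [|Psi [[Psih PsiE] _]] := tens_lift (mult D) beta.
  split.
  - by move=> b z c c'; rewrite /beta rhoL cmulDr cmulZr.
  - by move=> c z b b'; rewrite /beta phiBL cmulDl cmulZl.
  - move=> b b' c c'; rewrite /beta phiBM rhoM -!cmulA; congr (_ ** _).
    by rewrite !cmulA rp.
  - by move=> b c; rewrite /beta phiBS rhoS starM -phiBS -rhoS rp.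
exists Psi; split=> // x; rewrite PsiE /beta phiBt rhou /w /=.
have dx : deg (val x).1 = q_Nk H (val x).2 by exact: pullback_degP.
rewrite (gE _ _ dx) cmulE -mulrA v_pi' mulrA vVl mul1r.
by rewrite (spath_val s).
Qed.

End LeftInverse.

Lemma pullback_embedding : exists phi : A -> T, star_hom phi /\ injective phi.
Proof.
have [_ s_lift] := s_univ.
have [phi [[phih phis] _]] := s_lift _ _ twisted_ck.
exists phi; split=> // x y e; apply/eqP; rewrite -subr_eq0; apply/eqP.
have [//|a0] := pselect (x - y = 0).
(* [pi] depends on x - y and need not be faithful; it only has to be nonzero at x - y, which [phi]
   would kill. *)
have [D [pi [v [[pih pia] [v0 vs] vD vpi vrel]]]] := full_rep s_univ N0 a0.
have [Psi [Psih PsiE]] := untwist pih v0 (fun z => vs z I)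
  (fun z z' => vD z z' I I) (fun z a => vpi z a I) vrel.
case: pia; have -> : pi = Psi \o phi.
  apply: (graph_cstar_hom_eq s_univ (ck_star_hom pih ck) pih).
    exact: star_hom_comp phih Psih.
  by move=> z /=; rewrite phis PsiE.
by rewrite /= (star_homB phih) e subrr (star_hom0 Psih).
Qed.

End Embedding.

Theorem theorem3p2 (R : realType) (k : nat) (hk : (1 <= k)%N)
    (H : zmodClosed 'rV[int]_k) (Gamma : pgraph (qNk H))
    (A : cstarAlgType R) (s : pullback (q_Nk H) Gamma -> A)
    (B : cstarAlgType R) (t : Gamma -> B)
    (C : cstarAlgType R) (u : subgroup H -> C)
    (T : cstarAlgType R) (tens : B -> C -> T) :
  graph_cstar s -> graph_cstar t -> group_cstar u -> cstar_tensor tens ->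
  exists phi : A -> T, star_hom phi /\ injective phi.
Proof.
move=> s_univ t_univ u_univ tens_univ.
have [N [K [N0 KH KN]]] := subgroup_retract H.
exact: (pullback_embedding s_univ t_univ u_univ tens_univ N0 KH KN).
Qed.
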